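(* Let $n\geq 2$, let $Q\subset\mathbb{P}^{n+1}$ be a smooth quadric hypersurface, let $D$ be a smooth hyperplane section of $Q$, and let $H\subset\mathbb{P}^{n+1}$ be the hyperplane with $D=Q\cap H$. Then $$\Omega_Q^1(\log D)\cong\varphi_P^*(T\mathbb{P}^n(-2)),$$ where $P$ is the point apolar to $H$ with respect to $Q$ and $\varphi_P:Q\to\mathbb{P}^n$ is the linear projection with center $P$. In particular, the map $D\mapsto\Omega_Q^1(\log D)$ from smooth hyperplane sections of $Q$ to isomorphism classes of vector bundles on $Q$ is injective.
   Context: The base field is algebraically closed of characteristic $0$. $\Omega_Q^1(\log D)$ is the vector bundle of differential $1$-forms with logarithmic poles along $D$ (locally generated by $\Omega_Q^1$ and $df/f$, $f$ a local equation of $D$). The point apolar to $H$ with respect to $Q$ is the pole of $H$: if $Q=\{q=0\}$ with associated non-degenerate symmetric bilinear form $B$, it is the point $P=[v]$ such that $H=\{[w]\mid B(v,w)=0\}$; since $D$ is smooth, $P\notin Q$. *)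

(* Defs.v *)
(* Varieties are classical: a quasi-projective variety over an algebraically
   closed field is a locally closed set of points of projective space, with
   the Zariski topology and its regular functions. *)
From HB Require Import structures.
From mathcomp Require Import all_boot all_order all_algebra.
From mathcomp Require Import boolp classical_sets functions.
From mathcomp Require Import mpoly.

Set Implicit Arguments.
Unset Strict Implicit.
Unset Printing Implicit Defensive.

Import GRing.Theory.
Local Open Scope classical_set_scope.
Local Open Scope ring_scope.

(* Points of P^N are the lines through 0 in k^(N+1). *)
Definition Pn (k : fieldType) (N : nat) :=
  {L : {vspace 'rV[k]_N.+1} | \dim L == 1%N}.

(* A nonzero vector on the line x. The choice is not algebraic in x, so [rep]
   may only be used in expressions with a controlled homogeneity. *)
Definition rep (k : fieldType) (N : nat) (x : Pn k N) : 'rV[k]_N.+1 :=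
  vpick (val x).

Definition value (k : fieldType) (N : nat) (F : {mpoly k[N.+1]})
  (v : 'rV[k]_N.+1) : k := F.@[v 0].

Definition is_homog (k : fieldType) (N d : nat) (F : {mpoly k[N.+1]}) :=
  F \is d.-homog for mdeg.

Section Projective.
Variables (k : fieldType) (N : nat).
Implicit Types (X U V W D : set (Pn k N)) (x y : Pn k N) (f g : Pn k N -> k).

Definition zeros (s : seq {mpoly k[N.+1]}) : set (Pn k N) :=
  [set x | forall F, F \in s -> value F (rep x) = 0].

(* Jacobian criterion: the subscheme defined by the homogeneous polynomials s
   is smooth of codimension [size s] at each of its points. *)
Definition jacobian_smooth (s : seq {mpoly k[N.+1]}) : Prop :=
  forall x, zeros s x ->
    row_free (\matrix_(i < size s, j < N.+1) value (s`_i)^`M(j) (rep x)).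

Definition open_in X U : Prop :=
  U `<=` X /\
  forall x, U x -> exists (d : nat) (F : {mpoly k[N.+1]}),
    [/\ is_homog d F, value F (rep x) != 0 &
        forall y, X y -> value F (rep y) != 0 -> U y].

Definition nbhd_in X x U : Prop := open_in X U /\ U x.

(* Regular sections of O_X(d) over U. The fibre of O(d) at x consists of the
   functions of degree d on the punctured line x; it is identified with k by
   evaluation at [rep x]. Locally a section is G / H, with G and H homogeneous
   and deg G - deg H = d. *)
Definition sectO X (d : int) U f : Prop :=
  forall x, U x -> exists W (a b : nat) (G H : {mpoly k[N.+1]}),
    [/\ nbhd_in X x W, W `<=` U, is_homog a G /\ is_homog b H,
        a%:Z = b%:Z + d &
        forall y, W y -> value H (rep y) != 0 /\
          f y = value G (rep y) / value H (rep y)].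

Definition regular X U f : Prop := sectO X 0 U f.

Definition regular_at X x f : Prop := exists U, nbhd_in X x U /\ regular X U f.

Definition same_germ X x f g : Prop :=
  exists U, nbhd_in X x U /\ forall y, U y -> f y = g y.

(* Derivations O_{X,x} -> k. They are extended by 0 to the functions that are
   not regular at x, so that each one is a unique element of this type. *)
Definition derivation_prop X x (v : (Pn k N -> k) -> k^o) : Prop :=
  [/\ forall f, ~ regular_at X x f -> v f = 0,
      forall f g, regular_at X x f -> regular_at X x g -> same_germ X x f g ->
        v f = v g,
      forall a f g, regular_at X x f -> regular_at X x g ->
        v (fun y => a * f y + g y) = a * v f + v g &
      forall f g, regular_at X x f -> regular_at X x g ->
        v (fun y => f y * g y) = f x * v g + g x * v f].

Definition derivation X x : pred ((Pn k N -> k) -> k^o) :=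
  fun v => `[< derivation_prop X x v >].

Lemma derivation_submod X x : submod_closed (derivation X x).
Proof.
split.
  by apply/asboolP; split => // *; rewrite /GRing.zero /= ?mulr0 ?addr0.
move=> a u v /asboolP [u0 ug ua um] /asboolP [v0 vg va vm]; apply/asboolP.
have E h : (a *: u + v) h = a * u h + v h by [].
split=> [f nf|f g rf rg fg|b f g rf rg|f g rf rg]; rewrite !E.
- by rewrite u0 ?v0 // mulr0 addr0.
- by rewrite (ug f g) ?(vg f g).
- by rewrite ua ?va // !mulrDr addrACA mulrCA.
- by rewrite um ?vm // !mulrDr addrACA !(mulrCA a).
Qed.

HB.instance Definition _ X x := GRing.isSubmodClosed.Build k
  ((Pn k N -> k) -> k^o) (derivation X x) (derivation_submod X x).

(* The Zariski tangent space T_x X. *)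
Record tangent X x := Tangent {
  tan_fun :> (Pn k N -> k) -> k^o;
  tan_funP : derivation X x tan_fun }.

HB.instance Definition _ X x := [isSub for @tan_fun X x].
HB.instance Definition _ X x := [Choice of tangent X x by <:].
HB.instance Definition _ X x := [SubChoice_isSubLmodule of tangent X x by <:].

Definition lin_form X x : pred (tangent X x -> k^o) :=
  fun w => `[< forall a u v, w (a *: u + v) = a * w u + w v >].

Lemma lin_form_submod X x : submod_closed (@lin_form X x).
Proof.
split; first by apply/asboolP => a u v; rewrite /GRing.zero /= mulr0 addr0.
move=> a w w' /asboolP hw /asboolP hw'; apply/asboolP => b u v.
have E h : (a *: w + w') h = a * w h + w' h by [].
by rewrite !E hw hw' !mulrDr addrACA mulrCA.
Qed.

HB.instance Definition _ X x := GRing.isSubmodClosed.Build k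
  (tangent X x -> k^o) (@lin_form X x) (lin_form_submod X x).

Record cotangent X x := Cotangent {
  cot_fun :> tangent X x -> k^o;
  cot_funP : lin_form cot_fun }.

HB.instance Definition _ X x := [isSub for @cot_fun X x].
HB.instance Definition _ X x := [Choice of cotangent X x by <:].
HB.instance Definition _ X x := [SubChoice_isSubLmodule of cotangent X x by <:].

Lemma differential_subproof X x f :
  lin_form (fun v : tangent X x => tan_fun v f).
Proof. by apply/asboolP => a u v. Qed.

(* d_x f, for f regular at x. *)
Definition differential X x f : cotangent X x :=
  Cotangent (@differential_subproof X x f).

(* A family of vector spaces with, for each open U, a set of regular sections
   over U. Sections are total dependent functions; only their values on U
   matter. *)
Record vfamily := VFamily {
  vf_fib : Pn k N -> lmodType k;
  vf_sec : set (Pn k N) -> set (forall x, vf_fib x) }.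

(* A sheaf of O_X-modules whose sections over U are given by functions on
   U `&` ms_dom: two sections over U are identified when they agree there.
   A family of vector spaces is the case ms_dom = setT; a proper open dense
   ms_dom describes a subsheaf of the direct image of a sheaf on ms_dom. *)
Record modsheaf := ModSheaf {
  ms_fib : Pn k N -> lmodType k;
  ms_dom : set (Pn k N);
  ms_sec : set (Pn k N) -> set (forall x, ms_fib x) }.

Arguments vf_sec : clear implicits.
Arguments ms_sec : clear implicits.

Definition sheaf_of_family (E : vfamily) : modsheaf :=
  ModSheaf setT (vf_sec E).
Coercion sheaf_of_family : vfamily >-> modsheaf.

Definition eq_sec (E : modsheaf) U (s t : forall x, ms_fib E x) : Prop :=
  forall x, U x -> ms_dom E x -> s x = t x.

Definition iso_sheaf X (E F : modsheaf) : Prop :=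
  exists Phi : set (Pn k N) ->
      (forall x, ms_fib E x) -> (forall x, ms_fib F x),
    (forall U, open_in X U ->
      [/\ forall s, ms_sec E U s -> ms_sec F U (Phi U s),
          forall s t, ms_sec E U s -> ms_sec E U t ->
            eq_sec U s t <-> eq_sec U (Phi U s) (Phi U t),
          forall r, ms_sec F U r ->
            exists2 s, ms_sec E U s & eq_sec U (Phi U s) r,
          forall s t, ms_sec E U s -> ms_sec E U t ->
            eq_sec U (Phi U (fun x => s x + t x))
                     (fun x => Phi U s x + Phi U t x) &
          forall f s, regular X U f -> ms_sec E U s ->
            eq_sec U (Phi U (fun x => f x *: s x))
                     (fun x => f x *: Phi U s x)]) /\
    (forall U V s, open_in X U -> open_in X V -> V `<=` U -> ms_sec E U s ->
      eq_sec V (Phi V s) (Phi U s)).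

(* Locally free of finite rank. *)
Definition is_vector_bundle X (E : modsheaf) : Prop :=
  forall x, X x -> exists U (r : nat) (e : 'I_r -> forall y, ms_fib E y),
    [/\ nbhd_in X x U, forall i, ms_sec E U (e i) &
     forall V, open_in X V -> V `<=` U ->
      let comb (f : 'I_r -> Pn k N -> k) : forall y, ms_fib E y :=
        fun y : Pn k N => \sum_(i < r) f i y *: e i y in
      [/\ forall f : 'I_r -> Pn k N -> k, (forall i, regular X V (f i)) ->
            ms_sec E V (comb f),
          forall s, ms_sec E V s -> exists f : 'I_r -> Pn k N -> k,
            (forall i, regular X V (f i)) /\ eq_sec V s (comb f) &
          forall f g : 'I_r -> Pn k N -> k, (forall i, regular X V (f i)) ->
            (forall i, regular X V (g i)) -> eq_sec V (comb f) (comb g) ->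
            forall i y, V y -> f i y = g i y]].

(* The tangent bundle: vector fields sending regular functions to regular
   functions. *)
Definition tangent_bundle X : vfamily :=
  @VFamily (fun x => tangent X x) (fun U s =>
    forall W f, open_in X W -> W `<=` U -> regular X W f ->
      regular X W (fun y => s y f)).

(* The cotangent bundle: 1-forms that locally are sums of a_i * d b_i. *)
Definition cotangent_bundle X : vfamily :=
  @VFamily (fun x => cotangent X x) (fun U w =>
    forall x, U x -> exists W (m : nat) (a b : 'I_m -> Pn k N -> k),
      [/\ nbhd_in X x W, W `<=` U,
          forall i, regular X W (a i) /\ regular X W (b i) &
          forall y, W y ->
            w y = \sum_(i < m) a i y *: differential X y (b i)]).

(* E(d) = E (x) O(d). With the identification of O(d)_x with k explained at
   [sectO], the fibre of E(d) at x is that of E. *)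
Definition twist X (E : vfamily) (d : int) : vfamily :=
  @VFamily (vf_fib E) (fun U s =>
    forall x, U x -> exists W (m : nat) (g : 'I_m -> Pn k N -> k)
        (t : 'I_m -> forall y, vf_fib E y),
      [/\ nbhd_in X x W, W `<=` U,
          forall i, sectO X d W (g i) /\ vf_sec E W (t i) &
          forall y, W y -> s y = \sum_(i < m) g i y *: t i y]).

(* f generates the ideal sheaf of D (with its reduced structure) on U. *)
Definition local_equation X D U f : Prop :=
  [/\ regular X U f, forall y, U y -> D y -> f y = 0 &
      forall x V g, nbhd_in X x V -> V `<=` U -> regular X V g ->
        (forall y, V y -> D y -> g y = 0) ->
        exists W h, [/\ nbhd_in X x W, W `<=` V, regular X W h &
                        forall y, W y -> g y = h y * f y]].

(* Omega^1_X(log D), as the subsheaf of the direct image of Omega^1_{X\D}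
   locally generated by Omega^1_X and df/f, f a local equation of D. *)
Definition Omega_log X D : modsheaf :=
  @ModSheaf (fun x => cotangent X x) (~` D) (fun U w =>
    forall x, U x -> exists W (al : forall y, cotangent X y) c f,
      [/\ nbhd_in X x W, W `<=` U, vf_sec (cotangent_bundle X) W al,
          regular X W c /\ local_equation X D W f &
          forall y, W y -> ~ D y ->
            w y = al y + (c y / f y) *: differential X y f]).

Definition polar_form (q : {mpoly k[N.+1]}) (v w : 'rV[k]_N.+1) : k :=
  (value q (v + w) - value q v - value q w) / 2%:R.

(* P is the pole of the hyperplane {l = 0} with respect to {q = 0}. *)
Definition is_apolar (q l : {mpoly k[N.+1]}) (P : Pn k N) : Prop :=
  forall x, zeros [:: l] x <-> polar_form q (rep P) (rep x) = 0.

(* l is the equation of a hyperplane cutting a smooth section of {q = 0}. *)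
Definition cuts_smoothly (q l : {mpoly k[N.+1]}) : Prop :=
  [/\ is_homog 1 l, l != 0 & jacobian_smooth [:: q; l]].

Definition smooth_hyperplane_section (q : {mpoly k[N.+1]}) D : Prop :=
  exists2 l, cuts_smoothly q l & D = zeros [:: q; l].

End Projective.

Arguments vf_sec {k N}.
Arguments ms_sec {k N}.

(* phi^* E on X, for a map phi defined on X (phi may take arbitrary values
   outside X): sections are locally sums of f_i * (t_i o phi). *)
Definition pullback (k : fieldType) (N M : nat) (X : set (Pn k N))
    (Y : set (Pn k M)) (phi : Pn k N -> Pn k M) (E : vfamily k M)
    : vfamily k N :=
  @VFamily k N (fun x => vf_fib E (phi x)) (fun U s =>
    forall x, U x -> exists W (V : set (Pn k M)) (m : nat)
        (f : 'I_m -> Pn k N -> k) (t : 'I_m -> forall y, vf_fib E y),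
      [/\ nbhd_in X x W /\ W `<=` U, open_in Y V, forall y, W y -> V (phi y),
          forall i, regular X W (f i) /\ vf_sec E V (t i) &
          forall y, W y -> s y = \sum_(i < m) f i y *: t i (phi y)]).

(* phi is, away from P, a linear projection P^(n+1) --> P^n with center P; its
   value at P is irrelevant. *)
Definition is_projection_from (k : fieldType) (n : nat) (P : Pn k n.+1)
    (phi : Pn k n.+1 -> Pn k n) : Prop :=
  exists2 A : 'Hom('rV[k]_n.+2, 'rV[k]_n.+1), lker A = val P &
    forall x, x != P -> val (phi x) = (A @: val x)%VS.

Definition TPn_twisted (k : fieldType) (n : nat) : vfamily k n :=
  twist setT (tangent_bundle setT) (-2).

(* Main.v *)
(* Let V = k^(n+2), q(v) = B(v, v) and l = B(., p), where P = [p]. The forms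
   dx_j - x_j dl/l generate Omega_Q^1(log D) with coefficients in O(-1), and the
   relations between them are dl - l dl/l = 0 and dq = 0: identifying linear
   forms with vectors by B, the fibre of Omega_Q^1(log D)(1) at x is V / <p, x>.
   The Euler sequence gives the same description of the pull-back of TP^n(-1) by
   the projection from P, whence the isomorphism.
   For the injectivity, let x(t) = y + t p + t^2 z be a conic on Q whose plane
   contains P, with y, z in D. On it the sheaf of D has the nowhere vanishing
   section z / <p, x(t)>. If the plane does not contain P', the image of this
   section in V / <p', x(t)> pairs with the linear forms vanishing on p' and x(t)
   to polynomials in t that tend to 0 at infinity, so it is 0, a contradiction.
   Hence every such plane through P contains P', and P = P'. *)
Require Import Defs.
From mathcomp Require Import all_boot all_order all_algebra.
From mathcomp Require Import boolp classical_sets functions.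
From mathcomp Require Import mpoly.
From mathcomp Require Import ring.
Import GRing.Theory.
Local Open Scope ring_scope.

Set Implicit Arguments.
Unset Strict Implicit.
Unset Printing Implicit Defensive.
Local Open Scope classical_set_scope.

(** * Values and derivatives of polynomials *)

(** Both sheaves are brought to one format, [presented]: the quotient of O(-1)^(n+1) by the image of
    O(-2) under x |-> x M, with M a matrix of the projection from p. The isomorphism is then formal.
    Since [rep] is not algebraic and the forms of [Omega_log] are known only off D, a section is
    described near each point by a vector of fractions of degree -1, unique modulo the line of x M;
    irreducibility of Q carries this uniqueness across D. The conic argument compares splitting
    types. On a conic C, O(-1) has degree -2. If the plane of C contains the pole, the sheaf
    restricts to O + O(-2)^(n-1), with a nowhere vanishing section; if not, to O(-1)^2 +
    O(-2)^(n-2), without nonzero sections. An isomorphism in the sense of [iso_sheaf] acts only on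
    sections over open sets of Q, so restriction to C is replaced by two facts: it preserves
    vanishing at a point ([iso_vanish]), and the section on C comes from sections on two open sets
    of Q that cover C. *)

Lemma mpoly_ring_ind (R : comNzRingType) (n : nat) (P : {mpoly R[n]} -> Prop) :
  (forall c, P c%:MP) -> (forall i, P 'X_i) ->
  (forall F G, P F -> P G -> P (F + G)) ->
  (forall F G, P F -> P G -> P (F * G)) -> forall F, P F.
Proof.
move=> PC PX PD PM; elim/mpolyind => [|c m F _ _ PF]; first exact: (PC 0).
apply: (PD) => //; rewrite -mul_mpolyC; apply: (PM); first exact: PC.
rewrite mpolyXE_id; elim/big_ind: _ => [||i _]; [exact: (PC 1)|exact: PM|].
by elim: (m i) => [|e IH]; [exact: (PC 1)|rewrite exprS; exact: PM].
Qed.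

Section Value.
Variables (k : fieldType) (N : nat).
Implicit Types (F G H : {mpoly k[N.+1]}) (u v w : 'rV[k]_N.+1).

Lemma valueD F G v : value (F + G) v = value F v + value G v.
Proof. exact: mevalD. Qed.

Lemma valueB F G v : value (F - G) v = value F v - value G v.
Proof. exact: mevalB. Qed.

Lemma valueM F G v : value (F * G) v = value F v * value G v.
Proof. exact: mevalM. Qed.

Lemma valueZ c F v : value (c *: F) v = c * value F v.
Proof. exact: mevalZ. Qed.

Lemma valueX i v : value 'X_i v = v 0 i.
Proof. exact: mevalXU. Qed.

Lemma valueC c v : value c%:MP v = c.
Proof. exact: mevalC. Qed.

Lemma value1 v : value 1 v = 1.
Proof. exact: meval1. Qed.

Lemma value0 v : value 0 v = 0.
Proof. exact: meval0. Qed.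

Lemma value_sum (I : Type) (r : seq I) (P : pred I) (F : I -> {mpoly k[N.+1]}) v :
  value (\sum_(i <- r | P i) F i) v = \sum_(i <- r | P i) value (F i) v.
Proof. exact: raddf_sum. Qed.

Lemma valueXn F m v : value (F ^+ m) v = value F v ^+ m.
Proof. exact: rmorphXn. Qed.

Lemma value_prod (I : Type) (r : seq I) (P : pred I) (F : I -> {mpoly k[N.+1]}) v :
  value (\prod_(i <- r | P i) F i) v = \prod_(i <- r | P i) value (F i) v.
Proof. exact: rmorph_prod. Qed.

Lemma value_scale d F c v :
  is_homog d F -> value F (c *: v) = c ^+ d * value F v.
Proof.
move=> /dhomogP hF; rewrite /value !mevalE mulr_sumr.
apply: eq_big_seq => m /hF <-; rewrite mulrCA; congr (_ * _).
under eq_bigr => i _ do rewrite mxE exprMn.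
by rewrite big_split /= prodrXr -mdegE.
Qed.

Definition dir_deriv F v w := \sum_j w 0 j * value F^`M(j) v.

Lemma dir_derivD F G v w :
  dir_deriv (F + G) v w = dir_deriv F v w + dir_deriv G v w.
Proof.
rewrite /dir_deriv -big_split; apply: eq_bigr => j _ /=.
by rewrite mderivD valueD mulrDr.
Qed.

Lemma dir_derivM F G v w :
  dir_deriv (F * G) v w = dir_deriv F v w * value G v + value F v * dir_deriv G v w.
Proof.
rewrite /dir_deriv mulr_suml mulr_sumr -big_split; apply: eq_bigr => j _ /=.
rewrite mderivM valueD !valueM; ring.
Qed.

Lemma dir_derivC c v w : dir_deriv c%:MP v w = 0.
Proof. by apply: big1 => j _; rewrite mderivC value0 mulr0. Qed.

Lemma value_mderivX i j v : value ('X_i)^`M(j) v = (i == j)%:R.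
Proof.
rewrite mderivX mnm1E eq_sym; case: eqP => [->|_]; last by rewrite scale0r value0.
have -> : (U_(i) - U_(i))%MM = 0%MM :> 'X_{1..N.+1}.
  by apply/mnmP => l; rewrite mnmBE subnn mnm0E.
by rewrite mpolyX0 valueZ value1 mulr1.
Qed.

Lemma dir_derivX i v w : dir_deriv 'X_i v w = w 0 i.
Proof.
rewrite /dir_deriv (bigD1 i) //= value_mderivX eqxx mulr1 big1 ?addr0 // => j ne.
by rewrite value_mderivX eq_sym (negbTE ne) mulr0.
Qed.

Lemma dir_derivZ c F v w : dir_deriv (c *: F) v w = c * dir_deriv F v w.
Proof. by rewrite -mul_mpolyC dir_derivM dir_derivC mul0r add0r valueC. Qed.

Lemma dir_derivB F G v w :
  dir_deriv (F - G) v w = dir_deriv F v w - dir_deriv G v w.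
Proof. by rewrite -scaleN1r dir_derivD dir_derivZ mulN1r. Qed.

Lemma dir_deriv_sum (I : Type) (r : seq I) (P : pred I) (F : I -> {mpoly k[N.+1]}) v w :
  dir_deriv (\sum_(i <- r | P i) F i) v w = \sum_(i <- r | P i) dir_deriv (F i) v w.
Proof.
elim/big_rec2: _ => [|i G x _ <-]; first exact: dir_derivC.
by rewrite dir_derivD.
Qed.

Lemma dir_deriv_linear F v a w w' :
  dir_deriv F v (a *: w + w') = a * dir_deriv F v w + dir_deriv F v w'.
Proof.
rewrite /dir_deriv mulr_sumr -big_split; apply: eq_bigr => j _ /=.
by rewrite !mxE mulrDl mulrA.
Qed.

Lemma mderiv_homog d F j : is_homog d.+1 F -> is_homog d F^`M(j).
Proof.
move=> /dhomogP hF; apply/dhomogP => m.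
rewrite mcoeff_msupp mcoeff_mderiv => ne0.
have /hF : (m + U_(j))%MM \in msupp F.
  by rewrite mcoeff_msupp; apply: contraNneq ne0 => ->; rewrite mul0rn.
by rewrite /= mdegD mdeg1 addn1 => -[].
Qed.

Lemma sum_homog (I : Type) (r : seq I) (P : pred I) d (F : I -> {mpoly k[N.+1]}) :
  (forall i, P i -> is_homog d (F i)) -> is_homog d (\sum_(i <- r | P i) F i).
Proof. by move=> hF; apply: rpred_sum. Qed.

Lemma homogX i : is_homog 1 ('X_i : {mpoly k[N.+1]}).
Proof. by rewrite /is_homog dhomogX /= mdeg1. Qed.

Lemma homog1 : is_homog 0 (1 : {mpoly k[N.+1]}).
Proof. exact: dhomog1. Qed.

Definition lin_poly (L : 'cV[k]_N.+1) : {mpoly k[N.+1]} := \sum_i L i 0 *: 'X_i.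

Lemma lin_poly_homog L : is_homog 1 (lin_poly L).
Proof. by apply: sum_homog => i _; apply/dhomogZ/homogX. Qed.

Lemma value_lin_poly L v : value (lin_poly L) v = (v *m L) 0 0.
Proof.
by rewrite value_sum mxE; apply: eq_bigr => i _; rewrite valueZ valueX mulrC.
Qed.

Lemma dir_deriv_lin_poly L v w : dir_deriv (lin_poly L) v w = (w *m L) 0 0.
Proof.
rewrite dir_deriv_sum mxE; apply: eq_bigr => i _.
by rewrite dir_derivZ dir_derivX mulrC.
Qed.

Lemma mdeg1_mnm1 (m : 'X_{1..N.+1}) : mdeg m = 1%N -> exists i, m = U_(i)%MM.
Proof.
move=> m1; have : m != 0%MM by rewrite -mdeg_eq0 m1.
move=> mn0; have [i mi] : exists i, m i != 0%N.
  apply/existsP; apply: contraNT mn0; rewrite negb_exists => /forallP h.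
  by apply/eqP/mnmP => i; rewrite mnm0E; move: (h i); rewrite negbK => /eqP.
exists i; have le : (U_(i) <= m)%MM by rewrite lep1mP.
have d0 : mdeg (m - U_(i))%MM = 0%N.
  by have := mdegD (m - U_(i)) U_(i); rewrite submK // m1 mdeg1 addn1 => -[].
by move/eqP: d0; rewrite mdeg_eq0 => /eqP d0; rewrite -(submK le) d0 add0m.
Qed.

Lemma homog1_lin_poly F : is_homog 1 F -> exists L, F = lin_poly L.
Proof.
move=> /dhomogP hF.
exists (\sum_(m <- msupp F) \col_i (F@_m * (m == U_(i)%MM)%:R)).
rewrite [LHS]mpolyE /lin_poly.
under [RHS]eq_bigr => i _ do rewrite summxE scaler_suml.
rewrite exchange_big /=; apply: eq_big_seq => m /hF /mdeg1_mnm1 [i ->].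
rewrite (bigD1 i) //= !mxE eqxx mulr1 big1 ?addr0 // => j ne.
rewrite mxE (_ : _ == _ = false) ?mulr0 ?scale0r //.
apply/negbTE; apply: contraNneq ne => /mnmP /(_ i).
by rewrite !mnm1E eqxx; case: (j =P i).
Qed.

(** Collect the monomials X_i X_j into a matrix, one at a time, then symmetrise it; this is where 2
    is inverted. *)
Lemma homog2_quad_form F : 2%:R != 0 :> k -> is_homog 2 F ->
  exists2 S : 'M[k]_N.+1, S^T = S &
    (forall v, value F v = (v *m S *m v^T) 0 0) /\
    (forall v w, dir_deriv F v w = 2%:R * (v *m S *m w^T) 0 0).
Proof.
move=> two /dhomogP hF.
have formE (S : 'M[k]_N.+1) u v :
    (u *m S *m v^T) 0 0 = \sum_i \sum_j S i j * (u 0 i * v 0 j).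
  rewrite mxE exchange_big; apply: eq_bigr => j _; rewrite mxE mulr_suml.
  by apply: eq_bigr => i _; rewrite !mxE mulrCA mulrA.
pose G (S : 'M[k]_N.+1) : {mpoly k[N.+1]} := \sum_i \sum_j S i j *: ('X_i * 'X_j).
have [S ->] : exists S, F = G S.
  suff: forall s : seq 'X_{1..N.+1}, {subset s <= msupp F} ->
      exists S, \sum_(m <- s) F@_m *: 'X_[m] = G S.
    by case/(_ (msupp F) (fun m => id)) => S GS; exists S; rewrite -GS -mpolyE.
  elim=> [_|m s IH sub].
    exists 0; rewrite big_nil /G big1 // => i _; rewrite big1 // => j _.
    by rewrite mxE scale0r.
  rewrite big_cons; have [S ->] : exists S, \sum_(m <- s) F@_m *: 'X_[m] = G S.
    by apply: IH => m' ms; apply: sub; rewrite inE ms orbT.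
  have /hF dm : m \in msupp F by apply: sub; rewrite inE eqxx.
  have : m != 0%MM by rewrite -mdeg_eq0 dm.
  move=> mn0; have [i mi] : exists i, m i != 0%N.
    apply/existsP; apply: contraNT mn0; rewrite negb_exists => /forallP h.
    by apply/eqP/mnmP => i; rewrite mnm0E; move: (h i); rewrite negbK => /eqP.
  have le : (U_(i) <= m)%MM by rewrite lep1mP.
  have [j mE] : exists j, (m - U_(i))%MM = U_(j)%MM.
    apply: mdeg1_mnm1.
    by have := mdegD (m - U_(i)) U_(i); rewrite submK // dm mdeg1 addn1 => -[].
  exists (F@_m *: delta_mx j i + S).
  rewrite /G; under [RHS]eq_bigr => a _.
    under eq_bigr => b _ do rewrite mxE scalerDl.
    rewrite big_split /=; over.
  rewrite big_split /=; congr (_ + _).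
  rewrite (bigD1 j) //= (bigD1 i) //= !mxE !eqxx mulr1.
  rewrite [X in _ + X + _]big1 ?addr0; last first.
    by move=> b ne; rewrite !mxE (negbTE ne) andbF mulr0 scale0r.
  rewrite big1 ?addr0; last first.
    move=> a ne; apply: big1 => b _.
    by rewrite !mxE (negbTE ne) mulr0 scale0r.
  by rewrite -mpolyXD -mE submK.
exists (2%:R^-1 *: (S + S^T)).
  by rewrite linearZ linearD /= trmxK addrC.
have symE u v : (u *m (2%:R^-1 *: (S + S^T)) *m v^T) 0 0 =
    2%:R^-1 * ((u *m S *m v^T) 0 0 + (v *m S *m u^T) 0 0).
  have -> : (v *m S *m u^T) 0 0 = (u *m S^T *m v^T) 0 0.
    rewrite -[v *m S *m u^T]trmxK mxE; congr (_ 0 0).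
    by rewrite !trmx_mul !trmxK mulmxA.
  by rewrite -scalemxAr -scalemxAl mxE mulmxDr mulmxDl mxE.
have valG v : value (G S) v = (v *m S *m v^T) 0 0.
  rewrite formE value_sum; apply: eq_bigr => i _; rewrite value_sum.
  by apply: eq_bigr => j _; rewrite valueZ valueM !valueX.
split=> [v|v w]; rewrite symE; first by rewrite valG; field.
rewrite mulrA mulfV // mul1r /G dir_deriv_sum addrC !formE -big_split /=.
apply: eq_bigr => i _; rewrite dir_deriv_sum -big_split; apply: eq_bigr => j _ /=.
by rewrite dir_derivZ dir_derivM !dir_derivX !valueX -mulrDr.
Qed.

Definition along (g : 'I_N.+1 -> {poly k}) F : {poly k} := mmap polyC g F.

Lemma horner_along g F t : (along g F).[t] = value F (\row_i (g i).[t]).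
Proof.
rewrite /along; elim/mpoly_ring_ind: F => [c|i|F G IF IG|F G IF IG].
- by rewrite mmapC hornerC valueC.
- by rewrite mmapX mmap1U valueX mxE.
- by rewrite mmapD hornerD IF IG valueD.
- by rewrite rmorphM hornerM IF IG valueM.
Qed.

Lemma deriv_along g F t : (along g F)^`().[t] =
  dir_deriv F (\row_i (g i).[t]) (\row_i (g i)^`().[t]).
Proof.
rewrite /along; elim/mpoly_ring_ind: F => [c|i|F G IF IG|F G IF IG].
- by rewrite mmapC derivC hornerC dir_derivC.
- by rewrite mmapX mmap1U dir_derivX mxE.
- by rewrite mmapD derivD hornerD IF IG dir_derivD.
- rewrite rmorphM derivM hornerD !hornerM IF IG dir_derivM.
  by rewrite -!horner_along.
Qed.

End Value.

(** * Points, open sets and sections of O(d) *)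

Section Points.
Variables (k : fieldType) (N : nat).
Implicit Types (x y : Pn k N) (v w : 'rV[k]_N.+1).

Lemma rep_neq0 x : rep x != 0.
Proof.
by rewrite vpick0 -dimv_eq0; case: x => L /= /eqP ->.
Qed.

Lemma val_rep x : val x = <[rep x]>%VS.
Proof.
apply/eqP; rewrite eq_sym eqEdim -memvE memv_pick dim_vline rep_neq0 /=.
by case: x => L /= /eqP ->.
Qed.

Lemma Pn_of_vec v : v != 0 -> exists x c, c != 0 /\ rep x = c *: v.
Proof.
move=> v0; have d1 : \dim <[v]>%VS == 1%N by rewrite dim_vline v0.
pose x : Pn k N := exist _ <[v]>%VS d1; exists x.
have /vlineP [c cE] : rep x \in <[v]>%VS by rewrite -[<[v]>%VS]/(val x) memv_pick.
exists c; split=> //; apply: contra (rep_neq0 x) => /eqP c0.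
by rewrite cE c0 scale0r.
Qed.

Lemma rep_coord x : exists i, rep x 0 i != 0.
Proof.
apply/existsP; apply: contraNT (rep_neq0 x); rewrite negb_exists => /forallP h.
by apply/eqP/rowP => i; rewrite mxE; move: (h i); rewrite negbK => /eqP.
Qed.

Lemma value_rep_eq0 d F x c v :
  is_homog d F -> c != 0 -> rep x = c *: v ->
  (value F (rep x) == 0) = (value F v == 0).
Proof.
move=> hF c0 ->; rewrite (value_scale _ _ hF) mulf_eq0 expf_eq0.
by rewrite (negbTE c0) andbF.
Qed.

End Points.

Section Sections.
Variables (k : fieldType) (N : nat) (X : set (Pn k N)).
Implicit Types (U V W : set (Pn k N)) (x y : Pn k N) (f g : Pn k N -> k).
Implicit Types (F G H : {mpoly k[N.+1]}) (d e : int).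

Definition basic_open H : set (Pn k N) := [set x | X x /\ value H (rep x) != 0].

Lemma basic_open_in b H : is_homog b H -> open_in X (basic_open H).
Proof.
move=> hH; split=> [x []|x [_ Hx]] //.
by exists b, H; split.
Qed.

Lemma basic_nbhd b H x : is_homog b H -> X x -> value H (rep x) != 0 ->
  nbhd_in X x (basic_open H).
Proof. by move=> hH Xx Hx; split; [apply: basic_open_in hH|]. Qed.

Lemma open_inI U V : open_in X U -> open_in X V -> open_in X (U `&` V).
Proof.
move=> [UX oU] [VX oV]; split=> [x [Ux _]|x [Ux Vx]]; first exact: UX.
have [a [F [hF Fx FU]]] := oU x Ux; have [b [G [hG Gx GV]]] := oV x Vx.
exists (a + b)%N, (F * G); split; first exact: dhomogM.
  by rewrite valueM mulf_neq0.
by move=> y Xy; rewrite valueM mulf_eq0 negb_or => /andP [Fy Gy]; split; auto.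
Qed.

Lemma nbhd_inI x U V : nbhd_in X x U -> nbhd_in X x V -> nbhd_in X x (U `&` V).
Proof. by move=> [oU Ux] [oV Vx]; split; [apply: open_inI|]. Qed.

Lemma open_in_setT : open_in X X.
Proof.
split=> // x Xx; exists 0%N, 1; split; [exact: homog1|by rewrite value1 oner_eq0|].
by [].
Qed.

(** Compared with [sectO], the neighbourhood is the set where the denominator does not vanish. Two
    such fractions are then combined by multiplying denominators, without handling open sets. *)
Definition frac_at d U f x := exists (a b : nat) G H,
  [/\ is_homog a G /\ is_homog b H, a%:Z = b%:Z + d, value H (rep x) != 0 &
      forall y, X y -> value H (rep y) != 0 ->
        U y /\ f y = value G (rep y) / value H (rep y)].

Lemma sectO_frac d U f x : sectO X d U f -> U x -> frac_at d U f x.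
Proof.
move=> sf Ux; have [W [a [b [G [H [[oW Wx] WU [hG hH] ab fE]]]]]] := sf x Ux.
(* Multiplying numerator and denominator by the equation F of the complement of the neighbourhood
   shrinks the domain of the fraction into W. *)
have [e [F [hF Fx FW]]] := oW.2 x Wx.
exists (a + e)%N, (b + e)%N, (G * F), (H * F); split.
- by split; apply: dhomogM.
- by rewrite !PoszD ab addrAC.
- by rewrite valueM mulf_neq0 //; case: (fE x Wx).
- move=> y Xy; rewrite !valueM mulf_eq0 negb_or => /andP [Hy Fy].
  have Wy := FW y Xy Fy; split; first exact: WU.
  by have [_ ->] := fE y Wy; rewrite -mulf_div divff // mulr1.
Qed.

Lemma frac_sectO d U f : U `<=` X -> (forall x, U x -> frac_at d U f x) ->
  sectO X d U f.
Proof.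
move=> UX hf x Ux; have [a [b [G [H [[hG hH] ab Hx fE]]]]] := hf x Ux.
exists (basic_open H), a, b, G, H; split=> //.
- exact: basic_nbhd hH (UX x Ux) Hx.
- by move=> y [Xy Hy]; case: (fE y Xy Hy).
- by move=> y [Xy Hy]; case: (fE y Xy Hy).
Qed.

Lemma sectO_ext d U f g : (forall y, U y -> f y = g y) ->
  sectO X d U f -> sectO X d U g.
Proof.
move=> fg sf x Ux; have [W [a [b [G [H [nW WU hGH ab fE]]]]]] := sf x Ux.
exists W, a, b, G, H; split=> // y Wy; have [? <-] := fE y Wy.
by split=> //; rewrite fg //; apply: WU.
Qed.

Lemma sectO_sub d U V f : open_in X V -> V `<=` U -> sectO X d U f -> sectO X d V f.
Proof.
move=> oV VU sf x Vx; have [W [a [b [G [H [nW WU hGH ab fE]]]]]] := sf x (VU x Vx).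
exists (W `&` V), a, b, G, H; split=> //; first exact: nbhd_inI.
- by move=> y [Wy _]; exact: fE.
Qed.

Lemma sectO_local d U f :
  (forall x, U x -> exists2 W, nbhd_in X x W /\ W `<=` U & sectO X d W f) ->
  sectO X d U f.
Proof.
move=> h x Ux; have [W [nW WU] sf] := h x Ux.
have [W' [a [b [G [H [nW' WU' hGH ab fE]]]]]] := sf x nW.2.
by exists W', a, b, G, H; split=> // y /WU' /WU.
Qed.

Lemma sectO_ratio (a b : nat) d U G H : open_in X U -> is_homog a G -> is_homog b H ->
  a%:Z = b%:Z + d -> (forall y, U y -> value H (rep y) != 0) ->
  sectO X d U (fun y => value G (rep y) / value H (rep y)).
Proof.
move=> oU hG hH ab nz x Ux; exists U, a, b, G, H; split=> //.
by move=> y Uy; split=> //; apply: nz.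
Qed.

Lemma sectO_value (a : nat) U G : open_in X U -> is_homog a G ->
  sectO X a%:Z U (fun y => value G (rep y)).
Proof.
move=> oU hG; apply: sectO_ext (sectO_ratio oU hG (homog1 _ _) _ _).
- by move=> y _; rewrite value1 divr1.
- by rewrite add0r.
- by move=> y _; rewrite value1 oner_eq0.
Qed.

Lemma sectO_inv (b : nat) U H : open_in X U -> is_homog b H ->
  (forall y, U y -> value H (rep y) != 0) ->
  sectO X (- b%:Z) U (fun y => (value H (rep y))^-1).
Proof.
move=> oU hH nz; apply: sectO_ext (sectO_ratio oU (homog1 _ _) hH _ nz).
- by move=> y _; rewrite value1 div1r.
- by rewrite subrr.
Qed.

Lemma sectO_coord U i : open_in X U -> sectO X 1 U (fun y => rep y 0 i).
Proof.
move=> oU; apply: sectO_ext (sectO_value oU (homogX _ i)).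
by move=> y _; rewrite valueX.
Qed.

Lemma sectO_cst U c : open_in X U -> sectO X 0 U (fun=> c).
Proof.
move=> oU; have h : is_homog 0 (c%:MP : {mpoly k[N.+1]}).
  by rewrite -[c%:MP]mulr1 mul_mpolyC; apply/dhomogZ/homog1.
by apply: sectO_ext (sectO_value oU h) => y _; rewrite valueC.
Qed.

Lemma sectOD d U f g : U `<=` X -> sectO X d U f -> sectO X d U g ->
  sectO X d U (fun y => f y + g y).
Proof.
move=> UX sf sg; apply: frac_sectO => // x Ux.
have [a [b [G [H [[hG hH] ab Hx fE]]]]] := sectO_frac sf Ux.
have [a' [b' [G' [H' [[hG' hH'] ab' Hx' gE]]]]] := sectO_frac sg Ux.
exists (a + b')%N, (b + b')%N, (G * H' + G' * H), (H * H'); split.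
- split; last exact: dhomogM.
  apply: dhomogD; first exact: dhomogM.
  have -> : (a + b' = a' + b)%N by apply/eqP; rewrite -eqz_nat !PoszD ab ab'; apply/eqP; ring.
  exact: dhomogM.
- by rewrite !PoszD ab addrAC.
- by rewrite valueM mulf_neq0.
- move=> y Xy; rewrite valueM mulf_eq0 negb_or => /andP [Hy Hy'].
  have [Uy ->] := fE y Xy Hy; have [_ ->] := gE y Xy Hy'; split=> //.
  by rewrite valueD !valueM addf_div.
Qed.

Lemma sectOM d e U f g : U `<=` X -> sectO X d U f -> sectO X e U g ->
  sectO X (d + e) U (fun y => f y * g y).
Proof.
move=> UX sf sg; apply: frac_sectO => // x Ux.
have [a [b [G [H [[hG hH] ab Hx fE]]]]] := sectO_frac sf Ux.
have [a' [b' [G' [H' [[hG' hH'] ab' Hx' gE]]]]] := sectO_frac sg Ux.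
exists (a + a')%N, (b + b')%N, (G * G'), (H * H'); split.
- by split; apply: dhomogM.
- by rewrite !PoszD ab ab' addrACA.
- by rewrite valueM mulf_neq0.
- move=> y Xy; rewrite valueM mulf_eq0 negb_or => /andP [Hy Hy'].
  have [Uy ->] := fE y Xy Hy; have [_ ->] := gE y Xy Hy'; split=> //.
  by rewrite !valueM mulf_div.
Qed.

Lemma sectOM' (d e d' : int) U f g : d' = d + e -> U `<=` X ->
  sectO X d U f -> sectO X e U g -> sectO X d' U (fun y => f y * g y).
Proof. by move=> ->; exact: sectOM. Qed.

Lemma sectOZ d U c f : open_in X U -> sectO X d U f -> sectO X d U (fun y => c * f y).
Proof.
move=> oU sf; apply: (sectOM' (d := 0) (e := d)) => //; first by rewrite add0r.
- exact: oU.1.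
- exact: sectO_cst.
Qed.

Lemma sectO0 d U : open_in X U -> sectO X d U (fun=> 0).
Proof.
move=> oU; have [[m ->]|[m ->]] : (exists m : nat, d = m%:Z) \/ (exists m : nat, d = - m%:Z).
- case: d => m; [left|right]; first by exists m.
  by exists m.+1; rewrite NegzE.
- move=> x Ux; exists U, m, 0%N, 0, 1; split=> //.
  + by split; [exact: dhomog0|exact: homog1].
  + by move=> y Uy; rewrite value1 value0 mul0r oner_eq0.
- apply: frac_sectO; first exact: oU.1.
  move=> x Ux; have [i xi] := rep_coord x; have [e [F [hF Fx FU]]] := oU.2 x Ux.
  exists e, (e + m)%N, 0, (F * 'X_i ^+ m); split.
  + split; first exact: dhomog0.
    apply: dhomogM => //.
    by have := dhomogMn m (homogX k i); rewrite mul1n.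
  + by rewrite PoszD addrK.
  + by rewrite valueM mulf_neq0 // valueXn valueX expf_neq0.
  + move=> y Xy; rewrite valueM mulf_eq0 negb_or => /andP [Fy _].
    by rewrite value0 mul0r; split=> //; exact: FU.
Qed.

Lemma sectO_sum d U (I : Type) (r : seq I) (P : pred I) (f : I -> Pn k N -> k) :
  open_in X U -> (forall i, P i -> sectO X d U (f i)) ->
  sectO X d U (fun y => \sum_(i <- r | P i) f i y).
Proof.
move=> oU sf; elim: r => [|i r IH].
  by apply: sectO_ext (sectO0 d oU) => y _; rewrite big_nil.
case Pi : (P i); last first.
  by apply: sectO_ext IH => y _; rewrite big_cons Pi.
apply: sectO_ext (sectOD oU.1 (sf i Pi) IH) => y _.
by rewrite big_cons Pi.
Qed.

Lemma sectOB d U f g : open_in X U -> sectO X d U f -> sectO X d U g ->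
  sectO X d U (fun y => f y - g y).
Proof.
move=> oU sf sg; apply: sectO_ext (sectOD oU.1 sf (sectOZ (-1) oU sg)) => y _.
by rewrite mulN1r.
Qed.

Definition vsect (r : nat) d U (a : Pn k N -> 'rV[k]_r) :=
  forall i, sectO X d U (fun y => a y 0 i).

Lemma prod_homog (I : Type) (r : seq I) (P : pred I) (b : I -> nat)
  (H : I -> {mpoly k[N.+1]}) : (forall i, P i -> is_homog (b i) (H i)) ->
  is_homog (\sum_(i <- r | P i) b i)%N (\prod_(i <- r | P i) H i).
Proof.
move=> hH; elim/big_rec2: _ => [|i y1 y2 Pi h]; first exact: homog1.
exact: dhomogM (hH i Pi) h.
Qed.

(** Reduction to a common denominator, the product of all denominators. Each numerator then has the
    degree of this product plus d, so the degree at index 0 serves for all of them. *)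
Lemma vsect_frac (r : nat) d U (a : Pn k N -> 'rV[k]_r.+1) x :
  vsect d U a -> U x -> exists (m b : nat) (G : 'I_r.+1 -> {mpoly k[N.+1]}) H,
  [/\ (forall i, is_homog m (G i)) /\ is_homog b H, m%:Z = b%:Z + d,
      value H (rep x) != 0 &
      forall y, X y -> value H (rep y) != 0 ->
        U y /\ a y = (value H (rep y))^-1 *: \row_i value (G i) (rep y)].
Proof.
move=> sa Ux.
have /choice [g gP] : forall i, exists g : nat * nat * {mpoly k[N.+1]} * {mpoly k[N.+1]},
    [/\ is_homog g.1.1.1 g.1.2 /\ is_homog g.1.1.2 g.2,
        g.1.1.1%:Z = g.1.1.2%:Z + d, value g.2 (rep x) != 0 &
        forall y, X y -> value g.2 (rep y) != 0 ->
          U y /\ a y 0 i = value g.1.2 (rep y) / value g.2 (rep y)].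
  by move=> i; have [m [b [G [H h]]]] := sectO_frac (sa i) Ux; exists (m, b, G, H).
have degE i : ((g i).1.1.1 + \sum_(j | j != i) (g j).1.1.2 =
    (g 0%R).1.1.1 + \sum_(j | j != 0%R) (g j).1.1.2)%N.
  apply/eqP; rewrite -eqz_nat !PoszD.
  have E j : (g j).1.1.1%:Z + (\sum_(l | l != j) (g l).1.1.2)%N%:Z =
      (\sum_l (g l).1.1.2)%N%:Z + d.
    by rewrite [in RHS](bigD1 j) //= PoszD; have [_ -> _ _] := gP j; ring.
  by rewrite !E.
exists ((g 0%R).1.1.1 + \sum_(j | j != 0%R) (g j).1.1.2)%N, (\sum_j (g j).1.1.2)%N,
  (fun i => (g i).1.2 * \prod_(j | j != i) (g j).2), (\prod_j (g j).2).
split.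
- split=> [i|]; last by apply: prod_homog => i _; have [[]] := gP i.
  rewrite -(degE i); apply: dhomogM; first by have [[]] := gP i.
  by apply: prod_homog => j _; have [[]] := gP j.
- by rewrite [X in _ = X%:Z + _](bigD1 0) //= !PoszD; have [_ -> _ _] := gP 0; ring.
- by rewrite value_prod; apply/prodf_neq0 => i _; have [_ _ ? _] := gP i.
- move=> y Xy; rewrite value_prod => /prodf_neq0 nz; split.
    by have [_ _ _ /(_ y Xy (nz 0 isT)) []] := gP 0.
  apply/rowP => i; have [_ _ _ /(_ y Xy (nz i isT)) [_ ->]] := gP i.
  rewrite !mxE valueM !value_prod [X in X^-1 * _](bigD1 i) //=.
  have nz' : \prod_(j | j != i) value (g j).2 (rep y) != 0.
    by apply/prodf_neq0 => j _; exact: nz.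
  have nzi := nz i isT; by field; rewrite nz' nzi.
Qed.

Lemma vsect_sub r d U V (a : Pn k N -> 'rV[k]_r) : open_in X V -> V `<=` U ->
  vsect d U a -> vsect d V a.
Proof. by move=> oV VU sa i; apply: sectO_sub (sa i). Qed.

Lemma vsectD r d U (a b : Pn k N -> 'rV[k]_r) : U `<=` X -> vsect d U a ->
  vsect d U b -> vsect d U (fun y => a y + b y).
Proof.
by move=> UX sa sb i; apply: sectO_ext (sectOD UX (sa i) (sb i)) => y _; rewrite mxE.
Qed.

Lemma vsectZ r (d e d' : int) U f (a : Pn k N -> 'rV[k]_r) : d' = d + e -> U `<=` X ->
  sectO X d U f -> vsect e U a -> vsect d' U (fun y => f y *: a y).
Proof.
move=> de UX sf sa i.
by apply: sectO_ext (sectOM' de UX sf (sa i)) => y _; rewrite mxE.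
Qed.

Lemma vsect_cst r U (u : 'rV[k]_r) : open_in X U -> vsect 0 U (fun=> u).
Proof. by move=> oU i; exact: sectO_cst. Qed.

Lemma vsectB r d U (a b : Pn k N -> 'rV[k]_r) : open_in X U -> vsect d U a ->
  vsect d U b -> vsect d U (fun y => a y - b y).
Proof.
by move=> oU sa sb i; apply: sectO_ext (sectOB oU (sa i) (sb i)) => y _; rewrite !mxE.
Qed.

Lemma vsect_mulmx r s d U (a : Pn k N -> 'rV[k]_r) (M : 'M[k]_(r, s)) :
  open_in X U -> vsect d U a -> vsect d U (fun y => a y *m M).
Proof.
move=> oU sa i; apply: sectO_ext (sectO_sum (f := fun j y => M j i * a y 0 j) _ oU _).
  by move=> y _; rewrite mxE; apply: eq_bigr => j _; rewrite mulrC.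
by move=> j _; exact: sectOZ.
Qed.

Lemma vsect_rep U : open_in X U -> vsect 1 U (@rep k N).
Proof. by move=> oU i; exact: sectO_coord. Qed.

End Sections.

(** * Tangent vectors as directional derivatives *)

Section Derivations.
Variables (k : fieldType) (N : nat) (X : set (Pn k N)).
Implicit Types (U V W : set (Pn k N)) (x y : Pn k N) (f g : Pn k N -> k).
Implicit Types (F G H m : {mpoly k[N.+1]}).

(** The factor c on the left avoids the exponent d - 1, so that d = 0 is included. *)
Lemma dir_deriv_scale d F c (v w : 'rV[k]_N.+1) : is_homog d F ->
  c * dir_deriv F (c *: v) w = c ^+ d * dir_deriv F v w.
Proof.
rewrite /dir_deriv !mulr_sumr; case: d => [|d] hF; apply: eq_bigr => j _.
  suff -> : F^`M(j) = 0 by rewrite !value0 !mulr0.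
  apply/mpolyP => e; rewrite mcoeff_mderiv mcoeff0 (dhomog_nemf_coeff hF) ?mul0rn //.
  by rewrite /= mdegD mdeg1 addn1.
by rewrite (value_scale _ _ (mderiv_homog j hF)) exprS !mulrA; ring.
Qed.

Definition germ_frac x f d G H :=
  [/\ is_homog d G, is_homog d H, value H (rep x) != 0 &
      forall y, X y -> value H (rep y) != 0 -> f y = value G (rep y) / value H (rep y)].

Lemma regular_atP x f : X x -> regular_at X x f <-> exists d G H, germ_frac x f d G H.
Proof.
move=> Xx; split=> [[U [[_ Ux] rf]]|[d [G [H [hG hH Hx fE]]]]].
  have [a [b [G [H [[hG hH] ab Hx fE]]]]] := sectO_frac rf Ux.
  exists b, G, H; split=> //.
  - by move: ab hG; rewrite addr0 => -[->].
  - by move=> y Xy Hy; case: (fE y Xy Hy).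
exists (basic_open X H); split; first exact: basic_nbhd hH Xx Hx.
apply: frac_sectO; first by move=> y [].
move=> y [Xy Hy]; exists d, d, G, H; split=> //; first by rewrite addr0.
by move=> z Xz Hz; split=> //; exact: fE.
Qed.

Lemma regular_regular_at U f x : regular X U f -> nbhd_in X x U -> regular_at X x f.
Proof. by move=> rf nU; exists U. Qed.

Lemma germ_frac_ratio x d G H : is_homog d G -> is_homog d H -> value H (rep x) != 0 ->
  germ_frac x (fun y => value G (rep y) / value H (rep y)) d G H.
Proof. by []. Qed.

(** The quotient rule for G / H in the direction w. *)
Definition qderiv x w G H :=
  (dir_deriv G (rep x) w * value H (rep x) - value G (rep x) * dir_deriv H (rep x) w)
    / value H (rep x) ^+ 2.

Lemma germ_frac_cst x c : germ_frac x (fun=> c) 0 c%:MP 1.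
Proof.
split=> [|||y _ _]; [|exact: homog1|by rewrite value1 oner_eq0|].
  by rewrite -[c%:MP]mulr1 mul_mpolyC; apply/dhomogZ/homog1.
by rewrite valueC value1 divr1.
Qed.

Lemma germ_frac_lin x a f g d G H d' G' H' :
  germ_frac x f d G H -> germ_frac x g d' G' H' ->
  germ_frac x (fun y => a * f y + g y) (d + d') (a *: G * H' + G' * H) (H * H').
Proof.
move=> [hG hH Hx fE] [hG' hH' Hx' gE]; split=> [|||y Xy].
- apply: dhomogD; first by apply: dhomogM => //; exact: dhomogZ.
  by rewrite addnC; exact: dhomogM.
- exact: dhomogM.
- by rewrite valueM mulf_neq0.
- rewrite valueM mulf_eq0 negb_or => /andP [Hy Hy'].
  rewrite fE // gE // valueD !valueM valueZ; field; by rewrite Hy Hy'.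
Qed.

Lemma germ_frac_mul x f g d G H d' G' H' :
  germ_frac x f d G H -> germ_frac x g d' G' H' ->
  germ_frac x (fun y => f y * g y) (d + d') (G * G') (H * H').
Proof.
move=> [hG hH Hx fE] [hG' hH' Hx' gE]; split=> [|||y Xy].
- exact: dhomogM.
- exact: dhomogM.
- by rewrite valueM mulf_neq0.
- rewrite valueM mulf_eq0 negb_or => /andP [Hy Hy'].
  by rewrite fE // gE // !valueM mulf_div.
Qed.

Section AtPoint.
Variables (x : Pn k N) (Xx : X x).
Implicit Types (u v : tangent X x) (w : 'rV[k]_N.+1).

Lemma tangent_linE a u v f : (a *: u + v) f = a * u f + v f.
Proof. by []. Qed.

Lemma tangent0E f : (0 : tangent X x) f = 0.
Proof. by have := tangent_linE (-1) 0 0 f; rewrite scaler0 addr0 mulN1r addNr. Qed.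

Lemma tangent_nreg v f : ~ regular_at X x f -> v f = 0.
Proof. by move: (tan_funP v) => /asboolP [h _ _ _]; exact: h. Qed.

Lemma tangent_germ v f g : regular_at X x f -> regular_at X x g ->
  same_germ X x f g -> v f = v g.
Proof. by move: (tan_funP v) => /asboolP [_ h _ _]; exact: h. Qed.

Lemma tangent_lin v a f g : regular_at X x f -> regular_at X x g ->
  v (fun y => a * f y + g y) = a * v f + v g.
Proof. by move: (tan_funP v) => /asboolP [_ _ h _]; exact: h. Qed.

Lemma tangentM v f g : regular_at X x f -> regular_at X x g ->
  v (fun y => f y * g y) = f x * v g + g x * v f.
Proof. by move: (tan_funP v) => /asboolP [_ _ _ h]; exact: h. Qed.

Lemma regular_at_cst c : regular_at X x (fun=> c).
Proof. by apply/regular_atP => //; exists 0%N, c%:MP, 1; exact: germ_frac_cst. Qed.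

Lemma regular_at_lin a f g : regular_at X x f -> regular_at X x g ->
  regular_at X x (fun y => a * f y + g y).
Proof.
move=> /(regular_atP _ Xx) [d [G [H h]]] /(regular_atP _ Xx) [d' [G' [H' h']]].
apply/regular_atP => //.
by exists (d + d')%N, (a *: G * H' + G' * H), (H * H'); exact: germ_frac_lin.
Qed.

Lemma regular_atM f g : regular_at X x f -> regular_at X x g ->
  regular_at X x (fun y => f y * g y).
Proof.
move=> /(regular_atP _ Xx) [d [G [H h]]] /(regular_atP _ Xx) [d' [G' [H' h']]].
apply/regular_atP => //.
by exists (d + d')%N, (G * G'), (H * H'); exact: germ_frac_mul.
Qed.

Lemma tangent_cst v c : v (fun=> c) = 0.
Proof.
have v0 : v (fun=> 0) = 0.
  have := tangent_lin v 1 (regular_at_cst 0) (regular_at_cst 0).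
  rewrite /= [X in v X](_ : _ = fun=> 0); last by apply/funext => y; rewrite mulr0 addr0.
  by rewrite mul1r => /eqP; rewrite -subr_eq subrr eq_sym => /eqP.
have v1 : v (fun=> 1) = 0.
  have := tangentM v (regular_at_cst 1) (regular_at_cst 1).
  rewrite /= [X in v X](_ : _ = fun=> 1); last by apply/funext => y; rewrite mulr1.
  by rewrite mul1r => /eqP; rewrite -subr_eq subrr eq_sym => /eqP.
have := tangent_lin v c (regular_at_cst 1) (regular_at_cst 0).
rewrite /= [X in v X](_ : _ = fun=> c); last by apply/funext => y; rewrite mulr1 addr0.
by rewrite v0 v1 mulr0 addr0.
Qed.

Variables (m : {mpoly k[N.+1]}) (hm : is_homog 1 m) (mx : value m (rep x) != 0).

Definition affine_coord j y := rep y 0 j / value m (rep y).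

(* [v] is the derivative in the direction [tan_coord v], see [tangent_frac]. *)
Definition tan_coord v : 'rV[k]_N.+1 :=
  value m (rep x) *: \row_j v (affine_coord j).

Lemma germ_affine_coord j : germ_frac x (affine_coord j) 1 'X_j m.
Proof. by split=> // [|y _ _]; [exact: homogX|rewrite valueX]. Qed.

Lemma regular_at_affine_coord j : regular_at X x (affine_coord j).
Proof. by apply/regular_atP => //; exists 1%N, 'X_j, m; exact: germ_affine_coord. Qed.

Lemma tangent_affine v F :
  regular_at X x (fun y => value F ((value m (rep y))^-1 *: rep y)) /\
  v (fun y => value F ((value m (rep y))^-1 *: rep y)) =
    dir_deriv F ((value m (rep x))^-1 *: rep x) (\row_j v (affine_coord j)).
Proof.
elim/mpoly_ring_ind: F => [c|i|F G [rF vF] [rG vG]|F G [rF vF] [rG vG]].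
- rewrite (_ : (fun _ => _) = fun=> c); last by apply/funext => y; rewrite valueC.
  by rewrite dir_derivC tangent_cst; split=> //; exact: regular_at_cst.
- rewrite (_ : (fun _ => _) = affine_coord i); last first.
    by apply/funext => y; rewrite valueX mxE mulrC.
  by rewrite dir_derivX mxE; split=> //; exact: regular_at_affine_coord.
- have := regular_at_lin 1 rF rG; have := tangent_lin v 1 rF rG.
  rewrite (_ : (fun _ => _) = fun y => value (F + G) ((value m (rep y))^-1 *: rep y)).
    by rewrite dir_derivD -vF -vG mul1r.
  by apply/funext => y; rewrite valueD mul1r.
- have := regular_atM rF rG; have := tangentM v rF rG.
  rewrite (_ : (fun _ => _) = fun y => value (F * G) ((value m (rep y))^-1 *: rep y)).
    by rewrite dir_derivM -vF -vG => -> rFG; split=> //; ring.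
  by apply/funext => y; rewrite valueM.
Qed.

(** Apply v to the identity f H = G, with G and H evaluated at rep y / m(rep y) so that they become
    functions, and solve for v f. The powers of m(rep x) cancel because G and H have the same
    degree. *)
Lemma tangent_frac v f d G H : germ_frac x f d G H ->
  v f = qderiv x (tan_coord v) G H.
Proof.
move=> hf; have [hG hH Hx fE] := hf.
have rf : regular_at X x f by apply/regular_atP => //; exists d, G, H.
have [rG vG] := tangent_affine v G; have [rH vH] := tangent_affine v H.
have fHG : same_germ X x
    (fun y => f y * value H ((value m (rep y))^-1 *: rep y))
    (fun y => value G ((value m (rep y))^-1 *: rep y)).
  exists (basic_open X H); split; first exact: basic_nbhd hH Xx Hx.
  move=> y [Xy Hy]; rewrite (value_scale _ _ hG) (value_scale _ _ hH) fE //.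
  by field.
have := tangent_germ v (regular_atM rf rH) rG fHG.
rewrite tangentM // vG vH (value_scale _ _ hH) (fE x Xx Hx) /qderiv /tan_coord.
set c := value m (rep x); have c0 : c != 0 := mx; set w := \row_j _.
have ddE F : is_homog d F ->
    dir_deriv F (c^-1 *: rep x) w = c^-1 ^+ d * dir_deriv F (rep x) (c *: w).
  move=> hF; have := dir_deriv_linear F (c^-1 *: rep x) c w 0.
  rewrite addr0 => cw; have := dir_deriv_scale c^-1 (rep x) (c *: w) hF.
  rewrite cw mulrDr mulrA mulVf // mul1r => <-.
  suff -> : dir_deriv F (c^-1 *: rep x) 0 = 0 by rewrite mulr0 addr0.
  by rewrite /dir_deriv big1 // => j _; rewrite mxE mul0r.
rewrite !ddE //; have cd : c^-1 ^+ d != 0 by rewrite expf_neq0 // invr_eq0.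
set t := c^-1 ^+ d in cd *; set gx := value G _; set h := value H _ in Hx *.
set dg := dir_deriv G _ _; set dh := dir_deriv H _ _ => E.
have -> : v f = (t * dg - gx / h * (t * dh)) / (t * h).
  by rewrite -E; field; rewrite Hx cd.
by field; rewrite Hx cd.
Qed.

Lemma tangent_eq u v : (forall j, u (affine_coord j) = v (affine_coord j)) -> u = v.
Proof.
move=> uv; apply: val_inj; apply/funext => f /=.
have [rf|nf] := pselect (regular_at X x f); last by rewrite !tangent_nreg.
have [d [G [H h]]] := (regular_atP f Xx).1 rf.
rewrite !(tangent_frac _ h); congr (qderiv x _ G H); congr (_ *: _).
by apply/rowP => j; rewrite !mxE uv.
Qed.

End AtPoint.

(** The tangent space of the affine cone over X at rep x. The condition is made local by K: F has to
    vanish on X only where K does not. *)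
Definition tangent_vec x w := forall a b F K, is_homog a F -> is_homog b K ->
  value K (rep x) != 0 ->
  (forall y, X y -> value K (rep y) != 0 -> value F (rep y) = 0) ->
  dir_deriv F (rep x) w = 0.

(** If G / H and G' / H' agree near x, then G H' - G' H vanishes there, so its derivative in a
    tangent direction is 0; the product rule turns this into equality of the two quotient rules. *)
Lemma qderiv_germ x w f g d G H d' G' H' : X x -> tangent_vec x w ->
  same_germ X x f g -> germ_frac x f d G H -> germ_frac x g d' G' H' ->
  qderiv x w G H = qderiv x w G' H'.
Proof.
move=> Xx tw [U [[oU Ux] fg]] [hG hH Hx fE] [hG' hH' Hx' gE].
have [e [F [hF Fx FU]]] := oU.2 x Ux.
have vanish y : X y -> value (H * H' * F) (rep y) != 0 ->
    value (G * H' - G' * H) (rep y) = 0.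
  move=> Xy; rewrite !valueM !mulf_eq0 !negb_or => /andP [/andP [Hy Hy'] Fy].
  have := fg y (FU y Xy Fy); rewrite fE // gE // valueB !valueM => /eqP.
  by rewrite eqr_div // => /eqP ->; rewrite subrr.
have Kx : value (H * H' * F) (rep x) != 0 by rewrite !valueM !mulf_neq0.
have hP : is_homog (d + d') (G * H' - G' * H).
  by apply: rpredB; [exact: dhomogM|rewrite addnC; exact: dhomogM].
have := tw _ _ _ _ hP (dhomogM (dhomogM hH hH') hF) Kx vanish.
have := vanish x Xx Kx; rewrite valueB !valueM dir_derivB !dir_derivM /qderiv.
set gx := value G _; set h := value H _ in Hx *; set gx' := value G' _.
set h' := value H' _ in Hx' *.
set dg := dir_deriv G _ _; set dh := dir_deriv H _ _.
set dg' := dir_deriv G' _ _; set dh' := dir_deriv H' _ _ => /eqP E0 E1.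
have {E0}Eg : gx = gx' * h / h'.
  by apply: (canRL (mulfK Hx')); apply/eqP; rewrite -subr_eq0.
have -> : dg = (dg' * h + gx' * dh - gx * dh') / h'.
  apply: (canRL (mulfK Hx')); apply/eqP; rewrite -subr_eq0 -E1; apply/eqP; ring.
by rewrite Eg; field; rewrite Hx Hx'.
Qed.

Lemma qderiv_lin x w a G H G' H' : value H (rep x) != 0 -> value H' (rep x) != 0 ->
  qderiv x w (a *: G * H' + G' * H) (H * H') = a * qderiv x w G H + qderiv x w G' H'.
Proof.
move=> Hx Hx'; rewrite /qderiv dir_derivD !dir_derivM dir_derivZ valueD !valueM valueZ.
by field; rewrite Hx Hx'.
Qed.

Lemma qderiv_mul x w G H G' H' : value H (rep x) != 0 -> value H' (rep x) != 0 ->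
  qderiv x w (G * G') (H * H') =
  value G (rep x) / value H (rep x) * qderiv x w G' H' +
  value G' (rep x) / value H' (rep x) * qderiv x w G H.
Proof.
move=> Hx Hx'; rewrite /qderiv !dir_derivM !valueM.
by field; rewrite Hx Hx'.
Qed.

Lemma qderiv_linear x a w w' G H :
  qderiv x (a *: w + w') G H = a * qderiv x w G H + qderiv x w' G H.
Proof. by rewrite /qderiv !dir_deriv_linear; ring. Qed.

(** By [qderiv_germ] the set has at most one element when w is tangent. It is empty for f not
    regular at x, and [xget] then returns the value 0 that [derivation_prop] prescribes. *)
Definition dvec_fun x w : (Pn k N -> k) -> k^o := fun f =>
  xget 0 [set r | exists d G H, germ_frac x f d G H /\ r = qderiv x w G H].

Lemma dvec_funE x w f d G H : X x -> tangent_vec x w -> germ_frac x f d G H ->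
  dvec_fun x w f = qderiv x w G H.
Proof.
move=> Xx tw hf; apply: xget_unique; first by exists d, G, H.
move=> r [d' [G' [H' [hf' ->]]]]; apply: qderiv_germ hf' hf => //.
by exists X; split=> //; split=> //; exact: open_in_setT.
Qed.

Lemma dvec_derivation x w : X x -> tangent_vec x w -> derivation X x (dvec_fun x w).
Proof.
move=> Xx tw; apply/asboolP; split.
- move=> f nf; apply: xgetPN => r [d [G [H [h _]]]]; apply: nf.
  by apply/regular_atP => //; exists d, G, H.
- move=> f g /(regular_atP _ Xx) [d [G [H h]]] /(regular_atP _ Xx) [d' [G' [H' h']]] fg.
  rewrite (dvec_funE Xx tw h) (dvec_funE Xx tw h'); exact: qderiv_germ fg h h'.
- move=> a f g /(regular_atP _ Xx) [d [G [H h]]] /(regular_atP _ Xx) [d' [G' [H' h']]].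
  rewrite (dvec_funE Xx tw h) (dvec_funE Xx tw h').
  rewrite (dvec_funE Xx tw (germ_frac_lin a h h')).
  by case: h h' => _ _ Hx _ [_ _ Hx' _]; exact: qderiv_lin.
- move=> f g /(regular_atP _ Xx) [d [G [H h]]] /(regular_atP _ Xx) [d' [G' [H' h']]].
  rewrite (dvec_funE Xx tw h) (dvec_funE Xx tw h').
  rewrite (dvec_funE Xx tw (germ_frac_mul h h')).
  case: h h' => _ _ Hx fE [_ _ Hx' gE].
  by rewrite qderiv_mul // fE // gE.
Qed.

(* The junk value is [0], used when [w] is not tangent to [X]. *)
Definition dvec x w : tangent X x := insubd 0 (dvec_fun x w).

Lemma dvecE x w f d G H : X x -> tangent_vec x w -> germ_frac x f d G H ->
  dvec x w f = qderiv x w G H.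
Proof.
move=> Xx tw hf; rewrite -(dvec_funE Xx tw hf) /dvec.
suff -> : insubd (0 : tangent X x) (dvec_fun x w) =
    Tangent (dvec_derivation Xx tw) by [].
by apply: val_inj; rewrite val_insubd (dvec_derivation Xx tw).
Qed.

Lemma tangent_vec_lin x a w w' : tangent_vec x w -> tangent_vec x w' ->
  tangent_vec x (a *: w + w').
Proof.
move=> tw tw' d b F K hF hK Kx van.
by rewrite dir_deriv_linear (tw _ _ _ _ hF hK Kx van) (tw' _ _ _ _ hF hK Kx van)
  mulr0 addr0.
Qed.

Lemma dvec_linear x a w w' : X x -> tangent_vec x w -> tangent_vec x w' ->
  dvec x (a *: w + w') = a *: dvec x w + dvec x w'.
Proof.
move=> Xx tw tw'; have [i xi] := rep_coord x.
apply: (tangent_eq Xx (homogX _ i)) => [|j]; first by rewrite valueX.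
have hj : germ_frac x (affine_coord 'X_i j) 1 'X_j 'X_i.
  by apply: germ_affine_coord; [exact: homogX|rewrite valueX].
rewrite tangent_linE !(dvecE _ _ hj) //; last exact: tangent_vec_lin.
exact: qderiv_linear.
Qed.

Lemma tangent_dvec x m v : X x -> is_homog 1 m -> value m (rep x) != 0 ->
  tangent_vec x (tan_coord m v) -> v = dvec x (tan_coord m v).
Proof.
move=> Xx hm mx tv; apply: (tangent_eq Xx hm mx) => j.
have hj := germ_affine_coord hm mx j.
by rewrite (tangent_frac Xx hm mx v hj) (dvecE Xx tv hj).
Qed.

(** The kernel in the Euler sequence is the radial direction: the derivatives of all x_j / x_i
    vanish exactly when w is proportional to rep x. *)
Lemma dvec_eq0 x w : X x -> tangent_vec x w ->
  dvec x w = 0 <-> exists c, w = c *: rep x.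
Proof.
move=> Xx tw; have [i xi] := rep_coord x.
have nz : value 'X_i (rep x) != 0 by rewrite valueX.
have hj j := germ_affine_coord (homogX k i) nz j.
have E j : dvec x w (affine_coord 'X_i j) =
    (w 0 j * rep x 0 i - rep x 0 j * w 0 i) / rep x 0 i ^+ 2.
  by rewrite (dvecE Xx tw (hj j)) /qderiv !dir_derivX !valueX.
split=> [w0|[c wE]].
  exists (w 0 i / rep x 0 i); apply/rowP => j; rewrite mxE.
  have := E j; rewrite w0 tangent0E => /esym/eqP; rewrite mulf_eq0 invr_eq0.
  rewrite (negbTE (expf_neq0 2 xi)) orbF subr_eq0 => /eqP wj.
  by apply: (mulIf xi); rewrite wj; field.
apply: (tangent_eq Xx (homogX _ i) nz) => j.
rewrite E tangent0E wE !mxE; suff -> : c * rep x 0 j * rep x 0 i - rep x 0 j * (c * rep x 0 i) = 0.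
  by rewrite mul0r.
by ring.
Qed.

End Derivations.

(** * Sheaves presented as quotients of O(-1)^(r+1) *)

Section Presentations.
Variables (k : fieldType) (N r : nat) (X : set (Pn k N)).
Variable M : 'M[k]_(N.+1, r.+1).
Implicit Types (U V W : set (Pn k N)) (x y : Pn k N).

Definition in_line x (u : 'rV[k]_r.+1) := exists c, u = c *: (rep x *m M).

Definition represents (E : modsheaf k N) (e : forall x, 'rV[k]_r.+1 -> ms_fib E x)
    U (s : forall x, ms_fib E x) (a : Pn k N -> 'rV[k]_r.+1) :=
  vsect X (-1) U a /\ forall y, U y -> ms_dom E y -> s y = e y (a y).

(* E is the quotient of O(-1)^(r+1) by the image of O(-2), embedded by
   x |-> rep x *m M. *)
Record presented (E : modsheaf k N) (e : forall x, 'rV[k]_r.+1 -> ms_fib E x) := {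
  pres_lin : forall x a u v, X x -> e x (a *: u + v) = a *: e x u + e x v;
  pres_ker : forall x u, X x -> ms_dom E x -> e x u = 0 <-> in_line x u;
  pres_sec : forall U s, open_in X U -> ms_sec E U s <->
    forall x, U x -> exists W a, [/\ nbhd_in X x W, W `<=` U & represents e W s a];
  pres_dense : forall W a, open_in X W -> vsect X (-1) W a ->
    (forall y, W y -> ms_dom E y -> in_line y (a y)) ->
    forall y, W y -> in_line y (a y);
  pres_neq0 : forall x, X x -> rep x *m M != 0 }.

Section One.
Variables (E : modsheaf k N) (e : forall x, 'rV[k]_r.+1 -> ms_fib E x).
Hypothesis pE : presented e.
Implicit Types (s t : forall x, ms_fib E x).

Lemma pres0 x : X x -> e x 0 = 0.
Proof.
by move=> Xx; have := pres_lin pE (-1) 0 0 Xx; rewrite scaler0 addr0 scaleN1r addNr.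
Qed.

Lemma presZ x a u : X x -> e x (a *: u) = a *: e x u.
Proof. by move=> Xx; rewrite -[a *: u]addr0 (pres_lin pE) // pres0 // addr0. Qed.

Lemma presD x u v : X x -> e x (u + v) = e x u + e x v.
Proof. by move=> Xx; rewrite -[u]scale1r (pres_lin pE) // !scale1r. Qed.

Lemma presB x u v : X x -> e x (u - v) = e x u - e x v.
Proof. by move=> Xx; rewrite presD // -(scaleN1r v) presZ // scaleN1r. Qed.

Lemma pres_sum x (I : Type) (l : seq I) (P : pred I) (u : I -> 'rV[k]_r.+1) : X x ->
  e x (\sum_(i <- l | P i) u i) = \sum_(i <- l | P i) e x (u i).
Proof.
move=> Xx; elim/big_rec2: _ => [|i v w _ <-]; first exact: pres0.
by rewrite presD.
Qed.

Lemma pres_eq x u v : X x -> ms_dom E x -> e x u = e x v <-> in_line x (u - v).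
Proof.
move=> Xx dx; split=> [uv|/(pres_ker pE _ Xx dx)].
  by apply/(pres_ker pE _ Xx dx); rewrite presB // uv subrr.
by rewrite presB // => /eqP; rewrite subr_eq0 => /eqP.
Qed.

Lemma represents_sub U V s a : open_in X V -> V `<=` U -> represents e U s a ->
  represents e V s a.
Proof.
move=> oV VU [sa sE]; split; first exact: vsect_sub sa.
by move=> y Vy; apply: sE; exact: VU.
Qed.

Lemma represents_sec U s a : open_in X U -> represents e U s a -> ms_sec E U s.
Proof. by move=> oU ra; apply/(pres_sec pE _ oU) => x Ux; exists U, a; split. Qed.

Lemma represents_e U a : vsect X (-1) U a -> represents e U (fun y => e y (a y)) a.
Proof. by []. Qed.

Lemma sec_sub U V s : open_in X U -> open_in X V -> V `<=` U -> ms_sec E U s ->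
  ms_sec E V s.
Proof.
move=> oU oV VU /(pres_sec pE _ oU) ss; apply/(pres_sec pE _ oV) => x Vx.
have [W [a [nW WU ra]]] := ss x (VU x Vx).
exists (W `&` V), a; split; first exact: nbhd_inI.
- by move=> y [].
- by apply: represents_sub ra; [apply: open_inI => //; case: nW|move=> y []].
Qed.

(** Outside [ms_dom] the values of s and t say nothing about a and b; [pres_dense] extends the
    relation to these points. *)
Lemma represents_eq U s t a b : open_in X U -> represents e U s a ->
  represents e U t b -> (forall y, U y -> ms_dom E y -> s y = t y) ->
  forall y, U y -> in_line y (a y - b y).
Proof.
move=> oU [sa sE] [sb tE] st; apply: (pres_dense pE (a := fun y => a y - b y)) => //.
  exact: vsectB.
move=> y Uy dy; apply/(pres_eq _ _ (oU.1 y Uy) dy).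
by rewrite -sE // -tE // st.
Qed.

Lemma representsD U s t a b : open_in X U -> represents e U s a ->
  represents e U t b -> represents e U (fun y => s y + t y) (fun y => a y + b y).
Proof.
move=> oU [sa sE] [sb tE]; split; first exact: vsectD oU.1 sa sb.
move=> y Uy dy; rewrite presD; last exact: oU.1.
by rewrite sE // tE.
Qed.

Lemma representsZ U s f a : open_in X U -> regular X U f -> represents e U s a ->
  represents e U (fun y => f y *: s y) (fun y => f y *: a y).
Proof.
move=> oU rf [sa sE]; split.
  by apply: (vsectZ (d := 0) (e := -1)) => //; exact: oU.1.
move=> y Uy dy; rewrite presZ; last exact: oU.1.
by rewrite sE.
Qed.

Lemma sec0 U : open_in X U -> ms_sec E U (fun=> 0).
Proof.
move=> oU; apply: (represents_sec oU (a := fun=> 0)); split.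
  by move=> i; apply: sectO_ext (sectO0 (-1) oU) => y _; rewrite mxE.
by move=> y Uy _; rewrite pres0 //; exact: oU.1.
Qed.

Lemma common_represents U s t x : open_in X U -> ms_sec E U s -> ms_sec E U t -> U x ->
  exists W a b, [/\ nbhd_in X x W, W `<=` U, represents e W s a & represents e W t b].
Proof.
move=> oU /(pres_sec pE _ oU) ss /(pres_sec pE _ oU) st Ux.
have [W [a [nW WU ra]]] := ss x Ux; have [W' [b [nW' WU' rb]]] := st x Ux.
have nI := nbhd_inI nW nW'; have [oI _] := nI.
exists (W `&` W'), a, b; split=> //; first by move=> y [/WU].
- by apply: (represents_sub oI _ ra) => y [].
- by apply: (represents_sub oI _ rb) => y [].
Qed.

Lemma secD U s t : open_in X U -> ms_sec E U s -> ms_sec E U t ->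
  ms_sec E U (fun y => s y + t y).
Proof.
move=> oU ss st; apply/(pres_sec pE _ oU) => x Ux.
have [W [a [b [nW WU ra rb]]]] := common_represents oU ss st Ux.
by exists W, (fun y => a y + b y); split=> //; apply: representsD => //; case: nW.
Qed.

Lemma secZ U s f : open_in X U -> regular X U f -> ms_sec E U s ->
  ms_sec E U (fun y => f y *: s y).
Proof.
move=> oU rf /(pres_sec pE _ oU) ss; apply/(pres_sec pE _ oU) => x Ux.
have [W [a [[oW Wx] WU ra]]] := ss x Ux.
exists W, (fun y => f y *: a y); split=> //; apply: representsZ => //.
exact: sectO_sub rf.
Qed.

Lemma sec_sum U (I : Type) (l : seq I) (s : I -> forall y, ms_fib E y) : open_in X U ->
  (forall i, ms_sec E U (s i)) -> ms_sec E U (fun y => \sum_(i <- l) s i y).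
Proof.
move=> oU ss; elim: l => [|i l IH].
  rewrite (_ : (fun _ => _) = fun=> 0); first exact: sec0.
  by apply: functional_extensionality_dep => y; rewrite big_nil.
rewrite (_ : (fun _ => _) = fun y => s i y + \sum_(i <- l) s i y); first exact: secD.
by apply: functional_extensionality_dep => y; rewrite big_cons.
Qed.

(** The choice of W and a at each point is arbitrary. Only the class modulo the line at x is
    canonical, by [germ_value_line], and that is all that the maps below depend on. *)
Definition germ_value U s x : 'rV[k]_r.+1 :=
  xget 0 [set u | exists W a, [/\ nbhd_in X x W, W `<=` U, represents e W s a & u = a x]].

Lemma germ_value_line U W s a : open_in X W -> W `<=` U -> represents e W s a ->
  forall y, W y -> in_line y (germ_value U s y - a y).
Proof.
move=> oW WU ra y Wy; rewrite /germ_value; case: xgetP.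
  move=> u _ [W' [b [nW' WU' rb ->]]].
  have [oI Iy] : nbhd_in X y (W `&` W') by apply: nbhd_inI.
  apply: (represents_eq (s := s) (t := s) oI _ _ _ Iy) => //.
  - by apply: (represents_sub oI _ rb) => z [].
  - by apply: (represents_sub oI _ ra) => z [].
by move/(_ (a y)); case; exists W, a; split.
Qed.

(** A section whose value at x is 0 lies locally in m_x E, where m_x is the ideal of x. This
    expresses vanishing in terms that any O-linear map preserves. *)
Lemma vanishing_section U s x : open_in X U -> ms_sec E U s -> U x -> ms_dom E x ->
  s x = 0 -> exists W (f : 'I_r.+1 -> Pn k N -> k) (t : 'I_r.+1 -> forall y, ms_fib E y),
  [/\ nbhd_in X x W, W `<=` U, forall i, [/\ regular X W (f i), f i x = 0 & ms_sec E W (t i)] &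
      eq_sec W s (fun y => \sum_i f i y *: t i y)].
Proof.
move=> oU /(pres_sec pE _ oU) ss Ux dx sx.
have [W [a [nW WU [sa sE]]]] := ss x Ux; have Xx := oU.1 x Ux.
have [c ax] : in_line x (a x).
  by apply/(pres_ker pE _ Xx dx); rewrite -sE //; case: nW.
have [j xj] := rep_coord x; have xj' : value 'X_j (rep x) != 0 by rewrite valueX.
have nI := nbhd_inI nW (basic_nbhd (homogX k j) Xx xj').
set V := W `&` basic_open X 'X_j in nI; have [oV Vx] := nI.
have VX : V `<=` X := oV.1.
have nz y : V y -> rep y 0 j != 0 by move=> [_ [_]]; rewrite valueX.
(* The subtracted term has degree -2 + 1 = -1, lies on the line at every y, and equals a x at y = x.
   Hence b represents s too, and b x = 0. *)
pose b y := a y - (c * rep x 0 j ^+ 2 * (rep y 0 j)^-1 ^+ 2) *: (rep y *m M).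
have invj : sectO X (-1) V (fun y => (rep y 0 j)^-1).
  apply: sectO_ext (sectO_inv oV (homogX k j) _) => [y _|y Vy]; rewrite valueX //.
  exact: nz.
have sb : vsect X (-1) V b.
  apply: vsectB => //; first by apply: vsect_sub sa => // y [].
  apply: (vsectZ (d := -2) (e := 1)) => //; last exact/vsect_mulmx/vsect_rep.
  by apply: sectOZ => //; apply: (sectOM' (d := -1) (e := -1)).
exists V, (fun i y => rep y 0 j * b y 0 i),
  (fun i y => e y ((rep y 0 j)^-1 *: delta_mx 0 i)).
split=> //; first by move=> y [/WU].
- move=> i; split.
  + by apply: (sectOM' (d := 1) (e := -1)) => //; exact: sectO_coord.
  + rewrite /b ax exprVn mulfK ?expf_neq0 // !mxE subrr mulr0 //.
  + apply: (represents_sec oV (a := fun y => (rep y 0 j)^-1 *: delta_mx 0 i)).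
    apply: represents_e; apply: (vsectZ (d := -1) (e := 0)) => //.
    exact: vsect_cst.
- move=> y Vy dy; rewrite sE //; last by case: Vy.
  have Xy := VX y Vy.
  under eq_bigr => i _ do rewrite -presZ // scalerA mulrAC mulfV ?nz // mul1r.
  rewrite -pres_sum // -row_sum_delta; apply/pres_eq => //.
  by rewrite /b opprB addrCA subrr addr0; eexists.
Qed.

(** Where the coordinate i0 of y M is nonzero, the line of y M is complementary to the coordinate
    hyperplane i0, so the other r basis vectors, divided by x_j to get degree -1, form a frame. *)
Lemma presented_bundle : is_vector_bundle X E.
Proof.
move=> x Xx; have [j xj] := rep_coord x.
have /existsP [i0 xi0] : [exists i, (rep x *m M) 0 i != 0].
  apply: contraNT (pres_neq0 pE Xx); rewrite negb_exists => /forallP h.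
  by apply/eqP/rowP => i; rewrite [RHS]mxE; move: (h i); rewrite negbK => /eqP.
have LE y : value (lin_poly (col i0 M)) (rep y) = (rep y *m M) 0 i0.
  by rewrite value_lin_poly !mxE; apply: eq_bigr => i _; rewrite mxE.
have hm : is_homog 2 ('X_j * lin_poly (col i0 M)).
  exact: dhomogM (homogX k j) (lin_poly_homog _).
pose U := basic_open X ('X_j * lin_poly (col i0 M)).
have nU : nbhd_in X x U.
  by apply: basic_nbhd hm Xx _; rewrite valueM valueX LE mulf_neq0.
have nz y : U y -> rep y 0 j != 0 /\ (rep y *m M) 0 i0 != 0.
  by move=> [_]; rewrite valueM valueX LE mulf_eq0 negb_or => /andP.
pose vec (f : 'I_r -> k) : 'rV[k]_r.+1 := \sum_i f i *: delta_mx 0 (lift i0 i).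
have vec0 f : vec f 0 i0 = 0.
  rewrite summxE big1 // => i _; rewrite !mxE eqxx /=.
  by rewrite (negbTE (neq_lift _ _)) mulr0.
have vecE f i : vec f 0 (lift i0 i) = f i.
  rewrite summxE (bigD1 i) //= !mxE !eqxx mulr1 big1 ?addr0 // => l ne.
  by rewrite !mxE (inj_eq lift_inj) eq_sym (negbTE ne) andbF mulr0.
have invj V : open_in X V -> V `<=` U -> sectO X (-1) V (fun y => (rep y 0 j)^-1).
  move=> oV VU; apply: sectO_ext (sectO_inv oV (homogX k j) _) => [y _|y Vy].
    by rewrite valueX.
  by rewrite valueX; case: (nz y (VU y Vy)).
have frame V f : open_in X V -> V `<=` U -> (forall i, regular X V (f i)) ->
    vsect X (-1) V (fun y => (rep y 0 j)^-1 *: vec (f^~ y)).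
  move=> oV VU rf; apply: (vsectZ (d := -1) (e := 0)) => //; [exact: oV.1|exact: invj|].
  move=> i; case: (unliftP i0 i) => [l ->|->].
    by apply: sectO_ext (rf l) => y _; rewrite vecE.
  by apply: sectO_ext (sectO0 0 oV) => y _; rewrite vec0.
exists U, r, (fun i y => e y ((rep y 0 j)^-1 *: delta_mx 0 (lift i0 i))).
split=> //.
  move=> i; apply: (represents_sec nU.1 (a := fun y => (rep y 0 j)^-1 *: delta_mx 0 (lift i0 i))).
  apply: represents_e; apply: (vsectZ (d := -1) (e := 0)) => //; first exact: nU.1.1.
  - by apply: invj nU.1 _.
  - by apply: vsect_cst; case: nU.
move=> V oV VU comb.
have combE f y : X y -> comb f y = e y ((rep y 0 j)^-1 *: vec (f^~ y)).
  move=> Xy; rewrite /comb scaler_sumr pres_sum //; apply: eq_bigr => i _.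
  by rewrite !presZ // !scalerA mulrC.
have combr f : (forall i, regular X V (f i)) ->
    represents e V (comb f) (fun y => (rep y 0 j)^-1 *: vec (f^~ y)).
  move=> rf; split; first exact: frame.
  by move=> y Vy _; rewrite combE //; exact: oV.1.
split=> [f rf|s ss|f g rf rg fg i y Vy].
- exact: represents_sec oV (combr f rf).
(* Projection along the line of y M onto the hyperplane where the coordinate i0 is 0. It removes the
   ambiguity of [germ_value], so the coefficients f are regular. *)
- pose red y (u : 'rV[k]_r.+1) := u - (u 0 i0 / (rep y *m M) 0 i0) *: (rep y *m M).
  pose f i y := rep y 0 j * red y (germ_value V s y) 0 (lift i0 i).
  have redE y u u' : V y -> in_line y (u - u') -> red y u = red y u'.
    move=> Vy [c cE]; have [_ yi0] := nz y (VU y Vy).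
    have -> : u = u' + c *: (rep y *m M) by rewrite -cE addrC subrK.
    rewrite /red; move: (rep y *m M) yi0 => w wi0.
    by apply/rowP => l; rewrite !mxE; field.
  exists f; split.
  + move=> i; apply: sectO_local => x' Vx'.
    have [W [a [nW WV ra]]] := (pres_sec pE _ oV).1 ss x' Vx'.
    exists W; first by split.
    have [oW _] := nW; have WX := oW.1.
    apply: (@sectO_ext _ _ _ _ _ (fun y => rep y 0 j * red y (a y) 0 (lift i0 i))).
      by move=> y Wy; rewrite /f (redE y _ (a y) (WV y Wy) (germ_value_line oW WV ra Wy)).
    apply: (sectOM' (d := 1) (e := -1)) => //; first exact: sectO_coord.
    suff : vsect X (-1) W (fun y => red y (a y)) by exact.
    apply: vsectB => //; first by case: ra.
    apply: (vsectZ (d := -2) (e := 1)) => //; last exact/vsect_mulmx/vsect_rep.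
    apply: (sectOM' (d := -1) (e := -1)) => //; first by case: ra.
    apply: sectO_ext (sectO_inv oW (lin_poly_homog (col i0 M)) _) => y Wy.
      by rewrite LE.
    by rewrite LE; case: (nz y (VU y (WV y Wy))).
  + move=> y Vy dy; have Xy := oV.1 y Vy; have [yj yi0] := nz y (VU y Vy).
    have [W [a [nW WV ra]]] := (pres_sec pE _ oV).1 ss y Vy.
    rewrite combE // ra.2 //; last by case: nW.
    have -> : (rep y 0 j)^-1 *: vec (f^~ y) = red y (germ_value V s y).
      apply/rowP => l; rewrite mxE; case: (unliftP i0 l) => [i ->|->].
        by rewrite vecE /f mulKf.
      by rewrite vec0 mulr0 /red; move: (rep y *m M) yi0 => w wi0; rewrite !mxE; field.
    rewrite (redE y _ (a y) Vy (germ_value_line nW.1 WV ra nW.2)).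
    apply/(pres_eq _ _ Xy dy); rewrite /red opprB addrCA subrr addr0.
    by eexists.
- have := represents_eq oV (combr f rf) (combr g rg) fg Vy.
  have [yj yi0] := nz y (VU y Vy); rewrite -scalerBr => -[c cE].
  have c0 : c = 0.
    have /rowP /(_ i0) := cE; rewrite !mxE !vec0 subrr mulr0 => /esym/eqP.
    rewrite mulf_eq0 => /orP [/eqP //|]; move: yi0; rewrite mxE => /negbTE -> //.
  move: cE => /rowP /(_ (lift i0 i)); rewrite c0 scale0r !mxE !vecE => /eqP.
  by rewrite mulf_eq0 invr_eq0 (negbTE yj) subr_eq0 => /eqP.
Qed.

End One.

(** Representatives do not depend on the sheaf: [Phi] sends s to the section of F with the same
    local representatives, and [Psi] does the converse. *)
Lemma presented_iso E F (e : forall x, 'rV[k]_r.+1 -> ms_fib E x)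
    (e' : forall x, 'rV[k]_r.+1 -> ms_fib F x) :
  presented e -> presented e' -> iso_sheaf X E F.
Proof.
move=> pE pF.
pose Phi U s x := e' x (germ_value e U s x).
pose Psi U s x := e x (germ_value e' U s x).
have PhiE U W s a : open_in X W -> W `<=` U -> represents e W s a ->
    represents e' W (Phi U s) a.
  move=> oW WU ra; split; first by case: ra.
  move=> y Wy dy; apply/(pres_eq pF _ _ (oW.1 y Wy) dy).
  exact (germ_value_line pE oW WU ra Wy).
have PsiE U W s a : open_in X W -> W `<=` U -> represents e' W s a ->
    represents e W (Psi U s) a.
  move=> oW WU ra; split; first by case: ra.
  move=> y Wy dy; apply/(pres_eq pE _ _ (oW.1 y Wy) dy).
  exact (germ_value_line pF oW WU ra Wy).
exists Phi; split=> [U oU|U V s oU oV VU].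
  split.
  - move=> s /(pres_sec pE _ oU) ss; apply/(pres_sec pF _ oU) => x Ux.
    have [W [a [nW WU ra]]] := ss x Ux; exists W, a; split=> //.
    by apply: PhiE => //; case: nW.
  - move=> s t ss st; split=> st' x Ux dx.
      have [W [a [b [[oW Wx] WU ra rb]]]] := common_represents pE oU ss st Ux.
      have rta : represents e W t a.
        by split; [case: ra|move=> y Wy dy; rewrite -st' ?ra.2 //; exact: WU].
      by rewrite (PhiE U _ _ _ oW WU ra).2 // (PhiE U _ _ _ oW WU rta).2.
    have [W [a [b [[oW Wx] WU ra rb]]]] := common_represents pE oU ss st Ux.
    rewrite ra.2 // rb.2 //; apply/(pres_eq pE _ _ (oU.1 x Ux) dx).
    apply: (represents_eq pF oW (PhiE U _ _ _ oW WU ra) (PhiE U _ _ _ oW WU rb)) => //.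
    by move=> y Wy; apply: st'; exact: WU.
  - move=> s /(pres_sec pF _ oU) ss.
    exists (Psi U s).
      apply/(pres_sec pE _ oU) => x Ux; have [W [a [nW WU ra]]] := ss x Ux.
      by exists W, a; split=> //; apply: PsiE => //; case: nW.
    move=> x Ux dx; have [W [a [[oW Wx] WU ra]]] := ss x Ux.
    by rewrite (PhiE U _ _ _ oW WU (PsiE U _ _ _ oW WU ra)).2 // ra.2.
  - move=> s t ss st x Ux dx.
    have [W [a [b [[oW Wx] WU ra rb]]]] := common_represents pE oU ss st Ux.
    rewrite (PhiE U _ _ _ oW WU (representsD pE oW ra rb)).2 //.
    rewrite (PhiE U _ _ _ oW WU ra).2 // (PhiE U _ _ _ oW WU rb).2 //.
    by rewrite (presD pF) //; exact: oU.1.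
  - move=> f s rf /(pres_sec pE _ oU) ss x Ux dx.
    have [W [a [[oW Wx] WU ra]]] := ss x Ux.
    have rfW : regular X W f by apply: sectO_sub rf.
    rewrite (PhiE U _ _ _ oW WU (representsZ pE oW rfW ra)).2 //.
    by rewrite (PhiE U _ _ _ oW WU ra).2 // (presZ pF) //; exact: oU.1.
move=> /(pres_sec pE _ oU) ss x Vx dx; have [W [a [[oW Wx] WU ra]]] := ss x (VU x Vx).
have oI := open_inI oW oV; have IW : W `&` V `<=` W by move=> y [].
have ra' := represents_sub oI IW ra.
have IU : W `&` V `<=` U by move=> y [/WU].
have IV : W `&` V `<=` V by move=> y [].
by rewrite (PhiE U _ _ _ oI IU ra').2 // (PhiE V _ _ _ oI IV ra').2.
Qed.

End Presentations.

(** * Isomorphisms preserve vanishing at a point *)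

Section IsoVanishing.
Variables (k : fieldType) (N r : nat) (X : set (Pn k N)).
Variables (M M' : 'M[k]_(N.+1, r.+1)) (E F : modsheaf k N).
Variables (e : forall x, 'rV[k]_r.+1 -> ms_fib E x) (e' : forall x, 'rV[k]_r.+1 -> ms_fib F x).
Hypotheses (pE : presented X M e) (pF : presented X M' e').
Variable Phi : set (Pn k N) -> (forall x, ms_fib E x) -> (forall x, ms_fib F x).
Hypothesis PhiU : forall U, open_in X U ->
  [/\ forall s, ms_sec E U s -> ms_sec F U (Phi U s),
      forall s t, ms_sec E U s -> ms_sec E U t ->
        eq_sec U s t <-> eq_sec U (Phi U s) (Phi U t),
      forall r, ms_sec F U r -> exists2 s, ms_sec E U s & eq_sec U (Phi U s) r,
      forall s t, ms_sec E U s -> ms_sec E U t ->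
        eq_sec U (Phi U (fun x => s x + t x)) (fun x => Phi U s x + Phi U t x) &
      forall f s, regular X U f -> ms_sec E U s ->
        eq_sec U (Phi U (fun x => f x *: s x)) (fun x => f x *: Phi U s x)].
Hypothesis PhiV : forall U V s, open_in X U -> open_in X V -> V `<=` U ->
  ms_sec E U s -> eq_sec V (Phi V s) (Phi U s).

Lemma iso_comb U (I : Type) (l : seq I) (f : I -> Pn k N -> k)
    (s : I -> forall y, ms_fib E y) : open_in X U ->
  (forall i, regular X U (f i)) -> (forall i, ms_sec E U (s i)) ->
  eq_sec U (Phi U (fun y => \sum_(i <- l) f i y *: s i y))
           (fun y => \sum_(i <- l) f i y *: Phi U (s i) y).
Proof.
move=> oU rf ss; have [_ _ _ addP scaleP] := PhiU oU.
elim: l => [|i l IH] x Ux dx.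
  (* [Phi] is only known to be additive and O-linear up to equality on U; the empty sum is reached
     as the multiple by the function 0 of the zero section. *)
  have h := scaleP (fun=> 0) _ (sectO_cst 0 oU) (sec0 pE oU) x Ux dx.
  rewrite big_nil -[RHS](scale0r (Phi U (fun=> 0) x)) -h; congr (Phi U _ x).
  by apply: functional_extensionality_dep => y; rewrite big_nil scaler0.
have sZ j : ms_sec E U (fun y => f j y *: s j y) by apply: (secZ pE).
have h := addP _ _ (sZ i) (sec_sum pE l oU sZ) x Ux dx.
rewrite big_cons -scaleP // -IH // -h; congr (Phi U _ x).
by apply: functional_extensionality_dep => y; rewrite big_cons.
Qed.

(** By [vanishing_section], s x = 0 means that near x the section is a combination with coefficients
    vanishing at x; the image is the same combination of images. For the converse the sections of F
    are lifted by surjectivity. The point must lie in both domains for both values to be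
    meaningful. *)
Lemma iso_vanish U s x : open_in X U -> ms_sec E U s -> U x -> ms_dom E x ->
  ms_dom F x -> s x = 0 <-> Phi U s x = 0.
Proof.
move=> oU ss Ux dx dx'; split=> [sx|Fsx].
- have [W [f [t [[oW Wx] WU fs sE]]]] := vanishing_section pE oU ss Ux dx sx.
  have [secP eqP _ _ _] := PhiU oW.
  rewrite -(PhiV oU oW WU ss Wx dx').
  have rf i : regular X W (f i) by case: (fs i).
  have st i : ms_sec E W (t i) by case: (fs i).
  have ssW := sec_sub pE oU oW WU ss.
  have sc : ms_sec E W (fun y => \sum_i f i y *: t i y).
    by apply: (sec_sum pE _ oW) => i; apply: (secZ pE).
  rewrite ((eqP _ _ ssW sc).1 sE x Wx dx') (iso_comb _ oW rf st Wx dx').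
  by apply: big1 => i _; have [_ -> _] := fs i; rewrite scale0r.
- have [secU _ _ _ _] := PhiU oU.
  have [W [f [t [[oW Wx] WU fs sE]]]] := vanishing_section pF oU (secU s ss) Ux dx' Fsx.
  have [secP eqP surP _ _] := PhiU oW.
  have /choice [u uP] : forall i, exists u, ms_sec E W u /\ eq_sec W (Phi W u) (t i).
    by move=> i; have [_ _ st] := fs i; have [u su uE] := surP _ st; exists u.
  have rf i : regular X W (f i) by case: (fs i).
  have su i : ms_sec E W (u i) by case: (uP i).
  have ssW := sec_sub pE oU oW WU ss.
  have sc : ms_sec E W (fun y => \sum_i f i y *: u i y).
    by apply: (sec_sum pE _ oW) => i; apply: (secZ pE).
  have -> : s x = (fun y => \sum_i f i y *: u i y) x.
    apply: (eqP _ _ ssW sc).2 => // y Wy dy.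
    rewrite (PhiV oU oW WU ss Wy dy) (iso_comb _ oW rf su Wy dy) sE //.
    by apply: eq_bigr => i _; have [_ ->] := uP i.
  by apply: big1 => i _; have [_ -> _] := fs i; rewrite scale0r.
Qed.

End IsoVanishing.

(** * The pull-back of the twisted tangent bundle *)

Section Curves.
Variables (k : fieldType) (char0 : [pchar k] =i pred0).

(** In characteristic 0 the images of the integers below [size p] are distinct, which are too many
    roots for a nonzero p. *)
Lemma poly_fun_eq0 (p : {poly k}) : (forall t, p.[t] = 0) -> p = 0.
Proof.
move=> p0; apply/eqP; apply: contraT => pn0.
pose s := [seq (i%:R : k) | i <- iota 0 (size p)].
have : (size s < size p)%N.
  apply: max_poly_roots pn0 _ _.
    by apply/allP => t _; apply/rootP.
  rewrite map_inj_uniq ?iota_uniq // => i j.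
  wlog ij : i j / (i <= j)%N => [h|].
    by case/orP: (leq_total i j) => [/h //|/h hh /esym/hh/esym].
  move=> /esym/eqP; rewrite -subr_eq0 -natrB // => /eqP e.
  apply/eqP; rewrite eqn_leq ij /= -subn_eq0 -leqn0 leqNgt.
  apply/negP => ji; have := natf0_pchar ji (introT eqP e).
  by case=> q; rewrite char0.
by rewrite size_map size_iota ltnn.
Qed.

(** Along the curve F K is the zero polynomial and K is not, so F vanishes identically on the curve
    and so does its derivative. *)
Lemma dir_deriv_curve N (F K : {mpoly k[N.+1]}) (g : 'I_N.+1 -> {poly k}) :
  (forall t, value F (\row_i (g i).[t]) * value K (\row_i (g i).[t]) = 0) ->
  value K (\row_i (g i).[0]) != 0 ->
  dir_deriv F (\row_i (g i).[0]) (\row_i (g i)^`().[0]) = 0.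
Proof.
move=> FK K0; rewrite -deriv_along.
suff -> : along g F = 0 by rewrite derivC horner0.
have /eqP : along g F * along g K = 0.
  by apply: poly_fun_eq0 => t; rewrite hornerM !horner_along FK.
rewrite mulf_eq0 => /orP [/eqP //|/eqP K0']; move: K0.
by rewrite -horner_along K0' horner0 eqxx.
Qed.

End Curves.

(** * Partial derivatives of local fractions *)

Section Coefficients.
Variables (k : fieldType) (N : nat) (X : set (Pn k N)).
Implicit Types (G H : {mpoly k[N.+1]}).

(** The common factor X_i makes the degree positive, as the degree count for partial derivatives
    requires. *)
Lemma regular_local U f x : regular X U f -> nbhd_in X x U ->
  exists W d G H, [/\ nbhd_in X x W, W `<=` U, is_homog d.+1 G /\ is_homog d.+1 H &
    forall y, W y -> germ_frac X y f d.+1 G H].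
Proof.
move=> rf [oU Ux]; have Xx := oU.1 x Ux.
have [a [b [G [H [[hG hH] ab Hx fE]]]]] := sectO_frac rf Ux.
move: ab hG; rewrite addr0 => -[->] hG.
have [i xi] := rep_coord x; have nx : value (H * 'X_i) (rep x) != 0.
  by rewrite valueM valueX mulf_neq0.
have hX := homogX k i.
have hH1 : is_homog b.+1 (H * 'X_i) by rewrite -addn1; exact: dhomogM.
have hG1 : is_homog b.+1 (G * 'X_i) by rewrite -addn1; exact: dhomogM.
exists (basic_open X (H * 'X_i)), b, (G * 'X_i), (H * 'X_i); split=> //.
- exact: basic_nbhd hH1 Xx nx.
- move=> y [Xy]; rewrite valueM mulf_eq0 negb_or => /andP [Hy _].
  by case: (fE y Xy Hy).
- move=> y [Xy Hy]; split=> // z Xz.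
  rewrite !valueM mulf_eq0 negb_or => /andP [Hz zi].
  by have [_ ->] := fE z Xz Hz; rewrite -mulf_div divff // mulr1.
Qed.

Definition qcoef G H j := G^`M(j) * H - G * H^`M(j).

Lemma qderivE x w G H :
  qderiv x w G H = \sum_j w 0 j * (value (qcoef G H j) (rep x) / value (H * H) (rep x)).
Proof.
rewrite /qderiv /dir_deriv mulr_suml mulr_sumr -sumrB mulr_suml.
apply: eq_bigr => j _; rewrite /qcoef valueB !valueM -expr2; ring.
Qed.

Lemma sectO_qcoef W d G H j : open_in X W -> is_homog d.+1 G -> is_homog d.+1 H ->
  (forall y, W y -> value H (rep y) != 0) ->
  sectO X (-1) W (fun y => value (qcoef G H j) (rep y) / value (H * H) (rep y)).
Proof.
move=> oW hG hH nz; apply: (sectO_ratio (a := (d + d.+1)%N) (b := (d.+1 + d.+1)%N)) => //.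
- apply: rpredB; first exact: dhomogM (mderiv_homog j hG) hH.
  by rewrite addnC; exact: dhomogM hG (mderiv_homog j hH).
- exact: dhomogM.
- by rewrite !PoszD; ring.
- by move=> y Wy; rewrite valueM mulf_neq0 ?nz.
Qed.

End Coefficients.

(** * Vector fields on projective space *)

Section ProjectiveSpace.
Variables (k : fieldType) (char0 : [pchar k] =i pred0) (r : nat).
Local Notation Y := (setT : set (Pn k r)).
Implicit Types (z : Pn k r) (V W : set (Pn k r)).

Lemma tangent_vecT z w : tangent_vec Y z w.
Proof.
move=> a b F K hF hK Kz van; have [i zi] := rep_coord z.
pose g j : {poly k} := (rep z 0 j)%:P + (w 0 j) *: 'X.
have gE t : \row_j (g j).[t] = rep z + t *: w.
  by apply/rowP => j; rewrite !mxE hornerD hornerZ hornerC hornerX mulrC.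
have g'E : \row_j (g j)^`().[0] = w.
  by apply/rowP => j; rewrite mxE derivD derivZ derivC derivX add0r hornerZ hornerC mulr1.
have g0 : \row_j (g j).[0] = rep z by rewrite gE scale0r addr0.
rewrite -[w]g'E -g0; apply: (dir_deriv_curve char0 (K := K * 'X_i)) => [t|]; last first.
  by rewrite g0 valueM valueX mulf_neq0.
(* The line may pass through the zero vector, which is no point; there the factor X_i vanishes. *)
have [v0|v0] := eqVneq (\row_j (g j).[t]) 0.
  by rewrite v0 valueM valueX mxE mulr0 mulr0.
have [y [c [c0 yE]]] := Pn_of_vec v0.
rewrite valueM; case: (eqVneq (value K (\row_j (g j).[t])) 0) => [->|Kt].
  by rewrite mul0r mulr0.
have Ky : value K (rep y) != 0 by rewrite (value_rep_eq0 hK c0 yE).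
by have /eqP := van y I Ky; rewrite (value_rep_eq0 hF c0 yE) => /eqP ->; rewrite mul0r.
Qed.

Lemma dvecT_sum z (I : Type) (l : seq I) (P : pred I) (w : I -> 'rV[k]_r.+1) :
  dvec Y z (\sum_(i <- l | P i) w i) = \sum_(i <- l | P i) dvec Y z (w i).
Proof.
have d0 : dvec Y z 0 = 0.
  apply/dvec_eq0 => //; first exact: tangent_vecT.
  by exists 0; rewrite scale0r.
elim/big_rec2: _ => [//|i x y _ <-].
by rewrite -[w i]scale1r dvec_linear ?scale1r //; exact: tangent_vecT.
Qed.

Lemma dvecTZ z a w : dvec Y z (a *: w) = a *: dvec Y z w.
Proof.
have := dvecT_sum z (nil : seq 'I_1) predT (fun=> 0); rewrite !big_nil => d0.
by rewrite -[a *: w]addr0 dvec_linear ?d0 ?addr0 //; exact: tangent_vecT.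
Qed.

Lemma tangent_coordT (i : 'I_r.+1) z (v : tangent Y z) : rep z 0 i != 0 ->
  v = dvec Y z (tan_coord 'X_i v).
Proof.
move=> zi; apply: tangent_dvec => //; [exact: homogX|by rewrite valueX|].
exact: tangent_vecT.
Qed.

Lemma tan_coord_sum (i : 'I_r.+1) z n (g : 'I_n -> k) (t : 'I_n -> tangent Y z) :
  tan_coord 'X_i (\sum_j g j *: t j) = \sum_j g j *: tan_coord 'X_i (t j).
Proof.
elim/big_rec2: _ => [|j x y _ <-].
  by apply/rowP => l; rewrite !mxE tangent0E mulr0.
by apply/rowP => l; rewrite !mxE tangent_linE mulrDr mulrCA.
Qed.

(** As in the Euler sequence, vector fields correspond to direction vectors of degree 1; this lemma
    and [coord_field] are the two directions. *)
Lemma field_coord (i : 'I_r.+1) V t : open_in Y V -> (forall z, V z -> rep z 0 i != 0) ->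
  vf_sec (tangent_bundle Y) V t -> vsect Y 1 V (fun z => tan_coord 'X_i (t z)).
Proof.
move=> oV nz st j.
apply: (sectO_ext (f := fun z => rep z 0 i * t z (affine_coord 'X_i j))).
  by move=> z _; rewrite !mxE valueX.
apply: (sectOM' (d := 1) (e := 0)) => //; first exact: sectO_coord.
apply: st => //.
apply: sectO_ext (sectO_ratio oV (homogX k j) (homogX k i) _ _) => //.
  by move=> z _; rewrite valueX.
by move=> z Vz; rewrite valueX nz.
Qed.

Lemma coord_field V a : open_in Y V -> vsect Y 1 V a ->
  vf_sec (tangent_bundle Y) V (fun z => dvec Y z (a z)).
Proof.
move=> oV sa W f oW WV rf; apply: sectO_local => z Wz.
have [W' [d [G [H [nW' W'W [hG hH] fE]]]]] := regular_local rf (conj oW Wz).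
exists W'; first by split.
have oW' := nW'.1.
apply: (@sectO_ext _ _ _ _ _ (fun y =>
  \sum_j a y 0 j * (value (qcoef G H j) (rep y) / value (H * H) (rep y)))).
  move=> y Wy; rewrite (dvecE _ (@tangent_vecT y (a y)) (fE y Wy)) //.
  by rewrite qderivE.
apply: sectO_sum => // j _; apply: (sectOM' (d := 1) (e := -1)) => //.
  by apply: sectO_sub (sa j) => // y /W'W /WV.
by apply: sectO_qcoef hG hH _ => // y /fE [].
Qed.

Lemma twisted_coord (i : 'I_r.+1) V s : open_in Y V -> (forall z, V z -> rep z 0 i != 0) ->
  vf_sec (TPn_twisted k r) V s -> vsect Y (-1) V (fun z => tan_coord 'X_i (s z)).
Proof.
move=> oV nz ss j; apply: sectO_local => z Vz.
have [W [n [g [t [nW WV gt sE]]]]] := ss z Vz.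
exists W; first by split.
have oW := nW.1.
apply: (@sectO_ext _ _ _ _ _ (fun y => \sum_l g l y * tan_coord 'X_i (t l y) 0 j)).
  move=> y Wy; rewrite sE // tan_coord_sum summxE.
  by apply: eq_bigr => l _; rewrite [RHS]mxE.
apply: sectO_sum => // l _; have [gl tl] := gt l.
apply: (sectOM' (d := -2) (e := 1)) => //.
by have := field_coord oW _ tl (i := i) => /(_ _ j); apply => y /WV /nz.
Qed.

End ProjectiveSpace.

(** * Presentation of the pull-back *)

Section Pullback.
Variables (k : fieldType) (char0 : [pchar k] =i pred0) (N r : nat).
Variables (X : set (Pn k N)) (M : 'M[k]_(N.+1, r.+1)).
Variables (phi : Pn k N -> Pn k r) (c : Pn k N -> k).
Hypothesis phiE : forall x, X x -> c x != 0 /\ rep (phi x) = c x *: (rep x *m M).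
Local Notation Y := (setT : set (Pn k r)).

Definition pull_poly (G : {mpoly k[r.+1]}) : {mpoly k[N.+1]} :=
  mmap (@mpolyC N.+1 k) (fun i => lin_poly (col i M)) G.

Lemma value_pull_poly G v : value (pull_poly G) v = value G (v *m M).
Proof.
rewrite /pull_poly; elim/mpoly_ring_ind: G => [a|i|F G IF IG|F G IF IG].
- by rewrite mmapC !valueC.
- rewrite mmapX mmap1U valueX value_lin_poly !mxE.
  by apply: eq_bigr => j _; rewrite mxE.
- by rewrite mmapD !valueD IF IG.
- by rewrite rmorphM !valueM IF IG.
Qed.

Lemma pull_poly_homog d G : is_homog d G -> is_homog d (pull_poly G).
Proof.
move=> /dhomogP hG; rewrite /pull_poly /mmap big_seq.
apply: sum_homog => m /hG <-; rewrite mul_mpolyC; apply: dhomogZ.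
rewrite /mmap1 /= mdegE; apply: prod_homog => i _.
by have := dhomogMn (m i) (lin_poly_homog (col i M)); rewrite mul1n.
Qed.

(** The vectors rep (phi y) and rep y M differ by the non-algebraic scalar c y. As b has degree -1,
    the factor c y compensates for it. *)
Lemma pull_sectO V W b : open_in X W -> (forall y, W y -> V (phi y)) ->
  sectO Y (-1) V b -> sectO X (-1) W (fun y => c y * b (phi y)).
Proof.
move=> oW WV sb; apply: sectO_local => x Wx.
have [a [e [G [H [[hG hH] ae Hx bE]]]]] := sectO_frac sb (WV x Wx).
have valE d F y : is_homog d F -> X y ->
    value F (rep (phi y)) = c y ^+ d * value (pull_poly F) (rep y).
  by move=> hF Xy; rewrite value_pull_poly -(value_scale _ _ hF); have [_ ->] := phiE Xy.
have nz y : X y -> (value H (rep (phi y)) != 0) = (value (pull_poly H) (rep y) != 0).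
  move=> Xy; rewrite (valE e) // mulf_eq0 expf_eq0.
  by have [/negbTE -> _] := phiE Xy; rewrite andbF.
have Xx := oW.1 x Wx.
have nx : value (pull_poly H) (rep x) != 0 by rewrite -nz.
have nI := nbhd_inI (conj oW Wx) (basic_nbhd (pull_poly_homog hH) Xx nx).
set W' := W `&` _ in nI; have oW' := nI.1.
exists W'; first by split=> // y [].
have e_a : e = a.+1 by apply/eqP; rewrite -eqz_nat -addn1 PoszD ae subrK.
apply: sectO_ext (sectO_ratio oW' (pull_poly_homog hG) (pull_poly_homog hH) ae _).
  move=> y [Wy [Xy Hy]]; have [_ ->] := bE (phi y) I (etrans (nz y Xy) Hy).
  rewrite (valE a) // (valE e) // e_a exprS.
  by have [c0 _] := phiE Xy; field; rewrite c0 Hy expf_neq0.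
by move=> y [_ []].
Qed.

(** Here u is a direction of degree -1 at the vector rep x M; passing to rep (phi x), which is c x
    times that vector, divides it by c x. *)
Definition pull_vec x (u : 'rV[k]_r.+1) : tangent Y (phi x) :=
  dvec Y (phi x) ((c x)^-1 *: u).

Lemma pullback_presented : (forall x, X x -> rep x *m M != 0) ->
  presented X M (E := pullback X Y phi (TPn_twisted k r)) pull_vec.
Proof.
move=> M0; have tv := tangent_vecT char0.
split=> //= [x a u v Xx|x u Xx _|U s oU|W a oW sa h y Wy]; last exact: h.
- by rewrite /pull_vec scalerDr scalerA mulrC -scalerA dvec_linear.
- have [c0 pE] := phiE Xx; rewrite /pull_vec dvec_eq0 //; split=> -[d dE].
    exists (c x * d * c x).
    by rewrite -[LHS](scalerKV c0) dE pE !scalerA mulrA.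
  exists (d * (c x)^-2); rewrite dE pE !scalerA.
  by congr (_ *: _); field.
split=> ss x Ux.
- have Xx := oU.1 x Ux.
  have [W [V [n [f [t [[[oW Wx] WU] oV WV ft sE]]]]]] := ss x Ux.
  have [i zi] := rep_coord (phi x).
  have oV' := open_inI oV (basic_open_in Y (homogX k i)).
  set V' := V `&` _ in oV'.
  have [c0 pE] := phiE Xx.
  have nx : value (pull_poly 'X_i) (rep x) != 0.
    by move: zi; rewrite value_pull_poly valueX pE mxE mulf_eq0 negb_or => /andP [].
  have nI := nbhd_inI (conj oW Wx) (basic_nbhd (pull_poly_homog (homogX k i)) Xx nx).
  set W' := W `&` _ in nI; have oW' := nI.1; have W'X := oW'.1.
  have WV' y : W' y -> V' (phi y).
    move=> [Wy [Xy]]; rewrite value_pull_poly valueX => yi; split; first exact: WV.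
    split=> //; have [cy ->] := phiE Xy.
    by rewrite valueX mxE mulf_neq0.
  have nz z : V' z -> rep z 0 i != 0 by move=> [_ [_]]; rewrite valueX.
  have st j : vf_sec (TPn_twisted k r) V' (t j).
    have [_ tj] := ft j; move=> z Vz; have [Vz' _] := Vz.
    have [W1 [n1 [g1 [t1 [nW1 W1V gt1 tE1]]]]] := tj z Vz'.
    have nI1 : nbhd_in Y z (W1 `&` V') by apply: nbhd_inI.
    exists (W1 `&` V'), n1, g1, t1; split=> //.
    + move=> l; have [gl tl] := gt1 l; split.
        by apply: sectO_sub gl; [case: nI1|move=> y []].
      by move=> W2 f2 oW2 W2V; apply: tl => // y /W2V [].
    + by move=> y [Wy _]; exact: tE1.
  (* The factor c y cancels the inverse in [pull_vec] and makes the coordinates regular by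
     [pull_sectO]. *)
  exists W', (fun y => \sum_j (f j y * c y) *: tan_coord 'X_i (t j (phi y))).
  split=> //; first by move=> y [/WU].
  split.
    move=> l; apply: (@sectO_ext _ _ _ _ _ (fun y =>
      \sum_j f j y * (c y * tan_coord 'X_i (t j (phi y)) 0 l))).
      by move=> y _; rewrite summxE; apply: eq_bigr => j _; rewrite [RHS]mxE mulrA.
    apply: sectO_sum => // j _; apply: (sectOM' (d := 0) (e := -1)) => //.
      by have [fj _] := ft j; apply: sectO_sub fj => // y [].
    exact: (pull_sectO oW' WV' (twisted_coord oV' nz (st j) l)).
  move=> y Wy _; have [Wy' [Xy yi]] := Wy; have [cy _] := phiE Xy.
  rewrite sE // /pull_vec scaler_sumr dvecT_sum //; apply: eq_bigr => j _.
  rewrite scalerA mulrCA mulVf // mulr1 dvecTZ //; congr (_ *: _).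
  by apply: tangent_coordT => //; apply: nz; exact: WV'.
- have Xx := oU.1 x Ux.
  have [W [a [[oW Wx] WU [sa sE]]]] := ss x Ux.
  have [i zi] := rep_coord (phi x).
  have oV := basic_open_in Y (homogX k i).
  set V := basic_open _ _ in oV.
  have [c0 pE] := phiE Xx.
  have nx : value (pull_poly 'X_i) (rep x) != 0.
    by move: zi; rewrite value_pull_poly valueX pE mxE mulf_eq0 negb_or => /andP [].
  have nI := nbhd_inI (conj oW Wx) (basic_nbhd (pull_poly_homog (homogX k i)) Xx nx).
  set W' := W `&` _ in nI; have oW' := nI.1; have W'X := oW'.1.
  have invi : sectO Y (-1) V (fun z => (rep z 0 i)^-1).
    apply: sectO_ext (sectO_inv oV (homogX k i) _) => [z _|z []//].
    by rewrite valueX.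
  (* With z = phi y, the vector a is the sum of the a_j (y M)_i times delta_j / (y M)_i: the
     coefficients have degree 0 and the vectors delta_j / z_i are sections downstairs. *)
  exists W', V, r.+1, (fun j y => a y 0 j * (rep y *m M) 0 i),
    (fun j z => dvec Y z ((rep z 0 i)^-1 *: delta_mx 0 j)).
  split=> //.
  + by split=> // y [/WU].
  + move=> y [Wy [Xy]]; rewrite value_pull_poly valueX => yi.
    split=> //; have [cy ->] := phiE Xy.
    by rewrite valueX mxE mulf_neq0.
  + move=> j; split.
      apply: (sectOM' (d := -1) (e := 1)) => //.
        by apply: sectO_sub (sa j) => // y [].
      exact: (vsect_mulmx M oW' (vsect_rep oW') i).
    (* As a section of the twist, delta_j / z_i is z_i^-2, of degree -2, times the vector field z_i
       delta_j. *)
    move=> z Vz; exists V, 1%N, (fun _ z => (rep z 0 i)^-1 ^+ 2),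
      (fun _ z => dvec Y z (rep z 0 i *: delta_mx 0 j)).
    split=> //.
      move=> _; split; first by apply: (sectOM' (d := -1) (e := -1)).
      apply: coord_field => //; apply: (vsectZ (d := 1) (e := 0)) => //.
        exact: sectO_coord.
      exact: vsect_cst.
    move=> y [_]; rewrite valueX => yi; rewrite big_ord1 !dvecTZ // scalerA.
    by congr (_ *: _); field.
  + move=> y [Wy [Xy]]; rewrite value_pull_poly valueX => yi.
    rewrite sE // {1}[a y]row_sum_delta /pull_vec scaler_sumr dvecT_sum //.
    apply: eq_bigr => j _; have [cy pEy] := phiE Xy.
    rewrite !dvecTZ // !scalerA pEy; congr (_ *: _).
    by move: (rep y *m M) yi => w wi; rewrite mxE; field; rewrite cy wi.
Qed.

End Pullback.

(** * Bilinear forms *)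

Section Bilinear.
Variables (k : fieldType) (N : nat) (S : 'M[k]_N.+1).
Implicit Types u v w : 'rV[k]_N.+1.

Definition bil u v := (u *m S *m v^T) 0 0.

Lemma bil_linl a u u' v : bil (a *: u + u') v = a * bil u v + bil u' v.
Proof. by rewrite /bil mulmxDl -scalemxAl mulmxDl -scalemxAl !mxE. Qed.

Lemma bil_linr a u v v' : bil u (a *: v + v') = a * bil u v + bil u v'.
Proof. by rewrite /bil linearD linearZ mulmxDr -scalemxAr !mxE. Qed.

Lemma bilDl u u' v : bil (u + u') v = bil u v + bil u' v.
Proof. by rewrite -[u]scale1r bil_linl mul1r scale1r. Qed.

Lemma bilDr u v v' : bil u (v + v') = bil u v + bil u v'.
Proof. by rewrite -[v]scale1r bil_linr mul1r scale1r. Qed.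

Lemma bil0l v : bil 0 v = 0.
Proof. by rewrite /bil !mul0mx mxE. Qed.

Lemma bil0r v : bil v 0 = 0.
Proof. by rewrite /bil trmx0 mulmx0 mxE. Qed.

Lemma bilZl a u v : bil (a *: u) v = a * bil u v.
Proof. by rewrite -[a *: u]addr0 bil_linl bil0l addr0. Qed.

Lemma bilZr a u v : bil u (a *: v) = a * bil u v.
Proof. by rewrite -[a *: v]addr0 bil_linr bil0r addr0. Qed.

Lemma bilNl u v : bil (- u) v = - bil u v.
Proof. by rewrite -scaleN1r bilZl mulN1r. Qed.

Lemma bilNr u v : bil u (- v) = - bil u v.
Proof. by rewrite -scaleN1r bilZr mulN1r. Qed.

Definition bilE := (bilDl, bilDr, bilZl, bilZr, bilNl, bilNr, bil0l, bil0r).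

Lemma bil_suml (I : Type) (l : seq I) (P : pred I) (u : I -> 'rV[k]_N.+1) v :
  bil (\sum_(i <- l | P i) u i) v = \sum_(i <- l | P i) bil (u i) v.
Proof.
elim/big_rec2: _ => [|i x y _ <-]; first exact: bil0l.
by rewrite bilDl.
Qed.

Lemma bil_lin_poly u v : value (lin_poly (S *m u^T)) v = bil v u.
Proof. by rewrite value_lin_poly mulmxA. Qed.

Hypothesis symS : S^T = S.

Lemma bilC u v : bil u v = bil v u.
Proof.
rewrite /bil -[in RHS](trmxK (v *m S *m u^T)) [RHS]mxE !trmx_mul trmxK symS.
by rewrite mulmxA.
Qed.

Hypothesis unitS : S \in unitmx.

Lemma bil_nondeg u : (forall v, bil u v = 0) -> u = 0.
Proof.
move=> h; suff uS : u *m S = 0 by rewrite -[u](mulmxK unitS) uS mul0mx.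
apply/rowP => i; have := h (delta_mx 0 i).
by rewrite /bil trmx_delta -colE mxE => ->; rewrite mxE.
Qed.

Lemma bil_neq0 y : y != 0 -> exists v, bil y v != 0.
Proof.
move=> y0; apply: contrapT => h; case/eqP: y0; apply: bil_nondeg => v.
by apply: contrapT => /eqP yv; apply: h; exists v.
Qed.

(** Fix v not orthogonal to y. Any w minus a multiple of v is orthogonal to y, hence to u; so u and
    its candidate multiple of y pair equally with w, and nondegeneracy applies. *)
Lemma bil_orth_line u y : y != 0 ->
  (forall v, bil y v = 0 -> bil u v = 0) -> exists c, u = c *: y.
Proof.
move=> y0 h; have [v yv] := bil_neq0 y0.
exists (bil u v / bil y v); apply/eqP; rewrite -subr_eq0; apply/eqP.
apply: bil_nondeg => w.
have := h (w - (bil y w / bil y v) *: v); rewrite !bilE => E.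
by have := E _; rewrite divfK // subrr => /(_ erefl) <-; field.
Qed.

Hypothesis two : 2%:R != 0 :> k.

(** Otherwise the orthogonal complement of the a_i is totally isotropic. By polarisation the
    projection [pr] of every vector is then orthogonal to everything, hence 0, so the m vectors a_i
    span a space of dimension N + 1 > m. *)
Lemma orth_anisotropic m (a : 'I_m -> 'rV[k]_N.+1) : (m < N.+1)%N ->
  (forall i, bil (a i) (a i) != 0) -> (forall i j, i != j -> bil (a i) (a j) = 0) ->
  exists2 w, forall i, bil w (a i) = 0 & bil w w != 0.
Proof.
move=> mN an orth; apply: contrapT => h.
have iso w : (forall i, bil w (a i) = 0) -> bil w w = 0.
  by move=> wa; apply: contrapT => /eqP nz; apply: h; exists w.
have [pr prD] : exists pr, forall u,
    pr u = u - \sum_i (bil u (a i) / bil (a i) (a i)) *: a i by eexists.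
have prE u i : bil (pr u) (a i) = 0.
  rewrite prD bilDl bilNl bil_suml (bigD1 i) //= bilZl divfK // big1 ?addr0 ?subrr //.
  by move=> j ji; rewrite bilZl (orth _ _ ji) mulr0.
have pr0 u : pr u = 0.
  apply: bil_nondeg => v.
  have -> : bil (pr u) v = bil (pr u) (pr v).
    rewrite (prD v) bilDr bilNr (bilC (pr u) (\sum__ _)) bil_suml.
    rewrite big1 ?subr0 // => i _.
    by rewrite bilZl (bilC (a i) (pr u)) prE mulr0.
  have := iso (pr u + pr v); rewrite !bilE (iso (pr u)) ?(iso (pr v)) // add0r addr0.
  rewrite (bilC (pr v)) -mulr2n -mulr_natl => E.
  apply/eqP; rewrite -(mulrI_eq0 _ (mulfI two)); apply/eqP; apply: E => i.
  by rewrite bilDl !prE addr0.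
pose A := \matrix_i a i.
pose C := \matrix_(j < N.+1, i < m)
  (bil (delta_mx 0 j) (a i) / bil (a i) (a i)).
have : (1%:M : 'M[k]_N.+1) = C *m A.
  apply/row_matrixP => j; rewrite row1 row_mul.
  apply/eqP; rewrite -subr_eq0; apply/eqP; rewrite -[RHS](pr0 (delta_mx 0 j)) prD.
  congr (_ - _); rewrite mulmx_sum_row; apply: eq_bigr => i _.
  by rewrite rowK !mxE.
move=> /(congr1 mxrank); rewrite mxrank1 => E.
have := leq_trans (mxrankM_maxr C A) (rank_leq_row A).
by rewrite -E leqNgt mN.
Qed.

(** Completion to a hyperbolic plane: correct any u with B y u = 1 by a multiple of y. *)
Lemma isotropic_partner y : y != 0 -> bil y y = 0 -> exists2 z, bil z z = 0 & bil y z = 1.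
Proof.
move=> y0 yy; have [v yv] := bil_neq0 y0.
have [u yu] : exists u, bil y u = 1 by exists ((bil y v)^-1 *: v); rewrite bilZr mulVf.
exists (u - (bil u u / 2%:R) *: y); rewrite !bilE yy ?yu; last by ring.
by rewrite (bilC u y) yu; field.
Qed.

End Bilinear.

(** * Irreducibility and tangent spaces of a quadric *)

Lemma closed_sqrt (k : closedFieldType) (a : k) : exists b, b ^+ 2 = a.
Proof.
have [b bE] := @solve_monicpoly k 2 (fun i => if i == 0%N then a else 0) isT.
by exists b; rewrite bE big_ord_recl big_ord1 /= mul0r addr0 expr0 mulr1.
Qed.

Section Quadric.
Variables (k : closedFieldType) (char0 : [pchar k] =i pred0).
Variables (N : nat) (N2 : (2 <= N)%N) (S : 'M[k]_N.+1).
Hypotheses (symS : S^T = S) (unitS : S \in unitmx).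
Variable q : {mpoly k[N.+1]}.
Hypotheses (qE : forall v, value q v = bil S v v) (hq : is_homog 2 q).
Local Notation B := (bil S).
Local Notation Q := (zeros [:: q]).
Implicit Types (u v w p : 'rV[k]_N.+1) (F G H K : {mpoly k[N.+1]}).

Lemma two_neq0 : 2%:R != 0 :> k.
Proof. by apply/negP => h; have [//|l] := natf0_pchar _ h; rewrite char0. Qed.

Lemma quadricP x : Q x <-> B (rep x) (rep x) = 0.
Proof.
rewrite -qE; split=> [h|h F]; first by apply: h; rewrite inE.
by rewrite inE => /eqP ->.
Qed.

Lemma quadric_pt v : v != 0 -> B v v = 0 ->
  exists x c, [/\ Q x, c != 0 & rep x = c *: v].
Proof.
move=> v0 vv; have [x [c [c0 xE]]] := Pn_of_vec v0; exists x, c; split=> //.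
by apply/quadricP; rewrite xE bilZl bilZr vv !mulr0.
Qed.

Lemma anisotropic_scale v a : B v v != 0 -> a != 0 -> exists2 c, c != 0 & B (c *: v) (c *: v) = a.
Proof.
move=> vv a0; have [c cE] := closed_sqrt (a / B v v); exists c.
  by have := sqrf_eq0 c; rewrite cE mulf_eq0 invr_eq0 (negbTE a0) (negbTE vv) => <-.
by rewrite bilZl bilZr mulrA -expr2 cE divfK.
Qed.

(* The factor [v 0 i] covers the case [v = 0]. *)
Lemma vanish_vec a b F K i v : is_homog a F -> is_homog b K ->
  (forall x, Q x -> value K (rep x) != 0 -> value F (rep x) = 0) ->
  B v v = 0 -> value F v * value (K * 'X_i) v = 0.
Proof.
move=> hF hK van vv; rewrite valueM valueX.
have [->|v0] := eqVneq v 0; first by rewrite mxE !mulr0.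
have [x [c [Qx c0 xE]]] := quadric_pt v0 vv.
have [->|Kv] := eqVneq (value K v) 0; first by rewrite mul0r mulr0.
have := van x Qx; rewrite (value_rep_eq0 hK c0 xE) => /(_ Kv)/eqP.
by rewrite (value_rep_eq0 hF c0 xE) => /eqP ->; rewrite mul0r.
Qed.

Definition qcurve u v w : 'I_N.+1 -> {poly k} :=
  fun i => (u 0 i)%:P + v 0 i *: 'X + w 0 i *: 'X^2.

Lemma qcurveE u v w t : \row_i (qcurve u v w i).[t] = u + t *: v + t ^+ 2 *: w.
Proof.
apply/rowP => i; rewrite !mxE !hornerD !hornerZ hornerC hornerX hornerXn; ring.
Qed.

Lemma qcurve_deriv u v w : \row_i (qcurve u v w i)^`().[0] = v.
Proof.
apply/rowP => i; rewrite mxE !derivD !derivZ derivC derivX derivXn.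
by rewrite !hornerD !hornerZ hornerMn hornerC hornerXn hornerC expr1 mul0rn; ring.
Qed.

Lemma quadric_tangent x w : Q x -> B (rep x) w = 0 -> tangent_vec Q x w.
Proof.
move=> /quadricP xx xw a b F K hF hK Kx van; have [i xi] := rep_coord x.
have curve u u' : (forall t, B (rep x + t *: u + t ^+ 2 *: u') (rep x + t *: u + t ^+ 2 *: u') = 0) ->
    dir_deriv F (rep x) u = 0.
  move=> iso; have := dir_deriv_curve char0 (F := F) (K := K * 'X_i) (g := qcurve (rep x) u u').
  rewrite qcurve_deriv qcurveE scale0r expr2 mul0r scale0r !addr0; apply.
    by move=> t; rewrite qcurveE; apply: vanish_vec hF hK van _.
  by rewrite valueM valueX mulf_neq0.
have [z zz xz] := isotropic_partner symS unitS two_neq0 (rep_neq0 x) xx.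
pose w' := w - B w z *: rep x.
have Fx : dir_deriv F (rep x) (rep x) = 0.
  by apply: (curve _ 0) => t; rewrite !bilE xx; ring.
have Fw : dir_deriv F (rep x) (w - B w z *: rep x) = 0.
  apply: (curve _ (- (B (w - B w z *: rep x) (w - B w z *: rep x) / 2%:R) *: z)) => t.
  have two := two_neq0.
  rewrite !bilE xx zz xw xz (bilC symS w (rep x)) xw (bilC symS z (rep x)) xz.
  by rewrite (bilC symS z w); field.
by move: Fw; rewrite addrC -scaleNr dir_deriv_linear Fx mulr0 add0r.
Qed.

Lemma quadric_irreducible a b F K x : is_homog a F -> is_homog b K -> Q x ->
  value K (rep x) != 0 ->
  (forall y, Q y -> value K (rep y) != 0 -> value F (rep y) = 0) ->
  forall y, Q y -> value F (rep y) = 0.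
Proof.
move=> hF hK /quadricP Qx Kx van y /quadricP Qy; apply/eqP; apply: contraT => Fy.
have [i xi] := rep_coord x.
pose KX := K * 'X_i; have KXx : value KX (rep x) != 0 by rewrite valueM valueX mulf_neq0.
suff [u [v [w [c [c0 gx gy iso]]]]] : exists u v w c, [/\ c != 0, u = rep x,
    u + v + w = c *: rep y & forall t, B (u + t *: v + t ^+ 2 *: w) (u + t *: v + t ^+ 2 *: w) = 0].
  have : along (qcurve u v w) F * along (qcurve u v w) KX = 0.
    apply: (poly_fun_eq0 char0) => t; rewrite hornerM !horner_along qcurveE.
    exact: vanish_vec hF hK van (iso t).
  move/eqP; rewrite mulf_eq0 => /orP [] /eqP p0.
  - have : (along (qcurve u v w) F).[1] = 0 by rewrite p0 horner0.
    rewrite horner_along qcurveE expr1n !scale1r gy (value_scale _ _ hF) => /eqP.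
    by rewrite mulf_eq0 expf_eq0 (negbTE c0) andbF (negbTE Fy).
  - have : (along (qcurve u v w) KX).[0] = 0 by rewrite p0 horner0.
    rewrite horner_along qcurveE expr2 mul0r !scale0r !addr0 gx => /eqP.
    by rewrite (negbTE KXx).
have two := two_neq0; have [xy|xy] := eqVneq (B (rep x) (rep y)) 0.
  exists (rep x), (rep y - rep x), 0, 1; rewrite oner_eq0; split=> //.
    by rewrite addr0 addrC subrK scale1r.
  by move=> t; rewrite !bilE Qx Qy (bilC symS (rep y)) xy; ring.
pose a' (j : 'I_2) := if j == 0%N :> nat then rep x + rep y else rep x - rep y.
have [||j|u uxy uu] := orth_anisotropic symS unitS two (a := a').
- by [].
- case=> [[|[|//]]] ?; rewrite /a' /= !bilE Qx Qy (bilC symS (rep y)).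
    rewrite [X in X != 0](_ : _ = 2%:R * B (rep x) (rep y)); last by ring.
    by rewrite mulf_neq0.
  rewrite [X in X != 0](_ : _ = - (2%:R * B (rep x) (rep y))); last by ring.
  by rewrite oppr_eq0 mulf_neq0.
- move=> j'; rewrite /a'; case: j j' => [[|[|//]] ?] [[|[|//]] ?] //= _;
    by rewrite !bilE Qx Qy (bilC symS (rep y)); ring.
have ux : B u (rep x) = 0.
  have := uxy (inord 0); have := uxy (inord 1); rewrite /a' !inordK //= !bilE => e1 e2.
  apply: (mulfI two); rewrite mulr0 -[RHS]addr0 -{1}e1 -e2; ring.
have uy : B u (rep y) = 0.
  have := uxy (inord 0); rewrite /a' inordK //= bilE ux add0r //.
pose c := - B u u / (2%:R * B (rep x) (rep y)).
exists (rep x), (u - 2%:R *: rep x), (rep x + c *: rep y - u), c; split=> //.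
- by rewrite mulf_neq0 ?oppr_eq0 ?invr_eq0 ?mulf_neq0.
- by apply/rowP => j; rewrite !mxE; ring.
- move=> t; rewrite !bilE Qx Qy (bilC symS (rep y) (rep x)) (bilC symS (rep x) u).
  by rewrite (bilC symS (rep y) u) ux uy /c; field; rewrite xy two.
Qed.

End Quadric.

(** * The ideal of a hyperplane section *)

Section HyperplaneSection.
Variables (k : closedFieldType) (char0 : [pchar k] =i pred0).
Variables (N : nat) (N2 : (2 <= N)%N) (S : 'M[k]_N.+1).
Hypotheses (symS : S^T = S) (unitS : S \in unitmx).
Variable q : {mpoly k[N.+1]}.
Hypotheses (qE : forall v, value q v = bil S v v) (hq : is_homog 2 q).
Local Notation B := (bil S).
Local Notation Q := (zeros [:: q]).
Variable p : 'rV[k]_N.+1.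
Hypothesis pp : B p p != 0.
Implicit Types (u v w e : 'rV[k]_N.+1) (F G H K : {mpoly k[N.+1]}).

Lemma orth_anisotropic1 : exists2 w, B w p = 0 & B w w != 0.
Proof.
have [||i j|w wp ww] := orth_anisotropic symS unitS (two_neq0 char0) (a := fun _ : 'I_1 => p).
- exact: leqW N2.
- by [].
- by rewrite (ord1 i) (ord1 j) eqxx.
- by exists w => //; exact: (wp 0).
Qed.

Lemma orth_anisotropic2 u : B p u = 0 -> B u u != 0 ->
  exists2 w, B w p = 0 /\ B w u = 0 & B w w != 0.
Proof.
move=> pu uu; have up : B u p = 0 by rewrite bilC.
pose a (i : 'I_2) := if i == 0%N :> nat then p else u.
have [||i j|w wp ww] := orth_anisotropic symS unitS (two_neq0 char0) (a := a).
- exact: N2.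
- by move=> i; rewrite /a; case: ifP.
- by case: i j => [[|[|//]] ?] [[|[|//]] ?].
exists w => //; split; first by have := wp (inord 0); rewrite /a inordK.
by have := wp (inord 1); rewrite /a inordK.
Qed.

Lemma quadric_off_section : exists x, Q x /\ B (rep x) p != 0.
Proof.
have [w wp ww] := orth_anisotropic1.
have [|c c0 cw] := anisotropic_scale ww (a := - B p p); first by rewrite oppr_eq0.
have wp' : B p w = 0 by rewrite bilC.
have vp : B (p + c *: w) p != 0 by rewrite !bilE wp mulr0 addr0.
have [||x [d [Qx d0 xE]]] := quadric_pt qE (v := p + c *: w).
- by apply: contraNneq vp => ->; rewrite bil0l.
- by rewrite bilDl !(bilDr S _ p) cw bilZr bilZl wp wp'; ring.
- by exists x; split=> //; rewrite xE bilZl mulf_neq0.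
Qed.

(* Where [q (v + t e) = 0], the relation [t ^+ 2 = - 2 B v e t - q v] reduces
   every polynomial to one of degree at most 1 in [t]. *)
Lemma reduce_along e F : B e e = 1 -> exists C D, forall v t,
  B (v + t *: e) (v + t *: e) = 0 -> value F (v + t *: e) = value C v + t * value D v.
Proof.
move=> ee; elim/mpoly_ring_ind: F => [c|i|F G [C [D IF]] [C' [D' IG]]|F G [C [D IF]] [C' [D' IG]]].
- by exists c%:MP, 0 => v t _; rewrite !valueC ?value0 mulr0 addr0.
- by exists 'X_i, (e 0 i)%:MP => v t _; rewrite !valueX valueC !mxE.
- exists (C + C'), (D + D') => v t vt; rewrite !valueD IF // IG //; ring.
- exists (C * C' - D * D' * q), (C * D' + D * C' - 2%:R *: (D * D' * lin_poly (S *m e^T))).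
  move=> v t vt; rewrite valueM IF // IG // !(valueB, valueD, valueZ, valueM).
  rewrite qE bil_lin_poly; apply/eqP; rewrite -subr_eq0; apply/eqP.
  move: vt; rewrite !bilE ee (bilC symS e v) => vt.
  by rewrite -[RHS](mulr0 (value D v * value D' v)) -vt; ring.
Qed.

Lemma divide_linear F : exists C D, forall v,
  value D v = value F (v - (B v p / B p p) *: p) /\
  value F v = value D v + B v p * value C v.
Proof.
elim/mpoly_ring_ind: F => [c|i|F G [C [D IF]] [C' [D' IG]]|F G [C [D IF]] [C' [D' IG]]].
- by exists 0, c%:MP => v; rewrite !valueC ?value0 mulr0 addr0.
- exists (p 0 i / B p p)%:MP, ('X_i - (p 0 i / B p p) *: lin_poly (S *m p^T)) => v.
  rewrite valueB valueZ !valueX valueC bil_lin_poly !mxE.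
  by split; field.
- exists (C + C'), (D + D') => v; rewrite !valueD.
  by have [-> ->] := IF v; have [-> ->] := IG v; split=> //; ring.
- exists (C * G + D * C'), (D * D') => v; rewrite !valueM valueD !valueM.
  have [<- FE] := IF v; have [<- GE] := IG v; split=> //.
  by rewrite FE GE; ring.
Qed.

Lemma homog_part d F C v : (forall t, value F (t *: v) = t ^+ d.+1 * value F v) ->
  (forall t, value F (t *: v) = t * B v p * value C (t *: v)) ->
  value F v = B v p * value (pihomog mdeg d C) v.
Proof.
move=> hF hC; pose K := maxn (msize C) d.+1.
have CE t : value C (t *: v) = \sum_(j < K) t ^+ j * value (pihomog mdeg j C) v.
  rewrite [in LHS](pihomog_partitionE (mf := mdeg) (k := K) (p := C)) ?leq_maxl //.
  by rewrite value_sum; apply: eq_bigr => j _; apply: value_scale; exact: pihomogP.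
pose P : {poly k} := \sum_(j < K) (B v p * value (pihomog mdeg j C) v) *: 'X^(j.+1)
   - (value F v) *: 'X^(d.+1).
have P0 : P = 0.
  apply: (poly_fun_eq0 char0) => t; rewrite !hornerE horner_sum.
  rewrite mulrC -hF hC CE mulr_sumr; apply/eqP; rewrite subr_eq0; apply/eqP.
  by apply: eq_bigr => j _; rewrite hornerZ hornerXn exprS; ring.
have := congr1 (fun R : {poly k} => R`_(d.+1)) P0.
rewrite coef0 coefB coefZ coefXn eqxx mulr1 coef_sum => /eqP; rewrite subr_eq0 => /eqP <-.
have dK : (d < K)%N by rewrite leq_max leqnn orbT.
rewrite (bigD1 (Ordinal dK)) //= coefZ coefXn eqxx mulr1 big1 ?addr0 // => j jd.
rewrite coefZ coefXn eqSS (_ : (d == j :> nat) = false) ?mulr0 //.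
by apply/negbTE; apply: contraNneq jd => dj; apply/eqP/val_inj.
Qed.

(* Nullstellensatz: the ideal of the section is generated by q and B(., p). *)
Lemma section_ideal d F : is_homog d.+1 F ->
  (forall x, Q x -> B (rep x) p = 0 -> value F (rep x) = 0) ->
  exists2 C, is_homog d C & forall x, Q x -> value F (rep x) = B (rep x) p * value C (rep x).
Proof.
move=> hF van; have two := two_neq0 char0.
have Fvan v : B v v = 0 -> B v p = 0 -> value F v = 0.
  move=> vv vp; have [->|v0] := eqVneq v 0.
    by have := value_scale 0 (0 : 'rV[k]_N.+1) hF; rewrite scale0r expr0n mul0r.
  have [x [c [Qx c0 xE]]] := quadric_pt qE v0 vv.
  have xp : B (rep x) p = 0 by rewrite xE bilZl vp mulr0.
  by have /eqP := van x Qx xp; rewrite (value_rep_eq0 hF c0 xE) => /eqP.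
have [e0 e0p ee0] := orth_anisotropic1.
have [e [ep ee]] : exists e, B e p = 0 /\ B e e = 1.
  have [//|c _ ce] := anisotropic_scale ee0 (a := 1); first exact: oner_neq0.
  by exists (c *: e0); rewrite bilZl e0p mulr0.
have [C0 [D0 C0E]] := reduce_along F ee.
have FC v : B v v = 0 -> value F v = value C0 v.
  by move=> vv; have := C0E v 0; rewrite scale0r addr0 mul0r addr0; apply.
pose disc v := B v e ^+ 2 - B v v.
have C0disc v : B v p = 0 -> value C0 v * disc v = 0.
  move=> vp; have [r rE] := closed_sqrt (disc v).
  have root t : t = - B v e + r \/ t = - B v e - r -> value C0 v + t * value D0 v = 0.
    move=> tE; have vt : B (v + t *: e) (v + t *: e) = 0.
      rewrite !bilE ee (bilC symS e v).
      rewrite (_ : _ + _ = (t + B v e) ^+ 2 - disc v); last by rewrite /disc; ring.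
      by rewrite -rE; case: tE => ->; ring.
    by rewrite -C0E // Fvan // bilDl bilZl vp ep mulr0 addr0.
  have r1 := root _ (or_introl erefl); have r2 := root _ (or_intror erefl).
  have D0r : value D0 v * r = 0.
    apply: (mulfI two); rewrite mulr0.
    by rewrite -[RHS](subrr 0) -{1}r1 -r2; ring.
  have C0r : value C0 v * r = 0.
    by rewrite -[RHS](mul0r r) -{1}r1 mulrDl -mulrA D0r mulr0 addr0.
  by rewrite -rE expr2 mulrA C0r mul0r.
have pe : B p e = 0 by rewrite bilC.
have een0 : B e e != 0 by rewrite ee oner_neq0.
have [f [fp fe] ff] := orth_anisotropic2 pe een0.
have C0van v : B v p = 0 -> value C0 v = 0.
  move=> vp; pose g := qcurve v (f - v) 0.
  have gE t : \row_i (g i).[t] = v + t *: (f - v) by rewrite qcurveE scaler0 addr0.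
  pose dpoly : {mpoly k[N.+1]} := lin_poly (S *m e^T) ^+ 2 - q.
  have dpolyE u : value dpoly u = disc u by rewrite valueB valueXn bil_lin_poly qE.
  have /eqP : along g C0 * along g dpoly = 0.
    apply: (poly_fun_eq0 char0) => t; rewrite hornerM !horner_along dpolyE gE.
    by apply: C0disc; rewrite !bilE vp fp; ring.
  rewrite mulf_eq0 => /orP [] /eqP h.
    have : (along g C0).[0] = 0 by rewrite h horner0.
    by rewrite horner_along gE scale0r addr0.
  have : (along g dpoly).[1] = 0 by rewrite h horner0.
  rewrite horner_along gE scale1r addrC subrK dpolyE /disc fe expr0n sub0r => /eqP.
  by rewrite oppr_eq0 (negbTE ff).
have [C1 [D1 C1E]] := divide_linear C0.
have FE v : B v v = 0 -> value F v = B v p * value C1 v.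
  move=> vv; rewrite FC //; have [D1E ->] := C1E v; rewrite D1E C0van ?add0r //.
  by rewrite bilDl bilNl bilZl divfK ?subrr.
exists (pihomog mdeg d C1); first exact: pihomogP.
move=> x /(quadricP qE) xx; apply: homog_part => t; first exact: value_scale hF.
by rewrite FE bilZl // bilZr xx !mulr0.
Qed.

End HyperplaneSection.

(** * Logarithmic forms *)

Section Cotangent.
Variables (k : fieldType) (N : nat) (X : set (Pn k N)) (x : Pn k N).
Implicit Types (w : cotangent X x) (v : tangent X x).

Lemma cotangent_linE a w w' v : (a *: w + w') v = a * w v + w' v.
Proof. by []. Qed.

Lemma cotangent0E v : (0 : cotangent X x) v = 0.
Proof. by have := cotangent_linE (-1) 0 0 v; rewrite scaler0 addr0 mulN1r addNr. Qed.

Lemma cotangentDE w w' v : (w + w') v = w v + w' v.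
Proof. by rewrite -[w]scale1r cotangent_linE mul1r scale1r. Qed.

Lemma cotangentZE a w v : (a *: w) v = a * w v.
Proof. by rewrite -[a *: w]addr0 cotangent_linE cotangent0E addr0. Qed.

Lemma cotangent_sumE (I : Type) (r : seq I) (P : pred I) (w : I -> cotangent X x) v :
  (\sum_(i <- r | P i) w i) v = \sum_(i <- r | P i) w i v.
Proof.
elim/big_rec2: _ => [|i y z _ <-]; first exact: cotangent0E.
exact: cotangentDE.
Qed.

Lemma cotangent_eq w w' : (forall v, w v = w' v) -> w = w'.
Proof. by move=> h; apply: val_inj; apply/funext. Qed.

Lemma differentialE f v : differential X x f v = v f.
Proof. by []. Qed.

End Cotangent.

Lemma proportionalP (k : fieldType) r (u w : 'rV[k]_r) : w != 0 ->
  (forall i j, u 0 i * w 0 j = u 0 j * w 0 i) <-> exists c, u = c *: w.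
Proof.
move=> w0; split=> [h|[c ->] i j]; last by rewrite !mxE; ring.
have /existsP [j wj] : [exists j, w 0 j != 0].
  apply: contraNT w0; rewrite negb_exists => /forallP h0.
  by apply/eqP/rowP => i; rewrite mxE; move: (h0 i); rewrite negbK => /eqP.
exists (u 0 j / w 0 j); apply/rowP => i; rewrite mxE.
by apply: (mulIf wj); rewrite h; field.
Qed.

Section LogForms.
Variables (k : closedFieldType) (char0 : [pchar k] =i pred0).
Variables (r : nat) (r1 : (1 <= r)%N) (S : 'M[k]_r.+2).
Hypotheses (symS : S^T = S) (unitS : S \in unitmx).
Variable q : {mpoly k[r.+2]}.
Hypotheses (qE : forall v, value q v = bil S v v) (hq : is_homog 2 q).
Hypothesis dqE : forall v w, dir_deriv q v w = 2%:R * bil S v w.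
Local Notation B := (bil S).
Local Notation Q := (zeros [:: q]).
Variable p : 'rV[k]_r.+2.
Hypothesis pp : B p p != 0.
Local Notation l := (lin_poly (S *m p^T)).
Local Notation D := (zeros [:: q; l]).
Variables (M : 'M[k]_(r.+2, r.+1)) (M' : 'M[k]_(r.+1, r.+2)).
Hypotheses (kerM : forall u : 'rV_r.+2, u *m M = 0 <-> exists c, u = c *: p).
Hypothesis (M'K : M' *m M = 1%:M).
Implicit Types (u v w : 'rV[k]_r.+2) (F G H K : {mpoly k[r.+2]}) (x y : Pn k r.+1).

Let r2 : (2 <= r.+1)%N := r1.

Lemma sectionP x : D x <-> Q x /\ B (rep x) p = 0.
Proof.
rewrite -bil_lin_poly; split=> [h|[hQ hl] F].
  by split=> [F|]; [rewrite inE => /eqP ->; apply: h|apply: h]; rewrite !inE eqxx ?orbT.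
by rewrite !inE => /orP [/eqP ->|/eqP -> //]; apply: hQ; rewrite inE.
Qed.

Lemma off_sectionP x : Q x -> ~ D x <-> B (rep x) p != 0.
Proof.
move=> Qx; split=> [nD|nz /sectionP [_ /eqP]]; last by rewrite (negbTE nz).
by apply/eqP => xp; apply: nD; apply/sectionP.
Qed.

Lemma section_dense a b F K x : is_homog a F -> is_homog b K -> Q x ->
  value K (rep x) != 0 ->
  (forall y, Q y -> B (rep y) p != 0 -> value K (rep y) != 0 -> value F (rep y) = 0) ->
  forall y, Q y -> value F (rep y) = 0.
Proof.
move=> hF hK Qx Kx van; have irr := quadric_irreducible char0 r2 symS unitS qE.
apply: (irr _ _ _ _ x hF hK Qx Kx) => y Qy Ky.
have [x1 [Qx1 x1p]] := quadric_off_section char0 r2 symS unitS qE pp.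
have := irr _ _ _ _ x1 (dhomogM hF hK) (lin_poly_homog (S *m p^T)) Qx1.
rewrite bil_lin_poly => /(_ x1p) FK; apply/eqP; have := FK _ y Qy; rewrite valueM => FK0.
have /eqP : value F (rep y) * value K (rep y) = 0.
  apply: FK0 => z Qz; rewrite bil_lin_poly valueM => zp.
  by have [->|Kz] := eqVneq (value K (rep z)) 0; rewrite ?mulr0 // van ?mul0r.
by rewrite mulf_eq0 (negbTE Ky) orbF.
Qed.

Lemma rep_mulM_neq0 x : Q x -> rep x *m M != 0.
Proof.
move=> /(quadricP qE) xx; apply: contra (rep_neq0 x) => /eqP /kerM [c xE].
move/eqP: xx; rewrite xE bilZl bilZr !mulf_eq0 (negbTE pp) orbF orbb => /eqP ->.
by rewrite scale0r.
Qed.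

Lemma in_line_dense W (a : Pn k r.+1 -> 'rV[k]_r.+1) : open_in Q W -> vsect Q (-1) W a ->
  (forall y, W y -> ~ D y -> in_line M y (a y)) -> forall y, W y -> in_line M y (a y).
Proof.
move=> oW sa off y Wy; have Qy := oW.1 y Wy.
have [m [b [G [H [[hG hH] mb Hy aE]]]]] := vsect_frac sa Wy.
apply/(proportionalP _ (rep_mulM_neq0 Qy)) => i j.
pose L j' := lin_poly (col j' M).
have LE j' z : value (L j') (rep z) = (rep z *m M) 0 j'.
  by rewrite value_lin_poly !mxE; apply: eq_bigr => i' _; rewrite mxE.
pose F := G i * L j - G j * L i.
have hF : is_homog (m + 1) F.
  by apply: rpredB; apply: dhomogM (hG _) (lin_poly_homog _).
have FE z : Q z -> value H (rep z) != 0 -> value F (rep z) =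
    value H (rep z) * (a z 0 i * (rep z *m M) 0 j - a z 0 j * (rep z *m M) 0 i).
  move=> Qz Hz; have [_ ->] := aE z Qz Hz.
  by rewrite valueB !valueM !LE; move: (rep z *m M) => w; rewrite !mxE; field.
have /eqP : value F (rep y) = 0.
  apply: (section_dense hF hH Qy Hy) => // z Qz zp Hz.
  have [Wz _] := aE z Qz Hz; rewrite FE //.
  have /(proportionalP _ (rep_mulM_neq0 Qz)) /(_ i j) -> : in_line M z (a z).
    by apply: off => //; apply/off_sectionP.
  by rewrite subrr mulr0.
by rewrite FE // mulf_eq0 (negbTE Hy) subr_eq0 => /eqP.
Qed.

(* The form [\sum_j (w *m S) 0 j * (dx_j - x_j * dl / l)], of degree 1 in [rep y]. *)
Definition log_form y w : cotangent Q y :=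
  \sum_j ((w *m S) 0 j * value l (rep y)) *: differential Q y (affine_coord l j).

Lemma log_formE y w (v : tangent Q y) : log_form y w v = B w (tan_coord l v).
Proof.
rewrite cotangent_sumE [RHS]mxE; apply: eq_bigr => j _.
by rewrite cotangentZE differentialE -mulrA; congr (_ * _); rewrite !mxE.
Qed.

Lemma log_form_lin y a w w' : log_form y (a *: w + w') = a *: log_form y w + log_form y w'.
Proof.
by apply: cotangent_eq => v; rewrite cotangent_linE !log_formE bil_linl.
Qed.

Section OffSection.
Variables (y : Pn k r.+1) (Qy : Q y) (yp : B (rep y) p != 0).
Implicit Types (t : tangent Q y).

Let hl : is_homog 1 l := lin_poly_homog (S *m p^T).
Let ly : value l (rep y) != 0.
Proof. by rewrite bil_lin_poly. Qed.

Lemma tan_coord_orth t : B (rep y) (tan_coord l t) = 0.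
Proof.
have hf : germ_frac Q y (fun=> 0) 2 q (l * l).
  split=> [|||z /(quadricP qE)]; [exact: hq|exact: dhomogM hl hl|by rewrite valueM mulf_neq0|].
  by rewrite -qE => -> _; rewrite mul0r.
have := tangent_frac Qy hl ly t hf; rewrite tangent_cst // /qderiv dqE qE.
have /(quadricP qE) -> := Qy; rewrite mul0r subr0 => /esym/eqP.
rewrite mulf_eq0 invr_eq0 expf_eq0 !valueM !mulf_eq0 (negbTE ly) (negbTE (two_neq0 char0)) /=.
by rewrite !orbF => /eqP.
Qed.

Lemma tan_coord_pole t : B p (tan_coord l t) = 0.
Proof.
have [rf] := tangent_affine Qy hl ly t l; rewrite dir_deriv_lin_poly mulmxA => E.
rewrite bilC // bilZl -[X in _ * X]E -[RHS](mulr0 (value l (rep y))); congr (_ * _).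
rewrite -[RHS](tangent_cst Qy t 1); apply: tangent_germ => //; first exact: regular_at_cst.
exists (basic_open Q l); split; first exact: basic_nbhd hl Qy ly.
by move=> z [_ lz]; rewrite (value_scale _ _ hl) expr1 mulVf.
Qed.

Lemma log_form_eq0 w : log_form y w = 0 <-> exists a b, w = a *: p + b *: rep y.
Proof.
split=> [w0|[a [b ->]]]; last first.
  apply: cotangent_eq => t; rewrite log_formE cotangent0E bilDl !bilZl.
  by rewrite tan_coord_orth tan_coord_pole !mulr0 addr0.
suff [b E] : exists b, w - (B w (rep y) / B (rep y) p) *: p = b *: rep y.
  by exists (B w (rep y) / B (rep y) p), b; rewrite -E addrC subrK.
apply: (bil_orth_line unitS (rep_neq0 y)) => xi yxi.
have tv := quadric_tangent char0 symS unitS qE Qy yxi.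
have := congr1 (fun f : cotangent Q y => f (dvec Q y xi)) w0.
rewrite log_formE cotangent0E.
have -> : tan_coord l (dvec Q y xi) = xi - (B xi p / B (rep y) p) *: rep y.
  have qd j : qderiv y xi 'X_j l =
      (xi 0 j * B (rep y) p - rep y 0 j * B xi p) / B (rep y) p ^+ 2.
    by rewrite /qderiv dir_derivX dir_deriv_lin_poly mulmxA valueX bil_lin_poly.
  apply/rowP => j; rewrite mxE mxE (dvecE Qy tv (germ_affine_coord Q hl ly j)) qd.
  by rewrite bil_lin_poly !mxE; field.
by rewrite !bilE (bilC symS p xi) => <-; field.
Qed.

Lemma log_form_eq w w' : (exists a, w - w' = a *: p) -> log_form y w = log_form y w'.
Proof.
move=> [a E]; have -> : w = a *: p + w' by rewrite -E subrK.
rewrite log_form_lin (log_form_eq0 p).2 ?scaler0 ?add0r //.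
by exists 1, 0; rewrite scale0r addr0 scale1r.
Qed.

Definition gradient G H : 'rV[k]_r.+2 :=
  \row_j (value (qcoef G H j) (rep y) / value (H * H) (rep y)).

Lemma differential_log_form f d G H : germ_frac Q y f d G H ->
  differential Q y f = log_form y (gradient G H *m invmx S).
Proof.
move=> hf; apply: cotangent_eq => t; rewrite log_formE differentialE.
rewrite (tangent_frac Qy hl ly t hf) qderivE /bil mulmxKV // mxE.
by apply: eq_bigr => j _; rewrite [X in _ = X * _]mxE [X in _ = _ * X]mxE mulrC.
Qed.

Lemma dlog_section i : rep y 0 i != 0 ->
  let f := fun z => value l (rep z) / value 'X_i (rep z) in
  forall t, (f y)^-1 * differential Q y f t = - (rep y 0 i)^-1 * (tan_coord l t) 0 i.
Proof.
move=> yi f t; have Xy : value 'X_i (rep y) != 0 by rewrite valueX.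
have hf := germ_frac_ratio Q hl (homogX k i) Xy.
rewrite differentialE (tangent_frac Qy hl ly t hf) /qderiv /f.
rewrite dir_deriv_lin_poly dir_derivX mulmxA -[X in X * _ - _]/(B _ _).
rewrite bilC // tan_coord_pole valueX; move: ly => ly'; field.
by rewrite ly' yi.
Qed.

Lemma differential_coord i j : rep y 0 i != 0 -> forall t,
  rep y 0 i * differential Q y (affine_coord 'X_i j) t =
  (tan_coord l t) 0 j - rep y 0 j * (rep y 0 i)^-1 * (tan_coord l t) 0 i.
Proof.
move=> yi t; have Xy : value 'X_i (rep y) != 0 by rewrite valueX.
rewrite differentialE (tangent_frac Qy hl ly t (germ_affine_coord Q (homogX k i) Xy j)).
by rewrite /qderiv !dir_derivX !valueX; field.
Qed.

End OffSection.

Definition near_log x (s : forall y, cotangent Q y) := exists W a,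
  [/\ nbhd_in Q x W, vsect Q (-1) W a & forall y, W y -> ~ D y -> s y = log_form y (a y)].

Implicit Types s t : forall y, cotangent Q y.

Lemma near_log_ext x U s t : nbhd_in Q x U -> (forall y, U y -> ~ D y -> s y = t y) ->
  near_log x s -> near_log x t.
Proof.
move=> nU st [W [a [nW sa sE]]]; have nI := nbhd_inI nW nU; have [oI _] := nI.
exists (W `&` U), a; split=> //; first by apply: vsect_sub sa => // y [].
by move=> y [Wy Uy] Dy; rewrite -st // sE.
Qed.

Lemma near_log_add x s t : near_log x s -> near_log x t -> near_log x (fun y => s y + t y).
Proof.
move=> [W [a [nW sa sE]]] [W' [b [nW' sb tE]]]; have nI := nbhd_inI nW nW'.
have [oI _] := nI; exists (W `&` W'), (fun y => a y + b y); split=> //.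
  apply: vsectD; [exact: oI.1|by apply: vsect_sub sa => // y []|].
  by apply: vsect_sub sb => // y [].
move=> y [Wy Wy'] Dy; rewrite sE // tE //.
by have := log_form_lin y 1 (a y) (b y); rewrite !scale1r => ->.
Qed.

Lemma log_formZ y a w : log_form y (a *: w) = a *: log_form y w.
Proof.
by apply: cotangent_eq => v; rewrite cotangentZE !log_formE bilZl.
Qed.

Lemma near_log_scale x U f s : nbhd_in Q x U -> regular Q U f -> near_log x s ->
  near_log x (fun y => f y *: s y).
Proof.
move=> nU rf [W [a [nW sa sE]]]; have nI := nbhd_inI nW nU; have [oI _] := nI.
exists (W `&` U), (fun y => f y *: a y); split=> //.
  apply: (vsectZ (d := 0) (e := -1)) => //; first exact: oI.1.
    by apply: sectO_sub rf => // y [].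
  by apply: vsect_sub sa => // y [].
by move=> y [Wy Uy] Dy; rewrite sE // log_formZ.
Qed.

Lemma near_log_sum x (I : Type) (e : seq I) (s : I -> forall y, cotangent Q y) : Q x ->
  (forall i, near_log x (s i)) -> near_log x (fun y => \sum_(i <- e) s i y).
Proof.
move=> Qx ss; have nX : nbhd_in Q x Q by split=> //; exact: open_in_setT.
elim: e => [|i e IH].
  exists Q, (fun=> 0); split=> // [j|y _ _].
    by apply: sectO_ext (sectO0 (-1) nX.1) => y _; rewrite mxE.
  rewrite big_nil; apply: cotangent_eq => v.
  by rewrite cotangent0E log_formE bil0l.
apply: near_log_ext nX _ (near_log_add (ss i) IH) => y _ _.
by rewrite big_cons.
Qed.

Lemma near_log_differential x U f : nbhd_in Q x U -> regular Q U f ->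
  near_log x (fun y => differential Q y f).
Proof.
move=> nU rf; have [W [d [G [H [nW WU [hG hH] fE]]]]] := regular_local rf nU.
have [oW _] := nW; exists W, (fun y => gradient y G H *m invmx S); split=> //.
  apply: vsect_mulmx => // j; apply: sectO_ext (sectO_qcoef j oW hG hH _).
    by move=> y _; rewrite mxE.
  by move=> y /fE [].
move=> y Wy Dy; have Qy := oW.1 y Wy.
by rewrite (differential_log_form Qy _ (fE y Wy)) //; apply/off_sectionP.
Qed.

Lemma section_quotient x U f i : nbhd_in Q x U -> regular Q U f ->
  (forall y, U y -> D y -> f y = 0) -> rep x 0 i != 0 ->
  exists W h, [/\ nbhd_in Q x W, W `<=` U, regular Q W h &
    forall y, W y -> rep y 0 i != 0 /\
      f y = h y * (value l (rep y) / value 'X_i (rep y))].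
Proof.
move=> nU rf fD xi; have Qx := nU.1.1 x nU.2.
have [W [d [G [H [nW WU [hG hH] fE]]]]] := regular_local rf nU.
have [a [F [hF Fx FW]]] := nW.1.2 x nW.2.
have hGF : is_homog (d + a).+1 (G * F) by rewrite -addSn; exact: dhomogM.
have van y : Q y -> B (rep y) p = 0 -> value (G * F) (rep y) = 0.
  move=> Qy yp; rewrite valueM; have [->|Fy] := eqVneq (value F (rep y)) 0.
    by rewrite mulr0.
  have Wy := FW y Qy Fy; have [_ _ Hy /(_ y Qy Hy)] := fE y Wy.
  rewrite fD; [|exact: WU|by apply/sectionP] => /esym/eqP.
  by rewrite mulf_eq0 invr_eq0 (negbTE Hy) orbF => /eqP ->; rewrite mul0r.
have [C hC CE] := section_ideal char0 r2 symS unitS qE pp hGF van.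
have hden : is_homog (d.+1 + a) (H * F) by exact: dhomogM.
have hK : is_homog (d.+1 + a + 1) (H * F * 'X_i) by exact: dhomogM hden (homogX k i).
have Hx : value H (rep x) != 0 by have [] := fE x nW.2.
have Kx : value (H * F * 'X_i) (rep x) != 0 by rewrite !valueM valueX !mulf_neq0.
have nV := basic_nbhd hK Qx Kx; have [oV _] := nV.
have nz y : basic_open Q (H * F * 'X_i) y ->
    [/\ Q y, W y, rep y 0 i != 0, value H (rep y) != 0 & value F (rep y) != 0].
  move=> [Qy]; rewrite !valueM valueX !mulf_eq0 !negb_or -andbA => /and3P [Hy Fy yi].
  by split=> //; exact: FW.
have hnum : is_homog (d.+1 + a) (C * 'X_i).
  by have := dhomogM hC (homogX k i); rewrite addn1 addSn.
exists (basic_open Q (H * F * 'X_i)), (fun y => value (C * 'X_i) (rep y) / value (H * F) (rep y)).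
split=> //.
- by move=> y /nz [_ Wy _ _ _]; exact: WU.
- apply: sectO_ratio oV hnum hden _ _; first by rewrite addr0.
  by move=> y /nz [_ _ _ Hy Fy]; rewrite valueM mulf_neq0.
- move=> y /nz [Qy Wy yi Hy Fy]; split=> //.
  have [_ _ _ -> //] := fE y Wy; have := CE y Qy.
  rewrite !valueM valueX bil_lin_poly => E.
  have -> : value G (rep y) = B (rep y) p * value C (rep y) / value F (rep y).
    by rewrite -E mulfK.
  by field; rewrite yi Hy Fy.
Qed.

Lemma local_equation_section U i : open_in Q U -> (forall y, U y -> rep y 0 i != 0) ->
  local_equation Q D U (fun y => value l (rep y) / value 'X_i (rep y)).
Proof.
move=> oU nz; split.
- apply: sectO_ratio oU (lin_poly_homog _) (homogX k i) _ _ => // y Uy.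
  by rewrite valueX nz.
- by move=> y _ /sectionP [_ yp]; rewrite bil_lin_poly yp mul0r.
- move=> x' V g nV VU rg gD; have xi := nz x' (VU x' nV.2).
  have [W [h [nW WV rh hE]]] := section_quotient nV rg gD xi.
  by exists W, h; split=> // y /hE [].
Qed.

Lemma near_log_dlog x U c f : nbhd_in Q x U -> regular Q U c -> local_equation Q D U f ->
  near_log x (fun y => (c y / f y) *: differential Q y f).
Proof.
move=> nU rc [rf fD fgen]; have Qx := nU.1.1 x nU.2; have [i xi] := rep_coord x.
have xi' : value 'X_i (rep x) != 0 by rewrite valueX.
pose g y := value l (rep y) / value 'X_i (rep y).
have nV := nbhd_inI nU (basic_nbhd (homogX k i) Qx xi').
set V := U `&` _ in nV; have [oV Vx] := nV.
have [rg gD _] : local_equation Q D V g.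
  by apply: local_equation_section => // y [_ [_]]; rewrite valueX.
have [W1 [h [nW1 W1V rh hE]]] := fgen x V g nV (fun y => @proj1 _ _) rg gD.
have [W2 [h' [nW2 W2U rh' h'E]]] := section_quotient nU rf fD xi.
have nW := nbhd_inI nW1 nW2; set W := W1 `&` W2 in nW; have [oW Wx] := nW.
have rhW : regular Q W h by apply: sectO_sub rh => // y [].
have rh'W : regular Q W h' by apply: sectO_sub rh' => // y [].
have rcW : regular Q W c by apply: sectO_sub rc => // y [_ /W2U].
have rgW : regular Q W g by apply: sectO_sub rg => // y [/W1V].
have WX : W `<=` Q := oW.1.
pose b y : 'rV[k]_r.+2 := (- (rep y 0 i)^-1) *: (delta_mx 0 i *m invmx S).
have log_g : near_log x (fun y => (c y) *: log_form y (b y)).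
  apply: near_log_scale nW rcW _; exists W, b; split=> //.
  apply: (vsectZ (d := -1) (e := 0)) => //; last exact: vsect_cst.
  apply: sectO_ext (sectOZ (-1) oW (sectO_inv oW (homogX k i) _)) => y Wy.
    by rewrite valueX mulN1r.
  by case: Wy => _ /h'E []; rewrite valueX.
have := near_log_scale nW (sectOM WX rcW rhW) (near_log_differential nW rh'W).
move/(near_log_add log_g); apply: near_log_ext nW _ => y Wy Dy.
have Qy := WX y Wy; have yp : B (rep y) p != 0 by apply/off_sectionP.
have [yi fE] := h'E y Wy.2; have gE := hE y Wy.1.
have gn0 : g y != 0 by rewrite /g bil_lin_poly valueX mulf_neq0 ?invr_eq0.
have hh' : h y * h' y = 1.
  apply: (mulIf gn0); rewrite mul1r -mulrA -[X in h y * X]fE; exact: esym.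
have [h0 h'0] : h y != 0 /\ h' y != 0.
  by apply/andP; rewrite -negb_or -mulf_eq0 hh' oner_eq0.
apply: cotangent_eq => t.
rewrite cotangentDE !cotangentZE log_formE !differentialE.
have -> : t f = h' y * t g + g y * t h'.
  have reg (e : Pn k r.+1 -> k) : regular Q W e -> regular_at Q y e.
    by move=> re; apply: regular_regular_at re _.
  rewrite -tangentM //; try exact: reg; apply: tangent_germ => //.
  - by apply: reg; apply: sectO_sub rf => // z [_ /W2U].
  - by apply: reg; apply: (sectOM WX rh'W rgW).
  - by exists W; split=> // z [_ /h'E []].
have := dlog_section Qy yp yi t; rewrite -/g differentialE => dg.
have {dg} -> : t g = - g y * (rep y 0 i)^-1 * (tan_coord l t) 0 i.
  by rewrite !mulNr -mulrA -mulrN -mulNr -dg mulVKf.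
have -> : B (b y) (tan_coord l t) = - (rep y 0 i)^-1 * (tan_coord l t) 0 i.
  rewrite bilZl; congr (_ * _).
  by rewrite /bil mulmxKV // -rowE !mxE.
have -> : f y = h' y * g y by [].
have -> : h y = (h' y)^-1 by rewrite -[h y](mulfK h'0) hh' mul1r.
by field; rewrite h'0 gn0 yi.
Qed.

Lemma Omega_log_presented :
  presented Q M (E := Omega_log Q D) (fun y (u : 'rV[k]_r.+1) => log_form y (u *m M')).
Proof.
split=> /=.
- by move=> y a u v Qy; rewrite mulmxDl -scalemxAl log_form_lin.
- move=> y u Qy /(off_sectionP Qy) yp; rewrite (log_form_eq0 Qy yp).
  split=> [[a [b uE]]|[c uE]].
    exists b; rewrite -[LHS]mulmx1 -M'K mulmxA uE mulmxDl -!scalemxAl.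
    by rewrite (kerM p).2 ?scaler0 ?add0r //; exists 1; rewrite scale1r.
  have [a aE] : exists a, u *m M' - c *: rep y = a *: p.
    by apply/kerM; rewrite mulmxBl -mulmxA M'K mulmx1 uE -scalemxAl subrr.
  by exists a, c; rewrite -aE subrK.
- move=> U s oU; split=> ss x Ux.
    have Qx := oU.1 x Ux; have [W [al [c [f [nW WU sal [rc lf] sE]]]]] := ss x Ux.
    have [W1 [m [a [b [nW1 W1W rab alE]]]]] := sal x nW.2.
    have nal : near_log x al.
      apply: (near_log_ext nW1 (fun y Wy _ => esym (alE y Wy))).
      apply: near_log_sum => // i; have [ra rb] := rab i.
      exact: near_log_scale nW1 ra (near_log_differential nW1 rb).
    have := near_log_add nal (near_log_dlog nW rc lf).
    move/(near_log_ext nW (fun y Wy Dy => esym (sE y Wy Dy))) => [V [d [nV sd dE]]].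
    have nI := nbhd_inI nV nW; have [oI _] := nI.
    exists (V `&` W), (fun y => d y *m M); split=> //; first by move=> y [_ /WU].
    split; first by apply: vsect_mulmx => //; apply: vsect_sub sd => // y [].
    move=> y [Vy Wy] Dy; rewrite dE //; have Qy := nW.1.1 y Wy.
    apply: log_form_eq => //; first by apply/off_sectionP.
    by apply/kerM; rewrite mulmxBl -!mulmxA M'K mulmx1 subrr.
  have Qx := oU.1 x Ux; have [W [a [nW WU [sa sE]]]] := ss x Ux.
  have [i xi] := rep_coord x; have xi' : value 'X_i (rep x) != 0 by rewrite valueX.
  have nV := nbhd_inI nW (basic_nbhd (homogX k i) Qx xi').
  set V := W `&` _ in nV; have [oV Vx] := nV; have VX : V `<=` Q := oV.1.
  have nz y : V y -> rep y 0 i != 0 by move=> [_ [_]]; rewrite valueX.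
  pose w y : 'rV[k]_r.+2 := a y *m M' *m S.
  have sw : vsect Q (-1) V w.
    by apply/vsect_mulmx/vsect_mulmx => //; apply: vsect_sub sa => // y [].
  pose f y := value l (rep y) / value 'X_i (rep y).
  exists V, (fun y => \sum_j (w y 0 j * rep y 0 i) *: differential Q y (affine_coord 'X_i j)),
    (fun y => - \sum_j w y 0 j * rep y 0 j), f.
  split=> //.
  + by move=> y [/WU].
  + move=> y Vy; exists V, r.+2, (fun j y => w y 0 j * rep y 0 i), (affine_coord 'X_i).
    split=> // j; split.
      by apply: (sectOM' (d := -1) (e := 1)) => //; exact: sectO_coord.
    apply: sectO_ext (sectO_ratio oV (homogX k j) (homogX k i) _ _) => // z Vz.
      by rewrite valueX.
    by rewrite valueX nz.
  + split; last exact: local_equation_section oV nz.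
    apply: sectO_ext (sectOZ (-1) oV (sectO_sum (f := fun j y => w y 0 j * rep y 0 j) _ oV _)).
      by move=> y _; rewrite mulN1r.
    by move=> j _; apply: (sectOM' (d := -1) (e := 1)) => //; exact: sectO_coord.
  + move=> y Vy Dy; have Qy := VX y Vy; have yi := nz y Vy.
    have yp : B (rep y) p != 0 by apply/off_sectionP.
    rewrite sE; [|by case: Vy|by []].
    rewrite -[LHS]/(log_form y (a y *m M')).
    apply: cotangent_eq => t; rewrite log_formE cotangentDE cotangent_sumE cotangentZE.
    rewrite -mulrA (dlog_section Qy yp yi).
    under [X in _ = X + _]eq_bigr => j _ do
      rewrite cotangentZE -mulrA (differential_coord Qy yp _ yi) mulrBr.
    rewrite sumrB !mulNr mulrN opprK mulr_suml.
    rewrite [X in _ = _ - _ + X](_ : _ = \sum_j w y 0 j *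
        (rep y 0 j / rep y 0 i * tan_coord l t 0 i)); last first.
      by apply: eq_bigr => j _; rewrite !mulrA.
    rewrite subrK [LHS]mxE; apply: eq_bigr => j _.
    by congr (_ * _); rewrite mxE.
- exact: in_line_dense.
- exact: rep_mulM_neq0.
Qed.

End LogForms.

(** * Rational functions vanishing at infinity *)

Section Decay.
Variables (k : closedFieldType) (char0 : [pchar k] =i pred0).
Implicit Types P N D E : {poly k}.

Definition rev_poly m P : {poly k} := \poly_(i < m.+1) P`_(m - i).

Lemma horner_rev_poly m P t : (size P <= m.+1)%N -> t != 0 ->
  (rev_poly m P).[t] = t ^+ m * P.[t^-1].
Proof.
move=> sP t0; rewrite horner_poly (horner_coef_wide _ sP) mulr_sumr.
rewrite (reindex_inj rev_ord_inj); apply: eq_bigr => i _ /=.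
have im : (i <= m)%N by rewrite -ltnS.
rewrite subSS subKn // mulrCA; congr (_ * _).
by rewrite exprVn -expfB_cond ?(negbTE t0) //; case: eqP t0.
Qed.

Lemma size_rev_poly m P : P`_0 != 0 -> size (rev_poly m P) = m.+1.
Proof. by move=> P0; rewrite size_poly_eq // subnn. Qed.

(* The fraction [N0 / D0] is locally regular on the affine line; at infinity it
   is [t^-1 * (Ni / Di) t^-1]. *)
Lemma rational_decay N0 D0 Ni Di E : D0 != 0 -> E != 0 -> Di.[0] != 0 ->
  (forall t0, exists N D, D.[t0] != 0 /\ N * D0 = N0 * D) ->
  (forall t, t != 0 -> E.[t] != 0 -> Di.[t^-1] != 0 ->
     t * N0.[t] * Di.[t^-1] = Ni.[t^-1] * D0.[t]) ->
  N0 = 0.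
Proof.
move=> D00 E0 Di0 reg inf.
have D0N0 : D0 %| N0.
  have gn0 : gcdp N0 D0 != 0 by rewrite gcdp_eq0 (negbTE D00) andbF.
  pose n := N0 %/ gcdp N0 D0; pose d := D0 %/ gcdp N0 D0.
  have nE : N0 = n * gcdp N0 D0 by rewrite divpK // dvdp_gcdl.
  have dE : D0 = d * gcdp N0 D0 by rewrite divpK // dvdp_gcdr.
  have cop : coprimep d n by rewrite coprimep_sym coprimep_div_gcd // D00 orbT.
  have d_noroot t : ~~ root d t.
    have [N [D [Dt ND]]] := reg t.
    have : N * d = n * D.
      apply: (mulIf gn0); rewrite -[LHS]mulrA -dE ND [in LHS]nE; exact: mulrAC.
    move=> Nd; have : d %| D by rewrite -(Gauss_dvdpr _ cop) -Nd dvdp_mull.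
    by move=> /dvdpP [e De]; apply: contraNN Dt => /rootP dt; rewrite De hornerM dt mulr0.
  have : size d == 1%N.
    by apply: contraT => /closed_rootP [t]; rewrite (negbTE (d_noroot t)).
  rewrite size_poly_eq1 => d1; rewrite dE (eqp_dvdl _ (eqp_mulr _ d1)) mul1r.
  exact: dvdp_gcdl.
have [h N0E] := dvdpP _ _ D0N0; have [h0|hn0] := eqVneq h 0.
  by rewrite N0E h0 mul0r.
pose m := maxn (size Di) (size Ni).
have sDi : (size Di <= m.+1)%N by rewrite leqW // leq_maxl.
have sNi : (size Ni <= m.+1)%N by rewrite leqW // leq_maxr.
have Di0' : Di`_0 != 0 by rewrite -horner_coef0.
have rD0 : rev_poly m Di != 0 by rewrite -size_poly_eq0 size_rev_poly.
have eqR : 'X * h * rev_poly m Di = rev_poly m Ni.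
  have : ('X * h * rev_poly m Di - rev_poly m Ni) * ('X * E * D0 * rev_poly m Di) = 0.
    apply: (poly_fun_eq0 char0) => t; rewrite !(hornerM, hornerD, hornerN, hornerX).
    have [->|t0] := eqVneq t 0; first by rewrite !(mul0r, mulr0).
    have [->|Et] := eqVneq E.[t] 0; first by rewrite !(mul0r, mulr0).
    have [->|D0t] := eqVneq D0.[t] 0; first by rewrite !(mul0r, mulr0).
    rewrite !horner_rev_poly //; have [->|Dit] := eqVneq Di.[t^-1] 0.
      by rewrite !(mul0r, mulr0).
    have := inf t t0 Et Dit; rewrite N0E hornerM => E1.
    have -> : Ni.[t^-1] = t * h.[t] * Di.[t^-1].
      by apply: (mulIf D0t); rewrite -E1; ring.
    by ring.
  move/eqP; rewrite mulf_eq0 subr_eq0 => /orP [/eqP //|].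
  by rewrite !mulf_eq0 polyX_eq0 (negbTE E0) (negbTE D00) (negbTE rD0).
have := congr1 (fun P : {poly k} => size P) eqR.
rewrite size_mul ?mulf_neq0 ?polyX_eq0 // (size_rev_poly m Di0').
rewrite mulrC size_mulX // addSn /= => e.
have := size_poly m.+1 (fun i => Ni`_(m - i)); rewrite -[\poly_(i < _) _]/(rev_poly m Ni) -e.
by rewrite addnS ltnS -[X in (_ <= X)%N]add0n leq_add2r leqn0 size_poly_eq0 (negbTE hn0).
Qed.

End Decay.

(** * Conics on the quadric *)

Section Conic.
Variables (k : closedFieldType) (char0 : [pchar k] =i pred0).
Variables (r : nat) (r2 : (2 <= r)%N) (S : 'M[k]_r.+2).
Hypotheses (symS : S^T = S) (unitS : S \in unitmx).
Local Notation B := (bil S).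
Implicit Types p u v w y z : 'rV[k]_r.+2.

Lemma conic_choice p p' y : B p p != 0 -> B y y = 0 -> B y p = 0 -> B y p' != 0 ->
  exists z p0 c, [/\ c != 0 /\ p = c *: p0, B z z = 0 /\ B y z = 1,
    B z p0 = 0 /\ B y p0 = 0, B p0 p0 = - 2%:R &
    forall a b d, p' <> a *: y + b *: p0 + d *: z].
Proof.
move=> pp yy yp yp'; have two := two_neq0 char0.
have nt : - 2%:R != 0 :> k by rewrite oppr_eq0.
have [e e0 p0p0] := anisotropic_scale pp nt.
set p0 := e *: p in p0p0; have yp0 : B y p0 = 0 by rewrite bilZr yp mulr0.
have pE : p = e^-1 *: p0 by rewrite scalerA mulVf // scale1r.
have e'0 : e^-1 != 0 by rewrite invr_eq0.
have y0 : y != 0 by apply: contraNneq yp' => ->; rewrite bil0l.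
clearbody p0; have p0y : B p0 y = 0 by rewrite bilC.
have [z1 z1z1 yz1] := isotropic_partner symS unitS two y0 yy.
have [z [zz yz zp]] : exists z, [/\ B z z = 0, B y z = 1 & B z p0 = 0].
  have [z2 [yz2 z2p]] : exists z2, B y z2 = 1 /\ B z2 p0 = 0.
    exists (z1 - (B z1 p0 / B p0 p0) *: p0); rewrite !bilE yz1 yp0; split.
      by rewrite mulr0 subr0.
    by rewrite p0p0; field; rewrite oppr_eq0.
  exists (z2 - (B z2 z2 / 2%:R) *: y); rewrite !bilE yy yz2 z2p yp0 (bilC symS z2 y) yz2.
  by split; field.
have zy : B z y = 1 by rewrite bilC.
have pz : B p0 z = 0 by rewrite bilC.
case: (pselect (exists a b d, p' = a *: y + b *: p0 + d *: z)); last first.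
  move=> nin; exists z, p0, e^-1; split=> // a b d E.
  by apply: nin; exists a, b, d.
move=> [a [b [d p'E]]].
pose f (i : 'I_3) := if i == 0%N :> nat then p0 else if i == 1%N :> nat then y + z else y - z.
have [||i j|w wf ww] := orth_anisotropic symS unitS two (a := f).
- exact: r2.
- case=> [[|[|[|//]]] ?]; rewrite /f /=.
  + by rewrite p0p0 oppr_eq0.
  + by rewrite !bilE yy zz yz zy add0r addr0.
  + by rewrite !bilE yy zz yz zy add0r oppr0 subr0 -opprD oppr_eq0.
- by case: i j => [[|[|[|//]]] ?] [[|[|[|//]]] ?] //= _; rewrite /f /= !bilE
    ?p0p0 ?yy ?zz ?yz ?zy ?yp0 ?p0y ?zp ?pz; ring.
have wp : B w p0 = 0 by have := wf (inord 0); rewrite /f inordK.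
have [wy wz] : B w y = 0 /\ B w z = 0.
  have := wf (inord 1); have := wf (inord 2); rewrite /f !inordK //= !bilE => e2 e1.
  split; apply: (mulfI two); rewrite mulr0.
    by rewrite -[RHS](addr0 0) -{1}e1 -e2; ring.
  by rewrite -[RHS](subr0 0) -{1}e1 -e2; ring.
have yw : B y w = 0 by rewrite bilC.
have zw : B z w = 0 by rewrite bilC.
have pw : B p0 w = 0 by rewrite bilC.
exists (z + w - (B w w / 2%:R) *: y), p0, e^-1; split=> //.
- by rewrite !bilE yy zz zy yz wy yw wz zw; split; field.
- by rewrite !bilE zp wp yp0; split=> //; ring.
move=> a' b' d' E.
have := congr1 (B w) p'E; rewrite [in LHS]E !bilE wy wp wz => d0.
have {}d0 : d' = 0.
  have : d' * B w w = 0 by move: d0; rewrite !(mulr0, add0r, addr0, oppr0).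
  by move/eqP; rewrite mulf_eq0 (negbTE ww) orbF => /eqP.
by case/eqP: yp'; rewrite E d0 !bilE yy yp0; ring.
Qed.

Lemma pole_unique p p' : B p p != 0 -> (forall y, B y y = 0 -> B y p = 0 -> B y p' = 0) ->
  exists c, p' = c *: p.
Proof.
move=> pp h; have p0 : p != 0 by apply: contraNneq pp => ->; rewrite bil0l.
apply: (bil_orth_line unitS p0) => u pu; rewrite bilC //.
have up : B u p = 0 by rewrite bilC.
have [uu|uu] := eqVneq (B u u) 0; first exact: h.
have r1 : (2 <= r.+1)%N := ltnW r2.
have [e [ep eu] ee] := orth_anisotropic2 char0 r1 symS unitS pp pu uu.
have nuu : - B u u != 0 by rewrite oppr_eq0.
have [c c0 cE] := anisotropic_scale ee nuu.
have ue : B u e = 0 by rewrite bilC.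
have hs s : s * s = 1 -> B (u + (s * c) *: e) p' = 0.
  move=> ss; apply: h; last by rewrite !bilE up ep mulr0 addr0.
  have E : B (u + (s * c) *: e) (u + (s * c) *: e) = B u u + s * s * B (c *: e) (c *: e).
    by rewrite !bilE eu ue; ring.
  by rewrite E ss cE mul1r subrr.
have := hs 1 (mulr1 1); have := hs (-1) (etrans (mulrNN 1 1) (mulr1 1)).
rewrite !bilE => e1 e2; apply: (mulfI (two_neq0 char0)); rewrite mulr0.
by rewrite -[RHS](addr0 0) -{1}e1 -e2; ring.
Qed.

End Conic.

Section ConicRestriction.
Variables (k : closedFieldType) (char0 : [pchar k] =i pred0) (r : nat).
Variables (X : set (Pn k r.+1)) (M : 'M[k]_(r.+2, r.+1)) (F : modsheaf k r.+1).
Variable e : forall x, 'rV[k]_r.+1 -> ms_fib F x.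
Hypothesis pF : presented X M e.
Implicit Types (U : set (Pn k r.+1)) (x : Pn k r.+1) (v w : 'rV[k]_r.+2).

Definition frac_vec (G : 'I_r.+1 -> {mpoly k[r.+2]}) H v : 'rV[k]_r.+1 :=
  (value H v)^-1 *: \row_i value (G i) v.

Lemma section_at_vec U s x c v : open_in X U -> ms_sec F U s -> U x -> c != 0 ->
  rep x = c *: v -> exists m G H,
  [/\ (forall i, is_homog m (G i)) /\ is_homog m.+1 H, value H v != 0 &
      forall x c w, X x -> c != 0 -> rep x = c *: w -> value H w != 0 -> ms_dom F x ->
        s x = e x (c^-1 *: frac_vec G H w)].
Proof.
move=> oU /(pres_sec pF _ oU) ss Ux c0 xE.
have [W [a [[oW Wx] WU [sa sE]]]] := ss x Ux.
have [m [b [G [H [[hG hH] mb Hx aE]]]]] := vsect_frac sa Wx.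
have bm : b = m.+1 by apply/eqP; rewrite -eqz_nat -addn1 PoszD mb subrK.
rewrite bm in hH; exists m, G, H; split=> //.
  by rewrite -(value_rep_eq0 hH c0 xE).
move=> x' c' w Xx' c'0 x'E Hw dx'.
have Hx' : value H (rep x') != 0 by rewrite (value_rep_eq0 hH c'0 x'E).
have [Wx' ax'] := aE x' Xx' Hx'; rewrite sE // ax' x'E; congr (e x' _).
apply/rowP => i; rewrite !mxE (value_scale _ _ (hG i)) (value_scale _ _ hH).
by rewrite exprS; field; rewrite Hw c'0 expf_neq0.
Qed.

Definition pairing (g : 'I_r.+2 -> {poly k}) (G : 'I_r.+1 -> {mpoly k[r.+2]})
    (a a' : 'cV[k]_r.+1) :=
  \sum_i along g (G i) * (a i 0 *: 'X - (a' i 0)%:P).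

Lemma horner_pairing g G H a a' t v : \row_j (g j).[t] = v -> value H v != 0 ->
  (pairing g G a a').[t] = value H v * (frac_vec G H v *m (t *: a - a')) 0 0.
Proof.
move=> gv Hv; rewrite horner_sum -scalemxAl mxE mulVKf // mxE.
apply: eq_bigr => i _; rewrite hornerM horner_along gv !mxE.
by rewrite hornerD hornerN hornerZ hornerX hornerC; ring.
Qed.

Variables (y p z : 'rV[k]_r.+2).
Local Notation g := (qcurve y p z).
Local Notation gi := (qcurve z p y).
Let gE t : \row_i (g i).[t] = y + t *: p + t ^+ 2 *: z := qcurveE y p z t.
Let giE t : \row_i (gi i).[t] = z + t *: p + t ^+ 2 *: y := qcurveE z p y t.

Variables (Uz Uy : set (Pn k r.+1)) (sz sy : forall x, ms_fib F x).
Hypotheses (oUz : open_in X Uz) (oUy : open_in X Uy).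
Hypotheses (secz : ms_sec F Uz sz) (secy : ms_sec F Uy sy).
Hypothesis on_conic : forall t, exists x c, [/\ Uz x, c != 0 & rep x = c *: \row_i (g i).[t]].
Hypothesis at_infinity : exists x c, [/\ Uy x, c != 0 & rep x = c *: z].
Variable L : {mpoly k[r.+2]}.
Hypothesis L0 : value L y != 0.
Hypothesis domF : forall x c v, X x -> c != 0 -> rep x = c *: v -> value L v != 0 -> ms_dom F x.
Hypothesis glue : forall x c t, X x -> c != 0 -> t != 0 -> rep x = c *: \row_i (g i).[t] ->
  ms_dom F x -> sz x = sy x.

Lemma along0 : along g L != 0.
Proof.
apply: contraNneq L0 => aL; have := horner_along g L 0.
by rewrite aL horner0 gE expr0n !scale0r !addr0 => <-.
Qed.

(* The pairing of [sz] with the linear forms [t *: a - a'], which vanish on the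
   tautological line, is a function on the conic that vanishes at infinity. *)
Lemma pairing_eq0 m G H a a' t0 :
  (forall i, is_homog m (G i)) -> is_homog m.+1 H ->
  value H (\row_i (g i).[t0]) != 0 ->
  (forall x c w, X x -> c != 0 -> rep x = c *: w -> value H w != 0 -> ms_dom F x ->
        sz x = e x (c^-1 *: frac_vec G H w)) ->
  (forall t, (\row_i (g i).[t] *m M *m (t *: a - a')) 0 0 = 0) ->
  pairing g G a a' = 0.
Proof.
move=> hG hH Hv0 GE ann.
have H0 : along g H != 0.
  by apply: contraNneq Hv0 => aH; rewrite -horner_along aH horner0.
have [xi [ci [Uxi ci0 xiE]]] := at_infinity.
have [mi [Gi [Hi [[hGi hHi] Hiz GiE]]]] := section_at_vec oUy secy Uxi ci0 xiE.
have conic_pt t : exists x c, [/\ X x, c != 0 & rep x = c *: \row_i (g i).[t]].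
  by have [x [c [Ux c0 xE]]] := on_conic t; exists x, c; split=> //; exact: oUz.1.
have eqline x c t u u' : X x -> c != 0 -> rep x = c *: \row_i (g i).[t] -> ms_dom F x ->
    e x (c^-1 *: u) = e x (c^-1 *: u') -> (u *m (t *: a - a')) 0 0 = (u' *m (t *: a - a')) 0 0.
  move=> Xx c0 xE dx /(pres_eq pF _ _ Xx dx) [d].
  rewrite -scalerBr xE => /(congr1 (fun h : 'rV[k]_r.+1 => c *: h)).
  rewrite scalerA divff // scale1r => uE.
  apply/eqP; rewrite -subr_eq0; apply/eqP.
  rewrite -[LHS](_ : ((u - u') *m (t *: a - a')) 0 0 = _); last by rewrite mulmxBl !mxE.
  by rewrite uE -!scalemxAl !scalerA mxE ann mulr0.
apply: (rational_decay char0 (D0 := along g H) (E := along g L * along g H)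
    (Ni := - pairing gi Gi a' a) (Di := along gi Hi)) => //.
- by rewrite mulf_neq0 ?along0.
- by rewrite horner_along giE expr0n !scale0r !addr0.
- move=> t1; have [x1 [c1 [Ux1 c10 x1E]]] := on_conic t1.
  have [m1 [G1 [H1 [[hG1 hH1] H1v G1E]]]] := section_at_vec oUz secz Ux1 c10 x1E.
  exists (pairing g G1 a a'), (along g H1); rewrite horner_along; split=> //.
  have H10 : along g H1 != 0.
    by apply: contraNneq H1v => aH; rewrite -horner_along aH horner0.
  have : (pairing g G1 a a' * along g H - pairing g G a a' * along g H1) *
      (along g L * along g H * along g H1) = 0.
    apply: (poly_fun_eq0 char0) => t; rewrite !(hornerM, hornerD, hornerN) !horner_along.
    set v := \row_i (g i).[t].
    have [->|Lv] := eqVneq (value L v) 0; first by rewrite !(mul0r, mulr0).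
    have [->|Hv] := eqVneq (value H v) 0; first by rewrite !(mul0r, mulr0).
    have [->|H1v'] := eqVneq (value H1 v) 0; first by rewrite !(mul0r, mulr0).
    have [x [c [Xx c0 xE]]] := conic_pt t.
    have dx := domF Xx c0 xE Lv.
    have E := GE x c v Xx c0 xE Hv dx; rewrite (G1E x c v Xx c0 xE H1v' dx) in E.
    rewrite (horner_pairing G a a' (erefl v) Hv) (horner_pairing G1 a a' (erefl v) H1v').
    by rewrite (eqline _ _ _ _ _ Xx c0 xE dx E); ring.
  move/eqP; rewrite mulf_eq0 !(mulf_eq0 _ (along g H1)) mulf_eq0.
  rewrite (negbTE along0) (negbTE H0) (negbTE H10) /= orbF subr_eq0 => /eqP //.
- move=> t t0'; rewrite hornerM mulf_eq0 negb_or !horner_along => /andP [Lv Hv] Hiv.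
  have [x [c [Xx c0 xE]]] := conic_pt t; have dx := domF Xx c0 xE Lv.
  have viE : \row_i (g i).[t] = t ^+ 2 *: \row_i (gi i).[t^-1].
    by rewrite gE giE; apply/rowP => i; rewrite !mxE; field.
  have ct0 : c * t ^+ 2 != 0 by rewrite mulf_neq0 ?expf_neq0.
  have xiE' : rep x = (c * t ^+ 2) *: \row_i (gi i).[t^-1] by rewrite xE viE scalerA.
  have E := GE x c _ Xx c0 xE Hv dx.
  rewrite (glue Xx c0 t0' xE dx) (GiE x _ _ Xx ct0 xiE' Hiv dx) in E.
  move: E; rewrite invfM -scalerA => /(eqline _ _ _ _ _ Xx c0 xE dx).
  rewrite hornerN (horner_pairing G a a' (erefl _) Hv) (horner_pairing Gi a' a (erefl _) Hiv).
  move=> <-; set vi := \row_i (gi i).[t^-1]; rewrite -scalemxAl.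
  have -> : t^-1 *: a' - a = - t^-1 *: (t *: a - a').
    by apply/colP => i; rewrite !mxE; field.
  rewrite -scalemxAr; move: (frac_vec Gi Hi vi *m _) => P.
  by rewrite !mxE; field.
Qed.

End ConicRestriction.

Lemma dual_columns (k : fieldType) n (a b c : 'rV[k]_n) :
  (forall s t u, s *: a + t *: b + u *: c = 0 -> [/\ s = 0, t = 0 & u = 0]) ->
  exists da db dc : 'cV[k]_n,
  [/\ [/\ (a *m da) 0 0 = 1, (a *m db) 0 0 = 0 & (a *m dc) 0 0 = 0],
      [/\ (b *m da) 0 0 = 0, (b *m db) 0 0 = 1 & (b *m dc) 0 0 = 0] &
      [/\ (c *m da) 0 0 = 0, (c *m db) 0 0 = 0 & (c *m dc) 0 0 = 1]].
Proof.
move=> indep; pose f (i : 'I_3) :=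
  if i == 0%N :> nat then a else if i == 1%N :> nat then b else c.
pose W := \matrix_(i < 3) f i.
have Wfree : row_free W.
  apply: inj_row_free => v; rewrite mulmx_sum_row !big_ord_recl big_ord0 addr0 !rowK /f /=.
  rewrite addrA => /indep [v0 v1 v2]; apply/rowP => -[[|[|[|//]]] h]; rewrite mxE.
  - by rewrite -v0; congr (v _ _); apply: val_inj.
  - by rewrite -v1; congr (v _ _); apply: val_inj.
  - by rewrite -v2; congr (v _ _); apply: val_inj.
have WK : W *m pinvmx W = 1%:M by have := mulmxKp Wfree 1%:M; rewrite mul1mx.
have E i j : (f i *m col j (pinvmx W)) 0 0 = (i == j)%:R.
  by rewrite -[f i](rowK (fun i => f i)) -row_mul colE mulmxA -colE WK !mxE.
exists (col (inord 0) (pinvmx W)), (col (inord 1) (pinvmx W)), (col (inord 2) (pinvmx W)).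
have h i : (i < 3)%N -> (inord i : 'I_3) = i :> nat by move=> i3; rewrite inordK.
have Ef i j : (i < 3)%N -> (j < 3)%N ->
    (f (inord i) *m col (inord j) (pinvmx W)) 0 0 = (i == j)%:R.
  by move=> i3 j3; rewrite E -val_eqE /= !inordK.
have fa : f (inord 0) = a by rewrite /f inordK.
have fb : f (inord 1) = b by rewrite /f inordK.
have fc : f (inord 2) = c by rewrite /f inordK.
by split; split; rewrite -?fa -?fb -?fc Ef.
Qed.

Lemma annihilator_family (k : fieldType) n (a b c u : 'rV[k]_n) t0 :
  (forall s t w, s *: a + t *: b + w *: c = 0 -> [/\ s = 0, t = 0 & w = 0]) -> t0 != 0 ->
  (forall d d' : 'cV[k]_n,
     (forall t, ((a + t *: b + t ^+ 2 *: c) *m (t *: d - d')) 0 0 = 0) ->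
     (u *m (t0 *: d - d')) 0 0 = 0) ->
  exists s, u = s *: (a + t0 *: b + t0 ^+ 2 *: c).
Proof.
move=> indep t00 hu; set v := a + _ + _.
have [da [db [dc [[aa ab ac] [ba bb bc] [ca cb cc]]]]] := dual_columns indep.
suff ann (d : 'cV[k]_n) : (v *m d) 0 0 = 0 -> (u *m d) 0 0 = 0.
  apply/sub_rVP; rewrite submxE; apply/eqP/rowP => j; rewrite [RHS]mxE.
  have colE' (w : 'rV[k]_n) : (w *m cokermx v) 0 j = (w *m col j (cokermx v)) 0 0.
    by rewrite [LHS]mxE [RHS]mxE; apply: eq_bigr => i _; rewrite [in RHS]mxE.
  rewrite colE'; apply: ann; rewrite -colE'.
  by rewrite mulmx_coker mxE.
pose ev (w : 'rV[k]_n) (d : 'cV[k]_n) := (w *m d) 0 0.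
have evDl w w' d' : ev (w + w') d' = ev w d' + ev w' d' by rewrite /ev mulmxDl mxE.
have evZl s w d' : ev (s *: w) d' = s * ev w d' by rewrite /ev -scalemxAl mxE.
have evDr w d1 d2 : ev w (d1 + d2) = ev w d1 + ev w d2 by rewrite /ev mulmxDr mxE.
have evZr s w d' : ev w (s *: d') = s * ev w d' by rewrite /ev -scalemxAr mxE.
have evN w d' : ev w (- d') = - ev w d' by rewrite /ev mulmxN mxE.
rewrite -!/(ev _ _) in aa ab ac ba bb bc ca cb cc *; rewrite /v !(evDl, evZl).
set s1 := ev a d; set s2 := ev b d; set s3 := ev c d => sE.
pose rho := d - s1 *: da - s2 *: db - s3 *: dc.
pose d1 := - s3 *: db - (s2 + s3 * t0) *: da + t0^-1 *: rho.
pose d2 := - s3 *: dc - (s2 + s3 * t0) *: db.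
have -> : d = t0 *: d1 - d2.
  have s1E : s1 = - (t0 * s2) - t0 ^+ 2 * s3.
    by apply/eqP; rewrite -subr_eq0 opprB addrA addrC opprK -sE; apply/eqP; ring.
  apply/colP => i; rewrite /d1 /d2 /rho s1E !mxE; field; exact: t00.
apply: hu => t; rewrite -/(ev _ _) /d1 /d2 /rho !(evDl, evZl, evDr, evZr, evN).
by rewrite aa ab ac ba bb bc ca cb cc -/s1 -/s2 -/s3; ring.
Qed.

Section Injectivity.
Variables (k : closedFieldType) (char0 : [pchar k] =i pred0).
Variables (r : nat) (r2 : (2 <= r)%N) (S : 'M[k]_r.+2).
Hypotheses (symS : S^T = S) (unitS : S \in unitmx).
Variable q : {mpoly k[r.+2]}.
Hypothesis qE : forall v, value q v = bil S v v.
Local Notation B := (bil S).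
Local Notation Q := (zeros [:: q]).
Variables (p p1 : 'rV[k]_r.+2) (M M1 : 'M[k]_(r.+2, r.+1)).
Hypothesis pp : B p p != 0.
Hypothesis kerM : forall u : 'rV_r.+2, u *m M = 0 <-> exists c, u = c *: p.
Hypothesis kerM1 : forall u : 'rV_r.+2, u *m M1 = 0 <-> exists c, u = c *: p1.
Variables (E F : modsheaf k r.+1).
Variables (e : forall x, 'rV[k]_r.+1 -> ms_fib E x) (e1 : forall x, 'rV[k]_r.+1 -> ms_fib F x).
Hypotheses (pE : presented Q M e) (pF : presented Q M1 e1).
Hypothesis domE : forall x, Q x -> B (rep x) p != 0 -> ms_dom E x.
Hypothesis domF : forall x, Q x -> B (rep x) p1 != 0 -> ms_dom F x.

Lemma iso_section_sub : iso_sheaf Q E F ->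
  forall x, Q x -> B (rep x) p = 0 -> B (rep x) p1 = 0.
Proof.
move=> [Phi [PhiU PhiV]] x0 /(quadricP qE); set y := rep x0 => yy yp.
apply/eqP; apply: contraT => yp1.
have [z [p0 [c0 [[c00 pE0] [zz yz] [zp0 yp0] p0p0 nspan]]]] :=
  conic_choice char0 r2 symS unitS pp yy yp yp1.
have two := two_neq0 char0.
have [zy p0z p0y] : [/\ B z y = 1, B p0 z = 0 & B p0 y = 0] by split; rewrite bilC.
pose g := qcurve y p0 z; have gE t : \row_i (g i).[t] = y + t *: p0 + t ^+ 2 *: z.
  exact: qcurveE.
have gg t : B (\row_i (g i).[t]) (\row_i (g i).[t]) = 0.
  by rewrite gE !bilE yy zz yz zy zp0 yp0 p0z p0y p0p0; ring.
have gz t : B (\row_i (g i).[t]) z = 1 by rewrite gE !bilE yz p0z zz; ring.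
have gy t : B (\row_i (g i).[t]) y = t ^+ 2 by rewrite gE !bilE yy p0y zy; ring.
have gp t : B (\row_i (g i).[t]) p = - 2%:R * c0 * t.
  by rewrite gE pE0 !bilE yp0 p0p0 zp0; ring.
have Mp0 : p0 *m M = 0.
  by apply/kerM; exists c0^-1; rewrite pE0 scalerA mulVf // scale1r.
pose chart w := basic_open Q (lin_poly (S *m w^T)).
have chart_open w : open_in Q (chart w) := basic_open_in Q (lin_poly_homog _).
pose sec a w x := e x ((a / B (rep x) w) *: (w *m M)).
have sec_chart a w : ms_sec E (chart w) (sec a w).
  apply: (represents_sec pE (chart_open w) (a := fun x => (a / B (rep x) w) *: (w *m M))).
  apply: represents_e; apply: (vsectZ (d := -1) (e := 0)) => //.
  - exact: (chart_open w).1.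
  - apply: sectO_ext (sectOZ a (chart_open w)
      (sectO_inv (chart_open w) (lin_poly_homog (S *m w^T)) _)).
      by move=> x _; rewrite bil_lin_poly.
    by move=> x [].
  - exact: vsect_cst.
have conic_pt t : exists x c, [/\ chart z x, c != 0 & rep x = c *: \row_i (g i).[t]].
  have v0 : \row_i (g i).[t] != 0.
    by apply: contra_eq_neq (gz t) => ->; rewrite bil0l eq_sym oner_eq0.
  have [x [c [Qx c0' xE]]] := quadric_pt qE v0 (gg t); exists x, c; split=> //.
  by split=> //; rewrite bil_lin_poly xE bilZl gz mulr1.
have inf_pt : exists x c, [/\ chart y x, c != 0 & rep x = c *: z].
  have v0 : z != 0 by apply: contra_eq_neq zy => ->; rewrite bil0l eq_sym oner_eq0.
  have [x [c [Qx c0' xE]]] := quadric_pt qE v0 zz; exists x, c; split=> //.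
  by split=> //; rewrite bil_lin_poly xE bilZl zy mulr1.
pose sz := Phi (chart z) (sec 1 z); pose sy := Phi (chart y) (sec (-1) y).
have conic_dom x c t : c != 0 -> t != 0 -> rep x = c *: \row_i (g i).[t] -> Q x ->
    ms_dom E x.
  by move=> c1 t0 xE Qx; apply: domE; rewrite // xE bilZl gp !mulf_neq0 ?oppr_eq0.
have glue x c t : Q x -> c != 0 -> t != 0 -> rep x = c *: \row_i (g i).[t] ->
    ms_dom F x -> sz x = sy x.
  move=> Qx c1 t0 xE dx'; have dx := conic_dom x c t c1 t0 xE Qx.
  have oU := open_inI (chart_open z) (chart_open y); set U := _ `&` _ in oU.
  have Ux : U x.
    split; split=> //; rewrite bil_lin_poly xE bilZl ?gz ?gy.
      by rewrite mulr1.
    by rewrite mulf_neq0 ?expf_neq0.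
  have Uz : U `<=` chart z by move=> w [].
  have Uy : U `<=` chart y by move=> w [].
  have szU := sec_sub pE (chart_open z) oU Uz (sec_chart 1 z).
  have syU := sec_sub pE (chart_open y) oU Uy (sec_chart (-1) y).
  have [_ _ _ addP scaleP] := PhiU U oU.
  rewrite /sz /sy -(PhiV _ _ _ (chart_open z) oU Uz (sec_chart 1 z) x Ux dx').
  rewrite -(PhiV _ _ _ (chart_open y) oU Uy (sec_chart (-1) y) x Ux dx').
  have rc : regular Q U (fun=> -1) by exact: sectO_cst.
  have tyU := secZ pE oU rc syU.
  have := (iso_vanish pE pF PhiU PhiV oU (secD pE oU szU tyU) Ux dx dx').1.
  rewrite addP // scaleP // !scaleN1r => h; apply/eqP; rewrite -subr_eq0; apply/eqP; apply: h.
  rewrite /sec -(presB pE) //; apply/(pres_ker pE _ Qx dx).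
  exists ((c * t) ^- 2); rewrite xE !bilZl gz gy gE.
  rewrite -scalemxAl !mulmxDl -!scalemxAl Mp0 scaler0 addr0.
  by apply/rowP => i; rewrite !mxE; field; rewrite c1 t0.
pose L := lin_poly (S *m p1^T).
have L0 : value L y != 0 by rewrite bil_lin_poly.
have domL x c v : Q x -> c != 0 -> rep x = c *: v -> value L v != 0 -> ms_dom F x.
  move=> Qx c1 xE; rewrite bil_lin_poly => vp1; apply: domF => //.
  by rewrite xE bilZl mulf_neq0.
have szF : ms_sec F (chart z) sz.
  by have [h _ _ _ _] := PhiU _ (chart_open z); exact: (h _ (sec_chart 1 z)).
have syF : ms_sec F (chart y) sy.
  by have [h _ _ _ _] := PhiU _ (chart_open y); exact: (h _ (sec_chart (-1) y)).
have [t1 [t10 Lt1]] : exists t, t != 0 /\ value L (\row_i (g i).[t]) != 0.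
  apply: contrapT => none; have /eqP : 'X * along g L = 0.
    apply: (poly_fun_eq0 char0) => t; rewrite hornerM hornerX horner_along.
    apply/eqP; rewrite mulf_eq0; apply: contraT; rewrite negb_or => /andP [t0 Lt].
    by case: none; exists t.
  by rewrite mulf_eq0 polyX_eq0 (negbTE (along0 p0 z L0)).
have [x1 [c1 [Ux1 c10 x1E]]] := conic_pt t1; have Qx1 := (chart_open z).1 x1 Ux1.
have dx1 := conic_dom x1 c1 t1 c10 t10 x1E Qx1; have dx1' := domL x1 c1 _ Qx1 c10 x1E Lt1.
have [m [G [H [[hG hH] Hv GE]]]] := section_at_vec pF (chart_open z) szF Ux1 c10 x1E.
have indep s t u : s *: (y *m M1) + t *: (p0 *m M1) + u *: (z *m M1) = 0 ->
    [/\ s = 0, t = 0 & u = 0].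
  rewrite !scalemxAl -!mulmxDl => /kerM1 [d dE].
  have [d0|d0] := eqVneq d 0; last first.
    case: (nspan (d^-1 * s) (d^-1 * t) (d^-1 * u)).
    by rewrite -!scalerA -!scalerDr dE scalerA mulVf // scale1r.
  move: dE; rewrite d0 scale0r => dE.
  have := congr1 (B^~ z) dE; have := congr1 (B^~ y) dE; have := congr1 (B^~ p0) dE.
  rewrite /= !bilE yy zz yz zy zp0 yp0 p0z p0y p0p0 => e3 e2 e1'; split.
  - by rewrite -e1'; ring.
  - apply: (mulIf two); apply: (mulfI (_ : -1 != 0)); first by rewrite oppr_eq0 oner_eq0.
    by rewrite mul0r mulr0 -e3; ring.
  - by rewrite -e2; ring.
have gM t : \row_i (g i).[t] *m M1 = y *m M1 + t *: (p0 *m M1) + t ^+ 2 *: (z *m M1).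
  by rewrite gE !mulmxDl -!scalemxAl.
have [s uE] : exists s, frac_vec G H (\row_i (g i).[t1]) =
    s *: (y *m M1 + t1 *: (p0 *m M1) + t1 ^+ 2 *: (z *m M1)).
  apply: annihilator_family indep t10 _ => d d' ann.
  have : (pairing g G d d').[t1] = 0.
    rewrite (pairing_eq0 char0 pF (chart_open z) (chart_open y) szF syF conic_pt inf_pt L0
      domL glue hG hH Hv GE) ?horner0 // => t.
    by rewrite gM.
  by rewrite (horner_pairing G d d' erefl Hv) => /eqP; rewrite mulf_eq0 (negbTE Hv) => /eqP.
have szx : sz x1 = 0.
  rewrite (GE x1 c1 _ Qx1 c10 x1E Hv dx1') uE -gM; apply/(pres_ker pF _ Qx1 dx1').
  exists (c1^-1 * s * c1^-1); rewrite x1E -!scalemxAl !scalerA; congr (_ *: _).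
  by rewrite mulfVK // mulrC.
have := (iso_vanish pE pF PhiU PhiV (chart_open z) (sec_chart 1 z) Ux1 dx1 dx1').2 szx.
move/(pres_ker pE _ Qx1 dx1) => [d]; rewrite x1E bilZl gz mulr1 div1r => dE.
have [b bE] : exists b, z - (c1 * d * c1) *: \row_i (g i).[t1] = b *: p.
  apply/kerM; rewrite mulmxBl -scalemxAl -[z *m M](scalerKV c10) dE -scalemxAl !scalerA.
  by rewrite mulrA subrr.
have := congr1 (B^~ z) bE; have := congr1 (B^~ y) bE.
rewrite /= pE0 bilDl (bilDl _ z) !bilNl !(bilZl _ _ (\row__ _)) gz gy !bilE zz zy p0z p0y.
rewrite !mulr0 mulr1 add0r => e2 /eqP; rewrite oppr_eq0 => /eqP e1'.
by move: e2; rewrite e1' mul0r subr0 => /eqP; rewrite oner_eq0.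
Qed.

End Injectivity.

(** * Gram matrices, poles and projections *)

Section Equations.
Variables (k : closedFieldType) (char0 : [pchar k] =i pred0) (n : nat).
Variable q : {mpoly k[n.+2]}.
Hypotheses (hq : is_homog 2 q) (Q_smooth : jacobian_smooth [:: q]).
Implicit Types (p u v : 'rV[k]_n.+2).

Lemma dir_deriv_delta (F : {mpoly k[n.+2]}) v j :
  dir_deriv F v (delta_mx 0 j) = value F^`M(j) v.
Proof.
rewrite /dir_deriv (bigD1 j) //= mxE !eqxx mul1r big1 ?addr0 // => i ij.
by rewrite mxE (negbTE ij) andbF mul0r.
Qed.

Lemma quadric_gram : exists S : 'M[k]_n.+2, [/\ S^T = S, S \in unitmx,
  forall v, value q v = bil S v v & forall v w, dir_deriv q v w = 2%:R * bil S v w].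
Proof.
have [S symS [qE dqE]] := homog2_quad_form (two_neq0 char0) hq.
exists S; split=> //; rewrite -row_free_unit; apply: inj_row_free => v vS.
apply/eqP; apply: contraT => v0.
have vw w : bil S v w = 0 by rewrite /bil vS mul0mx mxE.
have [x [c [Qx c0 xE]]] := quadric_pt qE v0 (vw v).
have := Q_smooth Qx; set J := (\matrix_(_, _) _).
have -> : J = 0.
  apply/matrixP => i j; rewrite !mxE (ord1 i) -dir_deriv_delta dqE xE.
  by rewrite -/(bil _ _ _) bilZl vw !mulr0.
by rewrite /row_free mxrank0.
Qed.

Variable S : 'M[k]_n.+2.
Hypotheses (symS : S^T = S) (unitS : S \in unitmx).
Hypotheses (qE : forall v, value q v = bil S v v).
Hypothesis dqE : forall v w, dir_deriv q v w = 2%:R * bil S v w.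

Lemma cutting_pole l : cuts_smoothly q l ->
  exists2 p, l = lin_poly (S *m p^T) & bil S p p != 0.
Proof.
move=> [hl l0 smooth]; have [L lE] := homog1_lin_poly hl.
pose p := L^T *m invmx S; have pL : S *m p^T = L.
  by rewrite trmx_mul trmxK trmx_inv symS mulKVmx.
exists p; first by rewrite pL.
apply/eqP => pp; have p0 : p != 0.
  apply: contraNneq l0 => p0; rewrite lE -pL p0 trmx0 mulmx0 /lin_poly big1 // => i _.
  by rewrite mxE scale0r.
have [x [c [Qx c0 xE]]] := quadric_pt qE p0 pp.
have Dx : zeros [:: q; l] x.
  move=> F; rewrite !inE => /orP [/eqP ->|/eqP ->]; first by apply: Qx; rewrite inE.
  by rewrite lE -pL bil_lin_poly xE bilZl pp mulr0.
have := smooth x Dx; set J := (\matrix_(_, _) _) => Jfree.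
pose a : 'rV[k]_2 := \row_i (if i == 0 then 1 else - (2%:R * c)).
have : a *m J = 0.
  apply/rowP => j; rewrite !mxE !big_ord_recl big_ord0 !mxE /= -!dir_deriv_delta dqE.
  by rewrite lE dir_deriv_lin_poly -pL mulmxA -/(bil S _ p) xE bilZl (bilC symS p); ring.
move/eqP; rewrite mulmx_free_eq0 // => /eqP/rowP/(_ 0); rewrite !mxE eqxx => /eqP.
by rewrite oner_eq0.
Qed.

End Equations.

Lemma kernel_line (k : fieldType) N (p : 'rV[k]_N.+1) : p != 0 ->
  exists M : 'M[k]_(N.+1, N), forall u : 'rV[k]_N.+1, u *m M = 0 <-> exists c, u = c *: p.
Proof.
move=> p0; have /existsP [j0 pj0] : [exists j, p 0 j != 0].
  apply: contraNT p0; rewrite negb_exists => /forallP h.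
  by apply/eqP/rowP => i; rewrite mxE; move: (h i); rewrite negbK => /eqP.
pose M : 'M[k]_(N.+1, N) :=
  \matrix_(i, j) ((i == lift j0 j)%:R - (i == j0)%:R * (p 0 (lift j0 j) / p 0 j0)).
have ME (u : 'rV[k]_N.+1) j :
    (u *m M) 0 j = u 0 (lift j0 j) - u 0 j0 * (p 0 (lift j0 j) / p 0 j0).
  rewrite mxE; under eq_bigr => i _ do rewrite mxE mulrBr mulrA.
  rewrite sumrB; congr (_ - _).
    rewrite (bigD1 (lift j0 j)) //= eqxx mulr1 big1 ?addr0 // => i ne.
    by rewrite (negbTE ne) mulr0.
  rewrite (bigD1 j0) //= eqxx mul1r big1 ?addr0 // => i ne.
  by rewrite (negbTE ne) !mul0r mulr0.
exists M => u; split=> [uM|[c ->]]; last first.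
  by apply/rowP => j; rewrite ME !mxE; field.
exists (u 0 j0 / p 0 j0); apply/rowP => i; rewrite mxE.
case: (unliftP j0 i) => [j ->|->]; last by rewrite divfK.
by have /rowP /(_ j) := uM; rewrite ME mxE => /eqP; rewrite subr_eq0 => /eqP ->; ring.
Qed.

Lemma kernel_line_section (k : fieldType) N (p : 'rV[k]_N.+1) (M : 'M[k]_(N.+1, N)) :
  (forall u : 'rV[k]_N.+1, u *m M = 0 <-> exists c, u = c *: p) ->
  exists M' : 'M[k]_(N, N.+1), M' *m M = 1%:M.
Proof.
move=> kerM; exists (pinvmx M); apply: mulVpmx.
have : (kermx M <= p)%MS.
  apply/row_subP => i; have [|c ->] := (kerM (row i (kermx M))).1.
    by rewrite -row_mul mulmx_ker row0.
  exact: scalemx_sub.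
move/mxrankS; rewrite mxrank_ker => h; have := leq_trans h (rank_leq_row p).
by rewrite leq_subLR addn1 ltnS /row_full eqn_leq rank_leq_col.
Qed.

Section Assembly.
Variables (k : closedFieldType) (char0 : [pchar k] =i pred0) (n : nat).
Variables (S : 'M[k]_n.+2) (symS : S^T = S) (unitS : S \in unitmx).
Variable q : {mpoly k[n.+2]}.
Hypotheses (qE : forall v, value q v = bil S v v).
Local Notation B := (bil S).
Local Notation Q := (zeros [:: q]).
Variable p : 'rV[k]_n.+2.
Hypothesis pp : B p p != 0.

Lemma pole_vec_neq0 : p != 0.
Proof. by apply: contraNneq pp => ->; rewrite bil0l. Qed.

Lemma apolar_pole P : is_apolar q (lin_poly (S *m p^T)) P ->
  exists2 c, c != 0 & rep P = c *: p.
Proof.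
move=> ap; have two := two_neq0 char0.
have polE v w : polar_form q v w = B v w.
  by rewrite /polar_form !qE !bilE (bilC symS w v); field.
have [c cE] : exists c, rep P = c *: p.
  apply: (bil_orth_line unitS pole_vec_neq0) => v pv.
  have [->|v0] := eqVneq v 0; first by rewrite bil0r.
  have [x [d [d0 xE]]] := Pn_of_vec v0.
  have : polar_form q (rep P) (rep x) = 0.
    apply/ap => F; rewrite inE => /eqP ->.
    by rewrite bil_lin_poly xE bilZl bilC // pv mulr0.
  by rewrite polE xE bilZr => /eqP; rewrite mulf_eq0 (negbTE d0) => /eqP.
exists c => //; apply: contra (rep_neq0 P) => /eqP c0.
by rewrite cE c0 scale0r.
Qed.

Lemma projection_matrix P phi : is_projection_from P phi ->
  (exists2 c, c != 0 & rep P = c *: p) ->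
  exists (M : 'M[k]_(n.+2, n.+1)) (c : Pn k n.+1 -> k),
    (forall u : 'rV[k]_n.+2, u *m M = 0 <-> exists c, u = c *: p) /\
    (forall x, Q x -> c x != 0 /\ rep (phi x) = c x *: (rep x *m M)).
Proof.
move=> [A kerA phiE] [d d0 PE]; exists (lin1_mx A).
have ker u : u *m lin1_mx A = 0 <-> exists c, u = c *: p.
  rewrite mul_rV_lin1 /=; split=> [Au|[c ->]].
    have : u \in val P by rewrite -kerA memv_ker Au.
    by rewrite val_rep => /vlineP [c ->]; exists (c * d); rewrite PE scalerA.
  apply/eqP; rewrite -memv_ker kerA val_rep; apply/vlineP; exists (c / d).
  by rewrite PE scalerA divfK.
suff /choice [c cE] : forall x, exists c, Q x ->
    c != 0 /\ rep (phi x) = c *: (rep x *m lin1_mx A).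
  by exists c; split.
move=> x; have [Qx|nQ] := pselect (Q x); last by exists 0.
have xP : x != P.
  apply: contraNneq pp => xP; have /(quadricP qE) := Qx.
  rewrite xP PE bilZl bilZr => /eqP; rewrite !mulf_eq0 (negbTE d0) => /eqP -> //.
have : rep (phi x) \in val (phi x) by rewrite val_rep memv_line.
rewrite (phiE x xP) val_rep limg_line => /vlineP [c cE]; exists c => _.
rewrite mul_rV_lin1; split=> //; apply: contra (rep_neq0 (phi x)) => /eqP c0.
by rewrite cE c0 scale0r.
Qed.

End Assembly.

Theorem corollary4p6 (k : closedFieldType) (char0 : [pchar k] =i pred0)
    (n : nat) (n_ge2 : (2 <= n)%N)
    (q : {mpoly k[n.+2]}) (q_quadric : is_homog 2 q)
    (Q_smooth : jacobian_smooth [:: q]) :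
  let Q : set (Pn k n.+1) := zeros [:: q] in
  (forall l : {mpoly k[n.+2]}, cuts_smoothly q l ->
   forall P : Pn k n.+1, is_apolar q l P ->
   forall phi : Pn k n.+1 -> Pn k n, is_projection_from P phi ->
     iso_sheaf Q (Omega_log Q (zeros [:: q; l]))
       (pullback Q setT phi (TPn_twisted k n))) /\
  (forall D : set (Pn k n.+1), smooth_hyperplane_section q D ->
     is_vector_bundle Q (Omega_log Q D)) /\
  (forall D D' : set (Pn k n.+1),
     smooth_hyperplane_section q D -> smooth_hyperplane_section q D' ->
     iso_sheaf Q (Omega_log Q D) (Omega_log Q D') -> D = D').
Proof.
move=> Q; have [S [symS unitS qE dqE]] := quadric_gram char0 q_quadric Q_smooth.
have n1 : (1 <= n)%N := ltnW n_ge2.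
have pres p (pp : bil S p p != 0) M M' kerM (MK : M' *m M = 1%:M) :=
  Omega_log_presented char0 n1 symS unitS qE q_quadric dqE pp kerM MK.
split; [|split].
- move=> l /(cutting_pole symS unitS qE dqE) [p -> pp] P ap phi proj.
  have [M [c [kerM phiE]]] := projection_matrix qE pp proj
    (apolar_pole char0 symS unitS qE pp ap).
  have [M' M'K] := kernel_line_section kerM.
  apply: presented_iso (pres p pp M M' kerM M'K) _.
  apply: (pullback_presented char0 phiE) => x Qx.
  exact: (rep_mulM_neq0 qE pp kerM Qx).
- move=> D [l /(cutting_pole symS unitS qE dqE) [p -> pp] ->].
  have [M kerM] := kernel_line (pole_vec_neq0 pp).
  have [M' M'K] := kernel_line_section kerM.
  exact: presented_bundle (pres p pp M M' kerM M'K).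
- move=> D D' [l /(cutting_pole symS unitS qE dqE) [p -> pp] ->].
  move=> [l' /(cutting_pole symS unitS qE dqE) [p1 -> pp1] ->] iso.
  have [M kerM] := kernel_line (pole_vec_neq0 pp).
  have [M' M'K] := kernel_line_section kerM.
  have [M1 kerM1] := kernel_line (pole_vec_neq0 pp1).
  have [M1' M1'K] := kernel_line_section kerM1.
  have sub := iso_section_sub char0 n_ge2 symS unitS qE pp kerM kerM1
    (pres p pp M M' kerM M'K) (pres p1 pp1 M1 M1' kerM1 M1'K)
    (fun x Qx => (off_sectionP S p Qx).2) (fun x Qx => (off_sectionP S p1 Qx).2) iso.
  have [c p1E] : exists c, p1 = c *: p.
    apply: (pole_unique char0 n_ge2 symS unitS pp) => y yy yp.
    have [->|y0] := eqVneq y 0; first by rewrite bil0l.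
    have [x [d [Qx d0 xE]]] := quadric_pt qE y0 yy.
    have := sub x Qx; rewrite xE !bilZl yp mulr0 => /(_ erefl)/eqP.
    by rewrite mulf_eq0 (negbTE d0) => /eqP.
  have c0 : c != 0 by apply: contraNneq pp1 => c0; rewrite p1E c0 scale0r bil0l.
  apply/seteqP; split=> x /sectionP [Qx xp]; apply/sectionP; split=> //.
    by rewrite p1E bilZr xp mulr0.
  by apply: (mulfI c0); rewrite mulr0 -bilZr -p1E.
Qed.
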